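(* Let $\psi$ be a conservative branching mechanism with parameter $(\tilde\alpha,\beta,\pi)$ such that $\beta\neq0$ or $\pi\neq0$. Let $q\in\mathbb R$ be such that either $q\ge 0$, or $q<0$ and $\int_{(1,+\infty)}\ell\, e^{|q|\ell}\,\pi(d\ell)<+\infty$. For $x\ge 0$ let $Z=(Z_a,a\ge0)$ be, under $\mathrm P_x^\psi$, a continuous state branching process with branching mechanism $\psi$ started at $x$, with filtration $\mathcal F=(\mathcal F_a,a\ge0)$, and set $$M_a^{\psi,q}=\exp\Big(qx-qZ_a-\psi(q)\int_0^aZ_s\,ds\Big),\qquad a\ge0.$$ (i) The process $M^{\psi,q}=(M^{\psi,q}_a,a\ge0)$ is an $\mathcal F$-martingale under $\mathrm P_x^\psi$. (ii) Let $a,x\ge0$. On $\mathcal F_a$, the probability measure $\mathrm P_x^{\psi_q}$ is absolutely continuous with respect to $\mathrm P_x^\psi$ and $$\frac{d\mathrm P^{\psi_q}_x{}_{|\mathcal F_a}}{d\mathrm P^{\psi}_x{}_{|\mathcal F_a}}=M_a^{\psi,q}.$$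
   Context: A branching mechanism with parameter $(\tilde\alpha,\beta,\pi)$ is a function $\psi(\lambda)=\tilde\alpha\lambda+\beta\lambda^2+\int_{(0,\infty)}\pi(d\ell)\,[e^{-\lambda\ell}-1+\lambda\ell\mathbf 1_{\{\ell\le1\}}]$, where $\tilde\alpha\in\mathbb R$, $\beta\ge0$ and $\pi$ is a Radon measure on $(0,\infty)$ with $\int_{(0,\infty)}(1\wedge\ell^2)\pi(d\ell)<\infty$. It is defined for $\lambda\ge0$, and the same formula defines $\psi(\lambda)$ for those $\lambda<0$ for which $\int_{(1,\infty)}e^{-\lambda\ell}\pi(d\ell)<\infty$. It is conservative if $\int_0^\varepsilon\frac{du}{|\psi(u)|}=+\infty$ for all $\varepsilon>0$. For $q$ such that $\psi(q)$ is defined, $\psi_q(\lambda)=\psi(\lambda+q)-\psi(q)$, $\lambda\ge 0$; under the hypotheses on $q$ in the claim this is again a conservative branching mechanism. $\mathrm P^\psi_x$ denotes the law of the continuous state branching process (CB) with branching mechanism $\psi$ started at $x\ge0$: the càdlàg $[0,\infty)$-valued Feller process $Z$ with $Z_0=x$ and $\mathrm E_x^\psi[e^{-\lambda Z_a}]=e^{-xu(a,\lambda)}$ for $a,\lambda\ge0$, where $u$ is the unique nonnegative solution of $u(a,\lambda)+\int_0^a\psi(u(s,\lambda))\,ds=\lambda$. $\mathcal F$ is the filtration generated by $Z$, completed in the usual way. *)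

(* Defs.v *)
From HB Require Import structures.
From mathcomp Require Import all_boot all_order all_algebra.
From mathcomp Require Import all_classical all_reals all_analysis.

Set Implicit Arguments.
Unset Strict Implicit.
Unset Printing Implicit Defensive.

Import Order.TTheory GRing.Theory Num.Theory.
Import numFieldNormedType.Exports.

Local Open Scope classical_set_scope.
Local Open Scope ring_scope.

(* [pi] is a Borel measure on the whole line, but only its restriction to
   (0,oo) is ever used. A Borel measure on (0,oo) which is finite on compact
   sets is automatically regular, i.e. Radon. *)
Definition levy_measure (R : realType) (pi : {measure set R -> \bar R}) : Prop :=
  (forall K : set R, compact K -> K `<=` `]0, +oo[ -> (pi K < +oo)%E) /\
  (\int[pi]_(l in `]0%R, +oo[) (Num.min 1 (l ^+ 2))%:E < +oo)%E.

(* The integral is the total real-valued one: it is meaningful for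
   [0 <= lam], and for those [lam < 0] at which [expR (- lam * l)] is
   [pi]-integrable on (1,oo). *)
Definition psi (R : realType) (alpha beta : R) (pi : {measure set R -> \bar R})
    (lam : R) : R :=
  alpha * lam + beta * lam ^+ 2 +
  \int[pi]_(l in `]0, +oo[)
    (expR (- lam * l) - 1 + lam * l * (l <= 1)%R%:R).

(* The inverse is taken in the extended reals, where [0^-1 = +oo]. *)
Definition conservative (R : realType) (f : R -> R) : Prop :=
  forall e : R, 0 < e ->
    (\int[lebesgue_measure]_(u in `]0%R, e]) (`|f u|%:E)^-1 = +oo)%E.

Definition shift_mechanism (R : realType) (f : R -> R) (q : R) : R -> R :=
  fun lam => f (lam + q) - f q.

(* For a conservative branching mechanism [f] these requirements determine
   [u a lam] uniquely for [0 <= a] and [0 <= lam]. *)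
Definition laplace_exponent (R : realType) (f : R -> R) (u : R -> R -> R) : Prop :=
  forall lam : R, 0 <= lam ->
    (forall a, 0 <= a -> 0 <= u a lam) /\
    (forall a, 0 <= a ->
       lebesgue_measure.-integrable `[0, a] (fun s => (f (u s lam))%:E) /\
       u a lam + \int[lebesgue_measure]_(s in `[0, a]) f (u s lam) = lam).

Definition C0_half_line (R : realType) (g : R -> R) : Prop :=
  {within `[0, +oo[, continuous g} /\ g x @[x --> +oo] --> (0 : R).

Definition transition_op (R : realType) (k : R.-pker R ~> R) (g : R -> R) : R -> R :=
  fun y => \int[k y]_(z in `[0, +oo[) g z.

(* A Feller semigroup on the state space [0,oo). The kernels live on the whole
   line; their values at negative starting points and negative times are
   irrelevant. *)
Definition feller_semigroup (R : realType) (p : R -> R.-pker R ~> R) : Prop :=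
  [/\ forall t y : R, 0 <= t -> 0 <= y -> p t y `[0, +oo[%classic = 1%E,
      forall (y : R) (B : set R), 0 <= y -> measurable B -> p 0 y B = \d_y B,
      forall (s t y : R) (B : set R), 0 <= s -> 0 <= t -> 0 <= y ->
        measurable B -> p (s + t) y B = (\int[p s y]_(z in `[0%R, +oo[) p t z B)%E,
      forall (t : R) (g : R -> R), 0 <= t -> C0_half_line g ->
        C0_half_line (transition_op (p t) g) &
      forall g : R -> R, C0_half_line g -> forall e : R, 0 < e ->
        \forall t \near 0^'+, forall y, 0 <= y ->
          `|transition_op (p t) g y - g y| <= e].

Definition cadlag (R : realType) (w : R -> R) : Prop :=
  (forall t, 0 <= t -> w s @[s --> t^'+] --> w t) /\
  (forall t, 0 < t -> cvg (w s @[s --> t^'-])).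

Definition natural_filtration (R : realType) (T : Type) (Z : R -> T -> R)
    (a : R) : set (set T) :=
  <<s [set A | exists s : R, exists B : set R,
         [/\ 0 <= s <= a, measurable B & A = Z s @^-1` B] ]>>.

(* Under [P], [Z] is a CB process with branching mechanism [f] started at [x].
   At [s = 0] the Markov property and [Z_0 = x] give
   E[exp(- lam Z_a)] = exp(- x u(a,lam)). *)
Definition is_CB (R : realType) (d : measure_display) (T : measurableType d)
    (f : R -> R) (x : R) (P : probability T R) (Z : R -> T -> R) : Prop :=
  [/\ forall t, 0 <= t -> measurable_fun setT (Z t),
      forall t w, 0 <= t -> 0 <= Z t w,
      forall w, cadlag (Z ^~ w),
      {ae P, forall w, Z 0 w = x} &
      exists (u : R -> R -> R) (p : R -> R.-pker R ~> R),
        [/\ laplace_exponent f u,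
            feller_semigroup p,
            forall a y lam : R, 0 <= a -> 0 <= y -> 0 <= lam ->
              (\int[p a y]_(z in `[0%R, +oo[) (expR (- lam * z))%:E =
                (expR (- y * u a lam))%:E)%E &
            forall (s t : R) (B : set R) (A : set T),
              0 <= s -> 0 <= t -> measurable B -> natural_filtration Z s A ->
              P (A `&` Z (s + t) @^-1` B) = (\int[P]_(w in A) p t (Z s w) B)%E] ].

(* The ambient sigma-algebra is not assumed to be [P]-complete: the completion
   is taken inside it, and is the full one when it contains all subsets of the
   [P]-null sets of [N]. *)
Definition completion (R : realType) (d : measure_display) (T : measurableType d)
    (P : probability T R) (N G : set (set T)) : set (set T) :=
  [set A | measurable A /\
    exists B N0 : set T, [/\ G B, N N0, P N0 = 0%E & A `+` B `<=` N0] ].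

(* F_a is the [P]-completion of the sigma-algebra generated by (Z_s, s <= a).
   The null sets of the whole sigma-algebra cannot be added here when changing
   measure on F_a: the laws of the processes with mechanisms psi and psi_q are
   in general not absolutely continuous on sigma(Z_s, s >= 0), hence would not
   be so on any F_a containing all of its null sets. *)
Definition completed_filtration (R : realType) (d : measure_display)
    (T : measurableType d) (P : probability T R) (Z : R -> T -> R)
    (a : R) : set (set T) :=
  completion P (natural_filtration Z a) (natural_filtration Z a).

(* The usual augmentation, for statements involving a single measure. *)
Definition augmented_filtration (R : realType) (d : measure_display)
    (T : measurableType d) (P : probability T R) (Z : R -> T -> R)
    (a : R) : set (set T) :=
  completion P measurable (natural_filtration Z a).

Definition measurable_wrt (R : realType) (T : Type) (F : set (set T))
    (X : T -> R) : Prop :=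
  forall B : set R, measurable B -> F (X @^-1` B).

(* Conditional expectation is spelled out through its defining identity. *)
Definition martingale (R : realType) (d : measure_display) (T : measurableType d)
    (P : probability T R) (F : R -> set (set T)) (M : R -> T -> R) : Prop :=
  [/\ forall a, 0 <= a -> measurable_wrt (F a) (M a),
      forall a, 0 <= a -> P.-integrable setT (EFin \o M a) &
      forall s t A, 0 <= s -> s <= t -> F s A ->
        (\int[P]_(w in A) (M t w)%:E = \int[P]_(w in A) (M s w)%:E)%E].

Definition dominated_on (R : realType) (d : measure_display)
    (T : measurableType d) (F : set (set T)) (Q P : probability T R) : Prop :=
  forall A, F A -> P A = 0%E -> Q A = 0%E.

Definition density_on (R : realType) (d : measure_display)
    (T : measurableType d) (F : set (set T)) (Q P : probability T R)
    (D : T -> R) : Prop :=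
  measurable_wrt F D /\
  forall A, F A -> Q A = (\int[P]_(w in A) (D w)%:E)%E.

Definition exp_process (R : realType) (T : Type) (f : R -> R) (q x : R)
    (Z : R -> T -> R) (a : R) (w : T) : R :=
  expR (q * x - q * Z a w - f q * \int[lebesgue_measure]_(s in `[0, a]) Z s w).

(* Main.v *)
Require Import Defs.
From HB Require Import structures.
From mathcomp Require Import all_boot all_order all_algebra.
From mathcomp Require Import all_classical all_reals all_analysis.
From mathcomp Require Import finmap measurable_realfun ring lra.
Import Order.TTheory GRing.Theory Num.Theory.
Import numFieldNormedType.Exports.
Local Open Scope classical_set_scope.
Local Open Scope ring_scope.

(** Let [f] be the mechanism, [u] its flow, and write
[W c t = exp (- c Z_t - f(q) int_0^t Z_s ds)], so that the process of the theorem is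
[M_t = exp (q x) W q t].

The Markov property gives [E[exp (- lam Z_{t+h}) | F_t] = exp (- u(h,lam) Z_t)],
and [f] is the generator of [u]. Hence, for an adapted [D] with right derivative
[D'] and a positive function [v], the mean of [D_t exp (- v(t) Z_t)] has right
derivative [E[exp (- v Z) ((f(v) - v') Z D + D')]] ([functional_rderive]). For
[D_t = exp (- f(q) int_0^t Z)] this vanishes as soon as [v' = f(v) - f(q)], and then
[W (v t) t] is constant in conditional mean ([exp_functional_martingale]; the path
integral is approximated by bounded ones). The constant solution [v = q] gives (i)
for [q >= 0]. The solutions [v = q + u'(T - t, lam)], where [u'] is the flow of the
shifted mechanism, say that under the measure with density [M] the process is
Markov with flow [u']. Since exponentials determine the law of a nonnegative
process, here through an induction over the cylinder sets, that measure and the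
law [Q] agree on the past: this is (ii) for [q >= 0] ([girsanov_natural]).

For [q = - theta < 0] no Laplace exponent is available at [q]. The function
[exp (theta z)] is the limit of polynomials in [exp (- z / n)], on which the
generator acts termwise, and each polynomial gives a bounded martingale
([tilted_martingale]) which tends to [W q t]. Part (i) follows from uniform
integrability ([entropy_cvg]): the logarithm of the martingale is bounded by
[theta g(Z_t) + C int_0^t g(Z_s) ds] with [g(z) = n (1 - exp (- z / n))], and under
the measure that has the martingale as density the mean of [g(Z_t)] grows at most
exponentially, uniformly in [n]. The last point is where the integrability of
[l exp (theta l)] at infinity enters ([tilt_saturation_generator], [moment_growth]).

For (ii) with [q < 0] the measures exchange their roles. The mechanism of [Q]
shifted by [- q > 0] is that of [P], so the case already treated gives the density
[1 / M] of [P] with respect to [Q] on the past, and this density is inverted.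

All identities are first proved for the natural sigma-algebras and then carried
over to their completions. *)

Set Implicit Arguments.
Unset Strict Implicit.
Unset Printing Implicit Defensive.

(** * Right derivatives *)

Definition is_rderive {R : realType} (f : R -> R) (t l : R) : Prop :=
  (f (t + h) - f t) / h @[h --> 0^'+] --> l.

Lemma rderive_cst {R : realType} (c t : R) : is_rderive (fun=> c) t 0.
Proof.
rewrite /is_rderive; under eq_fun do rewrite subrr mul0r.
exact: cvg_cst.
Qed.

Lemma rderiveD {R : realType} (f g : R -> R) (t a b : R) :
  is_rderive f t a -> is_rderive g t b -> is_rderive (fun s => f s + g s) t (a + b).
Proof.
rewrite /is_rderive => fa gb.
rewrite (_ : (fun h => _) = (fun h => (f (t + h) - f t) / h) \+
    (fun h => (g (t + h) - g t) / h)); first exact: cvgD.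
by apply/funext => h /=; rewrite -mulrDl opprD addrACA.
Qed.

Lemma rderiveZ {R : realType} (c : R) (f : R -> R) (t a : R) :
  is_rderive f t a -> is_rderive (fun s => c * f s) t (c * a).
Proof.
rewrite /is_rderive => fa.
rewrite (_ : (fun h => _) = (fun h => c * ((f (t + h) - f t) / h))).
  exact: cvgMl_tmp.
by apply/funext => h /=; rewrite mulrA mulrBr.
Qed.

Lemma rderive_sum {R : realType} (n : nat) (f : nat -> R -> R) (t : R) (a : nat -> R) :
  (forall i, is_rderive (f i) t (a i)) ->
  is_rderive (fun s => \sum_(i < n) f i s) t (\sum_(i < n) a i).
Proof.
move=> fa; elim: n => [|n ih].
  rewrite big_ord0 (_ : (fun s => _) = fun=> 0); first exact: rderive_cst.
  by apply/funext => s; rewrite big_ord0.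
rewrite big_ord_recr (_ : (fun s => _) = fun s => \sum_(i < n) f i s + f n s).
  exact: rderiveD.
by apply/funext => s; rewrite big_ord_recr.
Qed.

Lemma rderive_cvg {R : realType} (f : R -> R) (t a : R) :
  is_rderive f t a -> f (t + h) @[h --> 0^'+] --> f t.
Proof.
move=> fa.
have : (f t + h * ((f (t + h) - f t) / h)) @[h --> 0^'+] --> f t + 0 * a.
  apply: cvgD; first exact: cvg_cst.
  apply: cvgM fa; apply: cvg_at_right_filter; exact: cvg_id.
rewrite mul0r addr0; apply: cvg_trans; apply: near_eq_cvg.
near=> h.
have h0 : h != 0 by apply: lt0r_neq0; near: h; exact: nbhs_right_gt.
by rewrite mulrCA divff// mulr1 addrC subrK.
Unshelve. all: by end_near. Qed.

Lemma rderiveM {R : realType} (f g : R -> R) (t a b : R) :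
  is_rderive f t a -> is_rderive g t b ->
  is_rderive (fun s => f s * g s) t (a * g t + f t * b).
Proof.
move=> fa gb.
have H : ((f (t + h) - f t) / h * g (t + h) + f t * ((g (t + h) - g t) / h))
    @[h --> 0^'+] --> a * g t + f t * b.
  apply: cvgD; first exact: cvgM fa (rderive_cvg gb).
  by apply: cvgM gb; exact: cvg_cst.
rewrite /is_rderive (_ : (fun h => _) = fun h =>
  (f (t + h) - f t) / h * g (t + h) + f t * ((g (t + h) - g t) / h))//.
by apply/funext => h; ring.
Qed.

(** The difference quotient of [expR] extends continuously to the diagonal,
which avoids a case distinction on [f (t + h) = f t]. *)
Lemma rderive_expR {R : realType} (f : R -> R) (t a : R) :
  is_rderive f t a -> is_rderive (fun s => expR (f s)) t (expR (f t) * a).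
Proof.
move=> fa.
pose G (y : R) := if y == f t then expR (f t) else (expR y - expR (f t)) / (y - f t).
have GE y : expR y - expR (f t) = G y * (y - f t).
  rewrite /G; case: eqP => [->|/eqP yf]; first by rewrite !subrr mulr0.
  by rewrite divfK// subr_eq0.
have G0 : G y @[y --> f t] --> expR (f t).
  have : h^-1 *: (expR (h *: 1 + f t) - expR (f t)) @[h --> 0^'] --> expR (f t).
    by rewrite -[X in _ --> X](@derive_val _ _ _ (f t) 1 expR); exact: derivable_expR.
  move=> /cvgrPdist_lt H; apply/cvgrPdist_lt => e e0.
  have /= := H e e0; rewrite near_withinE => /nbhs_ballP[r /= r0 Hr].
  apply/nbhs_ballP; exists r => //= y; rewrite /ball/= => yr.
  rewrite /G; case: eqP => [_|/eqP yf].
    by rewrite subrr normr0.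
  have := Hr (y - f t); rewrite /ball/= sub0r normrN distrC => /(_ yr).
  rewrite subr_eq0 => /(_ yf); rewrite scaler1 subrK.
  by rewrite /GRing.scale/= mulrC.
have : (G (f (t + h)) * ((f (t + h) - f t) / h)) @[h --> 0^'+] --> expR (f t) * a.
  apply: cvgM => //; apply: cvg_comp G0; exact: rderive_cvg fa.
rewrite /is_rderive; apply: cvg_trans; apply: near_eq_cvg; near=> h => /=.
by rewrite mulrA -GE.
Unshelve. all: by end_near. Qed.

(** Only the right derivative is available for the expectations below, whose
increments are governed by the Markov property. *)
Lemma rderive_nonincreasing {R : realType} (f : R -> R) (a b : R) :
  a <= b -> {within `[a, b], continuous f} ->
  (forall t, a <= t < b -> exists2 l, is_rderive f t l & l <= 0) ->
  f b <= f a.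
Proof.
rewrite le_eqVlt => /predU1P[->//|ab] cf df.
apply/ler_addgt0Pr => e e0.
pose d := e / (b - a); have d0 : 0 < d by rewrite divr_gt0// subr_gt0.
suff : f b - f a <= d * (b - a).
  by rewrite /d divfK ?subr_eq0 ?gt_eqF// lerBlDr addrC.
pose g t := f t - f a - d * (t - a).
have cg : {within `[a, b], continuous g}.
  have cl : continuous (fun t : R => d * (t - a)).
    by move=> t; apply: cvgM; [exact: cvg_cst|apply: cvgB; [exact: cvg_id|exact: cvg_cst]].
  move=> x; apply: (@cvgB _ R^o); last exact: (continuous_subspaceT cl).
  by apply: (@cvgB _ R^o); [exact: cf|exact: cvg_cst].
suff : g b <= 0 by rewrite /g subr_le0.
pose S := [set t | a <= t <= b /\ forall r, a <= r <= t -> g r <= 0].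
have Sa : S a.
  split; first by rewrite lexx ltW.
  move=> r; rewrite -eq_le => /eqP <-.
  by rewrite /g !subrr mulr0 subr0.
have supS : has_sup S.
  by split; [exists a | exists b => t -[/andP[]]].
pose s := sup S.
have as_ : a <= s by apply: ub_le_sup => //; case: supS.
have sb : s <= b by apply: ge_sup; [case: supS|move=> t -[/andP[]]].
have below r : a <= r -> r < s -> g r <= 0.
  move=> ar rs; have [t St rt] := sup_gt (proj1 supS) rs.
  by case: St => _; apply; rewrite ar ltW.
have gs : g s <= 0.
  move: as_; rewrite le_eqVlt => /predU1P[<-|as_].
    by rewrite /g !subrr mulr0 subr0.
  have gcs : g x @[x --> s^'-] --> g s.
    move: sb; rewrite le_eqVlt => /predU1P[->|sb].
      by have /(continuous_within_itvP _ ab)[_ _ +] := cg.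
    have /(continuous_within_itvP _ ab)[+ _ _] := cg.
    move=> /(_ s); rewrite in_itv/= as_ sb => /(_ isT) h.
    exact: cvg_at_left_filter.
  apply: (@closed_cvg _ _ (s^'-) _ g [set y | y <= 0] (@closed_le R 0) _ _ gcs).
  near=> r; apply: below.
    by near: r; exact: nbhs_left_ge.
  by near: r; exact: nbhs_left_lt.
suff -> : b = s by [].
apply/eqP; rewrite eq_le sb andbT leNgt; apply/negP => sltb.
have /df[l dl l0] : a <= s < b by rewrite as_ sltb.
have /cvgrPdist_lt /(_ d d0) H := dl.
have [r r0 Hr] : exists2 r, 0 < r & forall h, 0 < h < r -> g (s + h) <= 0.
  move: H => [r /= r0 Hr]; exists r => // h /andP[h0 hr].
  have := Hr h; rewrite /= sub0r normrN gtr0_norm// => /(_ hr h0).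
  rewrite ltr_norml => /andP[Hl _].
  have : (f (s + h) - f s) / h <= d by move: Hl; set X := _ / h => Hl; lra.
  rewrite ler_pdivrMr// => K.
  move: gs; rewrite /g; move: K; nra.
have : S (Num.min b (s + r / 2)).
  split; first by rewrite le_min ge_min lexx/= ltW ?(le_trans as_)//; lra.
  move=> t /andP[at_]; rewrite le_min => /andP[tb tsr].
  have [ts|st] := leP t s.
    by move: ts; rewrite le_eqVlt => /predU1P[->//|]; exact: below.
  by rewrite (_ : t = s + (t - s)); last ring; apply: Hr; apply/andP; split; lra.
move=> /(ub_le_sup (proj2 supS)); rewrite -/s ge_min leNgt sltb/=.
by rewrite gerDl leNgt divr_gt0.
Unshelve. all: by end_near. Qed.

Lemma rderive_id {R : realType} (t : R) : is_rderive id t 1.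
Proof.
have H : (1 : R) @[_ --> (0 : R)^'+] --> (1 : R) by exact: cvg_cst.
rewrite /is_rderive; apply: (cvg_trans _ H); apply: near_eq_cvg; near=> h.
have h0 : h != 0 by apply: lt0r_neq0; near: h; exact: nbhs_right_gt.
by rewrite addrAC subrr add0r divff.
Unshelve. all: by end_near. Qed.

Lemma rderive_lin {R : realType} (c t : R) : is_rderive (fun s => c * s) t c.
Proof. by rewrite -[X in is_rderive _ _ X]mulr1; apply: rderiveZ; exact: rderive_id. Qed.

Lemma continuous_lin {R : realType} (c : R) : continuous (fun s : R => c * s).
Proof. by move=> t; apply: cvgM; [exact: cvg_cst|exact: cvg_id]. Qed.

Lemma rderive_upper {R : realType} (f : R -> R) (K a b : R) :
  a <= b -> {within `[a, b], continuous f} ->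
  (forall t, a <= t < b -> exists2 l, is_rderive f t l & l <= K) ->
  f b - f a <= K * (b - a).
Proof.
move=> ab cf df.
have : f b + - K * b <= f a + - K * a; last by lra.
apply: (rderive_nonincreasing (f := fun t => f t + - K * t)) => //.
  move=> x; apply: (@cvgD _ R^o); first exact: cf.
  exact: (continuous_subspaceT (@continuous_lin R (- K))).
move=> t /df[l fl lK]; exists (l + - K); last by rewrite subr_le0.
by apply: rderiveD => //; exact: rderive_lin.
Qed.

Lemma rderive_lip {R : realType} (f : R -> R) (K a b : R) :
  a <= b -> {within `[a, b], continuous f} ->
  (forall t, a <= t < b -> exists2 l, is_rderive f t l & `|l| <= K) ->
  `|f b - f a| <= K * (b - a).
Proof.
move=> ab cf df; rewrite ler_norml; apply/andP; split.
  have : -1 * f b - -1 * f a <= K * (b - a); last by lra.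
  apply: (rderive_upper (f := fun t => -1 * f t)) => //.
    move=> x; apply: cvgM; [exact: cvg_cst|exact: cf].
  move=> t /df[l fl]; rewrite ler_norml => /andP[lK _]; exists (-1 * l).
    exact: rderiveZ.
  by lra.
apply: rderive_upper => // t /df[l fl]; rewrite ler_norml => /andP[_ lK].
by exists l.
Qed.

Lemma rderive_gronwall {R : realType} (f : R -> R) (C a b : R) :
  a <= b -> {within `[a, b], continuous f} ->
  (forall t, a <= t < b -> exists2 l, is_rderive f t l & l <= C * f t) ->
  f b <= expR (C * (b - a)) * f a.
Proof.
move=> ab cf df.
have : expR (- C * b) * f b <= expR (- C * a) * f a.
  apply: (rderive_nonincreasing (f := fun t => expR (- C * t) * f t)) => //.
    move=> x; apply: cvgM; last exact: cf.
    have ce : continuous (fun t : R => expR (- C * t)).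
      move=> t; apply: (@continuous_comp _ _ _ (fun t : R => - C * t) expR).
        exact: continuous_lin.
      exact: continuous_expR.
    exact: (continuous_subspaceT ce).
  move=> t /df[l fl lC].
  exists (expR (- C * t) * (- C) * f t + expR (- C * t) * l).
    by apply: rderiveM => //; apply: rderive_expR; exact: rderive_lin.
  rewrite -mulrA -mulrDr mulr_ge0_le0 ?expR_ge0//; lra.
rewrite -(ler_pM2l (expR_gt0 (C * b))) !mulrA -!expRD.
rewrite (_ : C * b + - C * b = 0) ?expR0 ?mul1r; last by ring.
by rewrite (_ : C * b + - C * a = C * (b - a)); last by ring.
Qed.

(** * Exponential inequalities *)

Lemma mul_expRN_le {R : realType} (c z : R) : 0 < c -> z * expR (- c * z) <= c^-1.
Proof.
move=> c0; rewrite -(ler_pM2l c0) divff ?gt_eqF// mulNr expRN mulrA.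
rewrite ler_pdivrMr ?expR_gt0// mul1r.
by have := expR_ge1Dx (c * z); lra.
Qed.

Lemma expR_sub1_le {R : realType} (x : R) : expR x - 1 <= x * expR x.
Proof.
have := expR_ge1Dx (- x); rewrite expRN => h.
have := ler_wpM2l (expR_ge0 x) h; rewrite divff ?gt_eqF ?expR_gt0//; lra.
Qed.

Lemma expR_taylor2 {R : realType} (x : R) :
  `|expR x - 1 - x| <= x ^+ 2 * expR `|x|.
Proof.
rewrite ger0_norm; last by have := expR_ge1Dx x; lra.
have h := expR_sub1_le x; have h1 := expR_ge1Dx x.
apply: (@le_trans _ _ (x * (expR x - 1))); first by lra.
have [x0|x0] := leP 0 x.
  rewrite ger0_norm//.
  by have := ler_wpM2l x0 h; lra.
apply: (@le_trans _ _ (x ^+ 2)).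
  by have := ler_wnM2l (ltW x0) h1; lra.
have : 1 <= expR `|x| by rewrite -expR0 ler_expR.
by have := sqr_ge0 x; nra.
Qed.

Lemma expRN_lip {R : realType} (c a b z : R) : 0 < c -> c <= a -> c <= b -> 0 <= z ->
  `|expR (- a * z) - expR (- b * z)| <= `|a - b| / c.
Proof.
wlog ab : a b / a <= b.
  move=> H c0 ca cb z0; have [ab|ba] := leP a b; first exact: H.
  by rewrite distrC (distrC a); apply: H => //; exact: ltW.
move=> c0 ca cb z0; rewrite ger0_norm; last first.
  by rewrite subr_ge0 ler_expR ler_wpM2r// lerN2.
rewrite ler0_norm ?subr_le0// opprB.
rewrite (_ : - b * z = - a * z + - ((b - a) * z)); last by ring.
rewrite expRD -{1}[expR (- a * z)]mulr1 -mulrBr.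
apply: (@le_trans _ _ (expR (- c * z) * ((b - a) * z))).
  apply: ler_pM; rewrite ?expR_ge0//.
  - by rewrite subr_ge0 expR_le1 oppr_le0 mulr_ge0// subr_ge0.
  - by rewrite ler_expR ler_wpM2r// lerN2.
  - by have := expR_ge1Dx (- ((b - a) * z)); lra.
have := mul_expRN_le z c0; have : 0 <= b - a by rewrite subr_ge0.
by nra.
Qed.

(** * Real-valued integrals *)

Lemma bounded_integrable d (T : measurableType d) (R : realType)
    (mu : {measure set T -> \bar R}) (D : set T) (f : T -> R) (B : R) :
  measurable D -> (mu D < +oo)%E -> measurable_fun D f ->
  (forall x, D x -> `|f x| <= B) -> mu.-integrable D (EFin \o f).
Proof.
move=> mD muD mf fB; apply: measurable_bounded_integrable => //.
exists B; split; first exact: num_real.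
by move=> M BM x Dx /=; apply: (le_trans (fB x Dx)); exact: ltW.
Qed.

Lemma dominated_integrable_real d (T : measurableType d) (R : realType)
    (mu : {measure set T -> \bar R}) (D : set T) (f g : T -> R) :
  measurable D -> measurable_fun D f -> mu.-integrable D (EFin \o g) ->
  (forall x, D x -> `|f x| <= g x) -> mu.-integrable D (EFin \o f).
Proof.
move=> mD mf ig fg; apply: le_integrable ig => //; first exact/measurable_EFinP.
move=> x Dx /=; rewrite lee_fin; apply: (le_trans (fg x Dx)); exact: ler_norm.
Qed.

Lemma Rintegral_dominated_cvg d (T : measurableType d) (R : realType)
    (mu : {measure set T -> \bar R}) (D : set T) (F : nat -> T -> R) (f g : T -> R) :
  measurable D -> (forall n, measurable_fun D (F n)) ->
  (forall x, D x -> F n x @[n --> \oo] --> f x) ->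
  mu.-integrable D (EFin \o g) -> (forall n x, D x -> `|F n x| <= g x) ->
  \int[mu]_(x in D) F n x @[n --> \oo] --> \int[mu]_(x in D) f x.
Proof.
move=> mD mF Ff ig Fg.
have mf : measurable_fun D f by apply: measurable_fun_cvg mF Ff.
have [||||| iF _ H] := @dominated_convergence _ T R mu D mD
  (fun n => EFin \o F n) (EFin \o f) (EFin \o g).
- by move=> n; exact/measurable_EFinP.
- exact/measurable_EFinP.
- apply/aeW => x Dx; apply: cvg_EFin; first exact: nearW.
  exact: Ff.
- exact: ig.
- by apply/aeW => x n Dx /=; rewrite lee_fin; exact: Fg.
have fi : (\int[mu]_(x in D) (f x)%:E)%E \is a fin_num by exact: integrable_fin_num.
by apply: fine_cvg; rewrite fineK.
Qed.

Lemma Rintegral_dominated_at_right d (T : measurableType d) (R : realType)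
    (mu : {measure set T -> \bar R}) (D : set T) (F : R -> T -> R) (f g : T -> R) (r : R) :
  measurable D -> 0 < r -> (forall h, 0 < h < r -> measurable_fun D (F h)) ->
  (forall x, D x -> F h x @[h --> 0^'+] --> f x) ->
  mu.-integrable D (EFin \o g) ->
  (forall h x, 0 < h < r -> D x -> `|F h x| <= g x) ->
  \int[mu]_(x in D) F h x @[h --> 0^'+] --> \int[mu]_(x in D) f x.
Proof.
move=> mD r0 mF Ff ig Fg; apply/cvg_at_rightP => u [u0 cu].
have [N _ Nr] : \forall n \near \oo, u n < r.
  by apply: (cvgr_lt (0 : R)).
rewrite -(cvg_shiftn N) /=.
apply: (@Rintegral_dominated_cvg _ _ _ mu D (fun n => F (u (n + N)%N)) f g) => //.
- by move=> n; apply: mF; rewrite u0 Nr//= leq_addl.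
- move=> x Dx; have /cvg_at_rightP/(_ u (conj u0 cu)) := Ff x Dx.
  by rewrite -(cvg_shiftn N).
- by move=> n x Dx; apply: Fg => //; rewrite u0 Nr//= leq_addl.
Qed.

Lemma Rintegral_sum d (T : measurableType d) (R : realType)
    (mu : {measure set T -> \bar R}) (D : set T) (n : nat) (f : nat -> T -> R) :
  measurable D -> (forall i, mu.-integrable D (EFin \o f i)) ->
  \int[mu]_(x in D) (\sum_(i < n) f i x) = \sum_(i < n) \int[mu]_(x in D) f i x.
Proof.
move=> mD iF; elim: n => [|n ih].
  rewrite big_ord0; under eq_Rintegral do rewrite big_ord0.
  by rewrite Rintegral_cst// mul0r.
rewrite big_ord_recr/= -ih -RintegralD//.
  by apply: eq_Rintegral => x _; rewrite big_ord_recr.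
have -> : EFin \o (fun x => \sum_(i < n) f i x) =
    (fun x => \sum_(i < n) (EFin \o f i) x)%E.
  by apply/funext => x /=; rewrite sumEFin.
exact: integrable_sum.
Qed.

Lemma Rintegral_le0 d (T : measurableType d) (R : realType)
    (mu : {measure set T -> \bar R}) (D : set T) (f : T -> R) :
  (forall x, D x -> f x <= 0) -> \int[mu]_(x in D) f x <= 0.
Proof.
move=> f0; rewrite /Rintegral (_ : (fun x => _) = fun x => (- (- f x)%:E)%E); last first.
  by apply/funext => x; rewrite -EFinN opprK.
rewrite integral_ge0N; last by move=> x Dx; rewrite lee_fin oppr_ge0; exact: f0.
rewrite fineN oppr_le0 fine_ge0// integral_ge0// => x Dx.
by rewrite lee_fin oppr_ge0; exact: f0.
Qed.

Lemma norm_indic_le1 (T : Type) (R : realType) (A : set T) (w : T) : `|\1_A w : R| <= 1.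
Proof. by rewrite indicE; case: (_ \in _); rewrite ?normr1 ?normr0. Qed.

Lemma weighted_integrable d (T : measurableType d) (R : realType)
    (mu : {measure set T -> \bar R}) (Y V : T -> R) :
  measurable_fun setT Y -> (forall w, `|Y w| <= 1) -> mu.-integrable setT (EFin \o V) ->
  mu.-integrable setT (EFin \o (fun w => Y w * V w)).
Proof.
move=> mY Y1 iV; have mV : measurable_fun setT V.
  by apply/measurable_EFinP; case/integrableP: iV.
apply: (dominated_integrable_real (g := fun w => `|V w|)) => //.
- exact: measurable_funM.
- exact: integrable_norm iV.
- by move=> w _; rewrite normrM -[leRHS]mul1r ler_wpM2r.
Qed.

(** * Right-continuous bounded paths *)

Lemma cvg_right_shift {R : realType} (g : R -> R) (t l : R) :
  g s @[s --> t^'+] --> l -> g (t + h) @[h --> 0^'+] --> l.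
Proof.
move=> /cvg_at_rightP Hc; apply/cvg_at_rightP => x [x0 cx]; apply: Hc; split.
  by move=> n; rewrite ltrDl.
by rewrite -[X in _ --> X]addr0; apply: cvgD => //; exact: cvg_cst.
Qed.

Definition right_regular {R : realType} (a : R) (w : R -> R) : Prop :=
  (forall t : R, 0 <= t < a -> w s @[s --> t^'+] --> w t) /\
  exists B : R, forall t : R, 0 <= t <= a -> `|w t| <= B.

(** Compactness of [[0, a]]: the supremum of the times up to which the path is
bounded is itself such a time by the left limit, and is [a] by right-continuity. *)
Lemma cadlag_right_regular {R : realType} (w : R -> R) (a : R) :
  cadlag w -> right_regular a w.
Proof.
move=> [rc lc]; split; first by move=> t /andP[t0 _]; exact: rc.
have [a0|a0] := ltP a 0.
  by exists 0 => t /andP[t0 ta]; have := le_lt_trans (le_trans t0 ta) a0; rewrite ltxx.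
pose S := [set t | 0 <= t <= a /\ exists B, forall r, 0 <= r <= t -> `|w r| <= B].
have S0 : S 0.
  split; first by rewrite lexx.
  by exists `|w 0| => r; rewrite -eq_le => /eqP <-.
have supS : has_sup S by split; [exists 0 | exists a => t -[/andP[]]].
pose s := sup S.
have s0 : 0 <= s by apply: ub_le_sup => //; case: supS.
have sa : s <= a by apply: ge_sup; [case: supS|move=> t -[/andP[]]].
have Ss : exists B, forall r, 0 <= r <= s -> `|w r| <= B.
  move: s0; rewrite le_eqVlt => /predU1P[<-|s0].
    by case: S0.
  have /cvg_ex[/= l /cvgrPdist_lt/(_ 1 ltr01)[e /= e0 He]] := lc s s0.
  have se : s - e < s by rewrite ltrBlDr ltrDl.
  have [t [/andP[t0 _] [B HB]] st] := sup_gt (proj1 supS) se.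
  exists (Num.max B (Num.max (`|l| + 1) `|w s|)) => r /andP[r0 rs].
  rewrite !le_max; have [rt|tr] := leP r t; first by rewrite HB ?r0.
  move: rs; rewrite le_eqVlt => /predU1P[->|rs]; first by rewrite lexx !orbT.
  apply/orP; right; apply/orP; left.
  have {}He : `|l - w r| < 1 by apply: He => //=; rewrite ger0_norm; lra.
  have := ler_normB l (l - w r); rewrite subKr; lra.
have [B HB] := Ss.
move: sa; rewrite le_eqVlt => /predU1P[<-//|sa].
have /cvgrPdist_lt/(_ 1 ltr01)[e /= e0 He] := rc s s0.
suff : S (Num.min a (s + e / 2)).
  move=> /(ub_le_sup (proj2 supS)); rewrite -/s ge_min leNgt sa/=.
  by rewrite gerDl leNgt divr_gt0.
split; first by rewrite le_min ge_min lexx/= andbT; apply/andP; split; lra.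
exists (Num.max B (`|w s| + 1)) => r /andP[r0]; rewrite !le_min => /andP[ra re].
rewrite le_max; have [rs|sr] := leP r s; first by rewrite HB ?r0.
have {}He : `|w s - w r| < 1 by apply: He => //=; rewrite ltr0_norm; lra.
apply/orP; right; have := ler_normB (w s) (w s - w r); rewrite subKr; lra.
Qed.

Lemma right_regular_comp {R : realType} (a : R) (w g : R -> R) :
  continuous g -> right_regular a w ->
  (exists B : R, forall t : R, 0 <= t <= a -> `|g (w t)| <= B) ->
  right_regular a (fun t => g (w t)).
Proof.
move=> cg [rc _] [B gB]; split; last by exists B.
by move=> t ta; exact: (cvg_comp _ _ (rc t ta) (cg (w t))).
Qed.

Lemma right_regularZ {R : realType} (c a : R) (w : R -> R) :
  right_regular a w -> right_regular a (fun t => c * w t).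
Proof.
move=> [rc [B HB]]; split; first by move=> t ta; apply: cvgMl_tmp; exact: rc.
by exists (`|c| * B) => t ta; rewrite normrM ler_wpM2l ?HB.
Qed.

(** Sampling each cell at its right end point is what right-continuity makes
converge. *)
Definition step_path {R : realType} (a : R) (w : R -> R) (n : nat) (s : R) : R :=
  \sum_(k < n.+1) \1_(`[k%:R * a / n.+1%:R, k.+1%:R * a / n.+1%:R[) s *
    w (k.+1%:R * a / n.+1%:R).

Lemma step_pathE {R : realType} (a : R) (w : R -> R) (n : nat) (s : R) :
  0 <= s < a -> exists2 r, s < r <= s + a / n.+1%:R /\ r <= a & step_path a w n s = w r.
Proof.
move=> /andP[s0 sa]; have a0 := le_lt_trans s0 sa.
have n0 : (0 : R) < n.+1%:R by rewrite ltr0n.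
pose x := s * n.+1%:R / a.
have x0 : 0 <= x by apply: divr_ge0 (ltW a0); apply: mulr_ge0 s0 (ltW n0).
have /andP[k1 k2] := truncn_itv x0.
set k := Num.truncn x in k1 k2.
have sx : s = x * a / n.+1%:R by rewrite /x divfK ?gt_eqF// mulfK ?gt_eqF.
have kn : (k < n.+1)%N.
  rewrite -(ltr_nat R); apply: (le_lt_trans k1).
  by rewrite /x ltr_pdivrMr// mulrC ltr_pM2l.
have ks : k%:R * a / n.+1%:R <= s.
  by rewrite [leRHS]sx ler_pM2r ?invr_gt0// ler_pM2r.
have sk : s < k.+1%:R * a / n.+1%:R.
  by rewrite [ltLHS]sx ltr_pM2r ?invr_gt0// ltr_pM2r.
exists (k.+1%:R * a / n.+1%:R).
  split.
    by rewrite sk/= -[k.+1%:R]natr1 mulrDl mul1r mulrDl lerD2r.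
  rewrite ler_pdivrMr// mulrC ler_pM2l// ler_nat; exact: kn.
rewrite /step_path (bigD1 (Ordinal kn))//= indicE mem_set/= ?in_itv/= ?ks//.
rewrite mul1r big1 ?addr0// => i /eqP ik.
rewrite indicE memNset ?mul0r//= in_itv/= => /andP[i1 i2]; apply: ik.
apply/val_inj => /=; apply/eqP; rewrite eqn_leq.
have cancel_ (p q : nat) : p%:R * a / n.+1%:R < q%:R * a / n.+1%:R -> (p < q)%N.
  by rewrite ltr_pM2r ?invr_gt0// ltr_pM2r// ltr_nat.
apply/andP; split; rewrite -ltnS; apply: cancel_.
  exact: le_lt_trans i1 sk.
exact: le_lt_trans ks i2.
Qed.

Lemma step_path_cvg {R : realType} (a : R) (w : R -> R) (s : R) :
  right_regular a w -> 0 <= s < a -> step_path a w n s @[n --> \oo] --> w s.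
Proof.
move=> [rc _] sa; have a0 : 0 < a by case/andP: sa => s0; exact: le_lt_trans.
apply/cvgrPdist_lt => e e0.
have /cvgrPdist_lt/(_ e e0)[d /= d0 Hd] := rc s sa.
have an : a / n.+1%:R @[n --> \oo] --> a * 0.
  by apply: cvgMl_tmp; exact: cvg_harmonic.
rewrite mulr0 in an.
near=> n; have [r [/andP[sr rs] _] ->] := step_pathE w n sa.
apply: Hd => //=; rewrite ltr0_norm ?subr_lt0//.
rewrite opprB ltrBlDl; apply: (le_lt_trans rs); rewrite ltrD2l.
by near: n; apply: (cvgr_lt (0 : R)).
Unshelve. all: by end_near. Qed.

Lemma measurable_step_path {R : realType} (a : R) (w : R -> R) (n : nat) (D : set R) :
  measurable_fun D (step_path a w n).
Proof.
apply: measurable_sum => k; apply: measurable_funM; last exact: measurable_cst.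
by apply: measurable_indic.
Qed.

Lemma right_regular_measurable {R : realType} (a : R) (w : R -> R) :
  right_regular a w -> measurable_fun `[0, a] w.
Proof.
move=> rw; apply/measurable_fun_itv_bndo_bndcP.
apply: (measurable_fun_cvg (h := step_path a w)).
  by move=> n; exact: measurable_step_path.
by move=> x /=; rewrite in_itv/=; exact: step_path_cvg.
Qed.

Lemma lebesgue_itv_lty {R : realType} (b c : bool) (x y : R) :
  (lebesgue_measure [set` Interval (BSide b x) (BSide c y)] < +oo)%E.
Proof.
rewrite lebesgue_measure_itv/= lte_fin; case: ifP => _; last exact: ltry.
by rewrite -EFinB ltry.
Qed.

Lemma lebesgue_itv_len {R : realType} (b c : bool) (x y : R) : x <= y ->
  fine (lebesgue_measure [set` Interval (BSide b x) (BSide c y)]) = y - x.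
Proof.
rewrite lebesgue_measure_itv/= lte_fin; case: ltP => // yx xy.
by apply/esym/eqP; rewrite subr_eq0 eq_le yx.
Qed.

Lemma right_regular_integrable {R : realType} (a : R) (w : R -> R) :
  right_regular a w -> lebesgue_measure.-integrable `[0, a] (EFin \o w).
Proof.
move=> rw; have [_ [B HB]] := rw.
apply: (bounded_integrable (B := B)) => //.
- exact: lebesgue_itv_lty.
- exact: right_regular_measurable.
Qed.

(** A path integral is a limit of functions of finitely many values of the path,
which is what makes it measurable with respect to the past. *)
Lemma riemann_sum_cvg {R : realType} (a : R) (w : R -> R) :
  0 <= a -> right_regular a w ->
  \sum_(k < n.+1) (a / n.+1%:R * w (k.+1%:R * a / n.+1%:R)) @[n --> \oo] -->
    \int[lebesgue_measure]_(s in `[0, a]) w s.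
Proof.
move=> a0 rw; have [_ [B HB]] := rw.
have i0a : (@lebesgue_measure R).-integrable `[0%R, a[%classic (EFin \o w).
  apply: integrableS (right_regular_integrable rw) => //.
  by apply: subset_itvl; rewrite bnd_simp.
have fin0a : (lebesgue_measure (`[0%R, a[%classic : set R) < +oo)%E.
  exact: lebesgue_itv_lty.
rewrite -Rintegral_itv_bndo_bndc//.
have B0 : 0 <= B by apply: (le_trans (normr_ge0 (w a))); apply: HB; rewrite a0 lexx.
have H := @Rintegral_dominated_cvg _ _ R lebesgue_measure `[0, a[%classic (step_path a w)
  w (cst B) _ _ _ _ _.
apply: (cvg_trans _ (H _ _ _ _ _)) => //.
- apply: near_eq_cvg; near=> n.
  pose f k (s : R) := \1_(`[k%:R * a / n.+1%:R, k.+1%:R * a / n.+1%:R[) s *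
    w (k.+1%:R * a / n.+1%:R).
  transitivity (\sum_(i < n.+1) \int[lebesgue_measure]_(x in `[0, a[) f i x).
    have H2 := @Rintegral_sum _ _ R lebesgue_measure `[0, a[%classic n.+1 f.
    apply: H2 => // k; apply: (bounded_integrable (B := `|w (k.+1%:R * a / n.+1%:R)|)) => //.
      rewrite /f; apply: measurable_funM; last exact: measurable_cst.
      by apply: measurable_indic.
    by move=> x _; rewrite normrM -[leRHS]mul1r ler_wpM2r// norm_indic_le1.
  apply: eq_bigr => k _; rewrite /f.
  rewrite RintegralZr//; last first.
    apply: (bounded_integrable (B := 1)) => //.
    by move=> x _; exact: norm_indic_le1.
  rewrite /Rintegral integral_indic// setIidl; last first.
    move=> x /=; rewrite !in_itv/= => /andP[x1 x2]; apply/andP; split.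
      by apply: le_trans x1; rewrite divr_ge0 ?mulr_ge0 ?ler0n.
    apply: (lt_le_trans x2); rewrite ler_pdivrMr ?ltr0n// mulrC.
    by rewrite ler_wpM2l// ler_nat.
  congr (_ * _); rewrite (_ : k.+1%:R * a / n.+1%:R = k%:R * a / n.+1%:R + a / n.+1%:R).
    rewrite -[RHS](addrK (k%:R * a / n.+1%:R)) [X in X - _]addrC.
    by apply: lebesgue_itv_len; rewrite lerDl divr_ge0.
  by rewrite -[k.+1%:R]natr1 mulrDl mul1r mulrDl.
- by move=> n; exact: measurable_step_path.
- by move=> x /=; rewrite in_itv/=; exact: step_path_cvg.
- apply: (bounded_integrable (B := B)) => //.
  by move=> x _ /=; rewrite ger0_norm.
- move=> n x /=; rewrite in_itv/= => xa; have [r [/andP[r1 _] r2] ->] := step_pathE w n xa.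
  apply: HB; rewrite r2 andbT; case/andP: xa => x0 _.
  exact: (le_trans x0 (ltW r1)).
Unshelve. all: by end_near. Qed.

(** * Integrals of paths as functions of the upper end point *)

Lemma Rintegral_itv_le {R : realType} (b c : bool) (s t B : R) (w : R -> R) :
  s <= t ->
  lebesgue_measure.-integrable [set` Interval (BSide b s) (BSide c t)] (EFin \o w) ->
  (forall r, s <= r <= t -> w r <= B) ->
  \int[lebesgue_measure]_(r in [set` Interval (BSide b s) (BSide c t)]) w r <= B * (t - s).
Proof.
move=> st iw wB; rewrite -(lebesgue_itv_len b c st) -Rintegral_cst//.
apply: le_Rintegral => //.
  apply: (bounded_integrable (B := `|B|)) => //; exact: lebesgue_itv_lty.
move=> r /= rI; apply: wB; move: rI; rewrite itv_boundlr => /andP[+ +].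
by case: b c {iw} => -[]; rewrite !bnd_simp => h1 h2; rewrite ?(ltW h1) ?(ltW h2) ?h1 ?h2.
Qed.

Section integral_derivatives.
Context (R : realType) (a : R) (g : R -> R).
Hypothesis ig : (@lebesgue_measure R).-integrable `[0%R, a]%classic (EFin \o g).

Lemma integral_between (s t lo hi : R) : 0 <= s -> s <= t -> t <= a ->
  (forall r, s <= r <= t -> lo <= g r <= hi) ->
  lo * (t - s) <= \int[lebesgue_measure]_(r in `[0, t]) g r -
    \int[lebesgue_measure]_(r in `[0, s]) g r <= hi * (t - s).
Proof.
move=> s0 st ta H.
have i0t : (@lebesgue_measure R).-integrable `[0%R, t]%classic (EFin \o g).
  by apply: integrableS ig => //; apply: subset_itvl; rewrite bnd_simp.
have ist : (@lebesgue_measure R).-integrable `]s, t]%classic (EFin \o g).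
  by apply: integrableS i0t => //; apply: subset_itvr; rewrite bnd_simp.
rewrite Rintegral_itvB ?bnd_simp//.
apply/andP; split; last by apply: Rintegral_itv_le => // r /H/andP[].
have EN : \int[lebesgue_measure]_(r in `]s, t]) (- g r) =
    - \int[lebesgue_measure]_(r in `]s, t]) g r.
  by rewrite -mulN1r -RintegralZl//; apply: eq_Rintegral => r _; rewrite mulN1r.
rewrite -lerN2 -mulNr -EN.
apply: Rintegral_itv_le => //; last by move=> r /H/andP[]; rewrite lerN2.
by have := integrableN ist; apply: eq_integrable.
Qed.

Lemma integral_rderive_right (t : R) : 0 <= t < a -> g (t + h) @[h --> 0^'+] --> g t ->
  is_rderive (fun r => \int[lebesgue_measure]_(s in `[0, r]) g s) t (g t).
Proof.
move=> /andP[t0 ta] gt; apply/cvgrPdist_le => e e0.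
have /cvgrPdist_le/(_ e e0)[d /= d0 Hd] := gt.
near=> h.
have h0 : 0 < h by near: h; exact: nbhs_right_gt.
have ha : h < a - t by near: h; apply: nbhs_right_lt; rewrite subr_gt0.
have hd : h < d by near: h; exact: nbhs_right_lt.
have near_ r : t <= r <= t + h -> g t - e <= g r <= g t + e.
  move=> /andP[]; rewrite le_eqVlt => /predU1P[<- _|tr rh].
    by apply/andP; split; lra.
  have := Hd (r - t); rewrite /= sub0r normrN gtr0_norm ?subr_gt0// => /(_ _ tr).
  rewrite [t + _](_ : _ = r); last by ring.
  move=> H; have {}H : `|g t - g r| <= e by apply: H; lra.
  by move: H; rewrite ler_norml => /andP[h1 h2]; apply/andP; split; lra.
have := integral_between t0 _ _ near_; rewrite lerDl (ltW h0) => /(_ isT).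
have -> : t + h <= a by rewrite ltW// addrC -ltrBrDr.
move=> /(_ isT); rewrite addrAC subrr add0r; set I := (\int[_]_(_ in _) _ - _) => /andP[L U].
rewrite ler_norml; have [] : g t - e <= I / h /\ I / h <= g t + e.
  by split; [rewrite ler_pdivlMr|rewrite ler_pdivrMr].
set J := I / h => h1 h2; apply/andP; split; lra.
Unshelve. all: by end_near. Qed.

Lemma integral_rderive_left (t : R) : 0 < t <= a -> g (t - h) @[h --> 0^'+] --> g t ->
  (\int[lebesgue_measure]_(s in `[0, t - h]) g s -
   \int[lebesgue_measure]_(s in `[0, t]) g s) / h @[h --> 0^'+] --> - g t.
Proof.
move=> /andP[t0 ta] gt; apply/cvgrPdist_le => e e0.
have /cvgrPdist_le/(_ e e0)[d /= d0 Hd] := gt.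
near=> h.
have h0 : 0 < h by near: h; exact: nbhs_right_gt.
have ht : h < t by near: h; exact: nbhs_right_lt.
have hd : h < d by near: h; exact: nbhs_right_lt.
have near_ r : t - h <= r <= t -> g t - e <= g r <= g t + e.
  move=> /andP[rh]; rewrite le_eqVlt => /predU1P[->|tr].
    by apply/andP; split; lra.
  have := Hd (t - r); rewrite /= sub0r normrN gtr0_norm ?subr_gt0// subKr => /(_ _ tr).
  move=> H; have {}H : `|g t - g r| <= e by apply: H; lra.
  by move: H; rewrite ler_norml => /andP[h1 h2]; apply/andP; split; lra.
have th0 : 0 <= t - h by rewrite subr_ge0 ltW.
have tht : t - h <= t by rewrite gerBl ltW.
have := integral_between th0 tht ta near_; rewrite subKr.
rewrite -[X in X / h]opprB mulNr; set I := (\int[_]_(_ in _) _ - _) => /andP[L U].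
rewrite ler_norml; have [] : g t - e <= I / h /\ I / h <= g t + e.
  by split; [rewrite ler_pdivlMr|rewrite ler_pdivrMr].
set J := I / h => h1 h2; apply/andP; split; lra.
Unshelve. all: by end_near. Qed.

End integral_derivatives.

Lemma primitive_lip {R : realType} (a s t B : R) (w : R -> R) :
  right_regular a w -> 0 <= s -> s <= t -> t <= a -> (forall r, 0 <= r <= a -> `|w r| <= B) ->
  `|\int[lebesgue_measure]_(r in `[0, t]) w r - \int[lebesgue_measure]_(r in `[0, s]) w r|
    <= B * (t - s).
Proof.
move=> rw s0 st ta wB; rewrite ler_norml -mulNr.
apply: (integral_between (right_regular_integrable rw)) => // r /andP[sr rt].
by rewrite -ler_norml; apply: wB; rewrite (le_trans s0 sr) (le_trans rt ta).
Qed.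

Lemma primitive0 {R : realType} (w : R -> R) :
  \int[lebesgue_measure]_(r in `[0, 0]) w r = 0.
Proof. by rewrite set_itv1 Rintegral_set1. Qed.

Lemma primitive_ge0 {R : realType} (t : R) (w : R -> R) :
  (forall r, 0 <= r <= t -> 0 <= w r) -> 0 <= \int[lebesgue_measure]_(r in `[0, t]) w r.
Proof. by move=> w0; apply: Rintegral_ge0 => r /=; rewrite in_itv/=; exact: w0. Qed.

Lemma primitive_rderive {R : realType} (a t : R) (w : R -> R) :
  right_regular a w -> 0 <= t < a ->
  is_rderive (fun r => \int[lebesgue_measure]_(s in `[0, r]) w s) t (w t).
Proof.
move=> rw ta; apply: (integral_rderive_right (right_regular_integrable rw)) => //.
by apply: cvg_right_shift; case: rw => rc _; exact: rc.
Qed.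

Lemma within_itv_continuous {R : realType} (a b : R) (f : R -> R) :
  (forall t, a <= t <= b -> forall e, 0 < e -> exists2 d, 0 < d &
     forall s, a <= s <= b -> `|t - s| < d -> `|f t - f s| < e) ->
  {within `[a, b], continuous f}.
Proof.
move=> H; apply/subspace_continuousP => t /=; rewrite in_itv/= => tab.
apply/cvgrPdist_lt => e e0; have [d d0 Hd] := H t tab e e0.
rewrite near_withinE; near=> s => /=; rewrite in_itv/= => sab.
apply: Hd => //; near: s.
Unshelve. all: by end_near. Qed.

Lemma lipschitz_within_continuous {R : realType} (a b K : R) (f : R -> R) :
  (forall s t, a <= s -> s <= t -> t <= b -> `|f t - f s| <= K * (t - s)) ->
  {within `[a, b], continuous f}.
Proof.
move=> H; apply: within_itv_continuous => t /andP[at_ tb] e e0.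
have K0 : 0 < `|K| + 1 by rewrite ltr_wpDl.
exists (e / (`|K| + 1)); first by rewrite divr_gt0.
move=> s /andP[as_ sb]; rewrite ltr_pdivlMr// => ts.
suff h : `|f t - f s| <= `|K| * `|t - s|.
  apply: (le_lt_trans h); apply: le_lt_trans ts.
  by have := normr_ge0 (t - s); lra.
have [st|/ltW st] := leP s t.
  rewrite [ `|t - s|]ger0_norm ?subr_ge0//; apply: (le_trans (H _ _ as_ st tb)).
  by rewrite ler_wpM2r ?subr_ge0// ler_norm.
rewrite distrC [ `|t - s|]distrC [ `|s - t|]ger0_norm ?subr_ge0//.
apply: (le_trans (H _ _ at_ st sb)).
by rewrite ler_wpM2r ?subr_ge0// ler_norm.
Qed.

Lemma primitive_uniform_cvg {R : realType} (t e : R) (w v : R -> R) :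
  0 <= t -> right_regular t w -> right_regular t v ->
  (forall r, 0 <= r <= t -> `|v r - w r| <= e) ->
  `|\int[lebesgue_measure]_(r in `[0, t]) v r - \int[lebesgue_measure]_(r in `[0, t]) w r|
    <= e * t.
Proof.
move=> t0 rw rv vw; rewrite -RintegralB//; [|exact: right_regular_integrable..].
have rvw : right_regular t (fun r => v r - w r).
  split; first by move=> r rt; apply: cvgB; [apply: (proj1 rv)|apply: (proj1 rw)].
  by exists e.
have := @primitive_lip _ t 0 t e _ rvw; rewrite primitive0 !subr0; exact.
Qed.

(** * Extension of integral identities from sets to functions *)

(** The properties of the integral that determine it from the measures of sets;
integrals over the sample space and integrals against a kernel both have this
form, so that one extension argument serves all the identities below. *)
Definition monotone_functional d (S : measurableType d) (R : realType)
    (Phi : (S -> R) -> \bar R) : Prop :=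
  [/\ forall f g : S -> R, measurable_fun setT f -> measurable_fun setT g ->
        (forall x, 0 <= f x) -> (forall x, 0 <= g x) ->
        Phi (fun x => f x + g x) = (Phi f + Phi g)%E,
      forall (c : R) (f : S -> R), measurable_fun setT f -> (forall x, 0 <= f x) -> 0 <= c ->
        Phi (fun x => c * f x) = (c%:E * Phi f)%E &
      forall (F : nat -> S -> R) (f : S -> R), (forall n, measurable_fun setT (F n)) ->
        (forall n x, 0 <= F n x) -> (forall x, {homo F ^~ x : m n / (m <= n)%N >-> m <= n}) ->
        (forall x, F n x @[n --> \oo] --> f x) ->
        Phi (F n) @[n --> \oo] --> Phi f].

Import HBNNSimple.

Lemma monotone_functional_ext d (S : measurableType d) (R : realType)
    (Phi Psi : (S -> R) -> \bar R) :
  monotone_functional Phi -> monotone_functional Psi ->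
  (forall A, measurable A -> Phi \1_A = Psi \1_A) ->
  forall f : S -> R, measurable_fun setT f -> (forall x, 0 <= f x) -> Phi f = Psi f.
Proof.
move=> [D1 Z1 C1] [D2 Z2 C2] H f mf f0.
have mef : measurable_fun setT (EFin \o f) by exact/measurable_EFinP.
pose F n := nnsfun_approx measurableT mef n.
have mF n : measurable_fun setT (F n) by [].
have F0 n x : 0 <= F n x by [].
have ndF x : {homo F ^~ x : m n / (m <= n)%N >-> m <= n}.
  by move=> m n mn; exact/lefP/nd_nnsfun_approx.
have Ff x : F n x @[n --> \oo] --> f x.
  have := @cvg_nnsfun_approx _ S R setT measurableT (EFin \o f) mef
    (fun y _ => f0 y) x I.
  by move/fine_cvg; apply.
have PF n : Phi (F n) = Psi (F n).
  have sums (c : nat -> R) (A : nat -> set S) (N : nat) :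
      (forall i, 0 <= c i) -> (forall i, measurable (A i)) ->
      Phi (fun x => \sum_(i < N) c i * \1_(A i) x) =
      Psi (fun x => \sum_(i < N) c i * \1_(A i) x).
    move=> c0 mA; have m1 i : measurable_fun setT (fun x => c i * \1_(A i) x : R).
      by apply: measurable_funM; [exact: measurable_cst|exact: measurable_indic].
    have p1 i x : 0 <= c i * \1_(A i) x by rewrite mulr_ge0.
    elim: N => [|N ih].
      rewrite (_ : (fun _ => _) = fun x => 0 * \1_set0 x); last first.
        by apply/funext => x; rewrite big_ord0 mul0r.
      by rewrite Z1 ?Z2 ?H//; apply: measurable_indic.
    rewrite (_ : (fun _ => _) = fun x =>
      \sum_(i < N) c i * \1_(A i) x + c N * \1_(A N) x); last first.
      by apply/funext => x; rewrite big_ord_recr.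
    have mS : measurable_fun setT (fun x => \sum_(i < N) c i * \1_(A i) x : R).
      by apply: measurable_sum => i; exact: m1.
    have S0 x : 0 <= \sum_(i < N) c i * \1_(A i) x :> R by apply: sumr_ge0.
    rewrite D1// D2// ih Z1 ?Z2 ?H//; exact: measurable_indic.
  pose s : seq R := finmap.enum_fset (fset_set (range (F n))).
  pose N := size s.
  have -> : (F n : S -> R) = fun x => \sum_(i < N) s`_i * \1_(F n @^-1` [set s`_i]) x.
    by apply/funext => x; exact: fimfunEord.
  apply: (sums (fun i => s`_i) (fun i => F n @^-1` [set s`_i])) => i.
    have [iN|Ni] := ltnP i N; last by rewrite nth_default.
    have : s`_i \in fset_set (range (F n)) by exact: mem_nth.
    rewrite in_fset_set; last exact: fimfunP.
    by move=> /set_mem[x _ <-]; exact: F0.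
  by rewrite -[X in measurable X]setTI; apply: mF => //; exact: measurable_set1.
have h1 := C1 F f mF F0 ndF Ff.
have h2 := C2 F f mF F0 ndF Ff.
apply/(cvg_unique _ h1) => //; rewrite (_ : (fun n => _) = fun n => Psi (F n))//.
by apply/funext => n; exact: PF.
Qed.

Lemma monotone_functional_integral d (T : measurableType d) d' (S : measurableType d')
    (R : realType) (m : {measure set T -> \bar R}) (phi : T -> S) (X : T -> R) :
  measurable_fun setT phi -> measurable_fun setT X -> (forall w, 0 <= X w) ->
  monotone_functional (fun f => \int[m]_w (f (phi w) * X w)%:E)%E.
Proof.
move=> mphi mX X0.
have mM (f : S -> R) : measurable_fun setT f ->
    measurable_fun setT (fun w => (f (phi w) * X w)%:E).
  move=> mf; apply/measurable_EFinP; apply: measurable_funM => //.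
  exact: measurableT_comp.
split.
- move=> f g mf mg f0 g0; rewrite -ge0_integralD//; last 4 first.
  + by move=> w _; rewrite lee_fin mulr_ge0.
  + exact: mM.
  + by move=> w _; rewrite lee_fin mulr_ge0.
  + exact: mM.
  by apply: eq_integral => w _; rewrite mulrDl EFinD.
- move=> c f mf f0 c0; rewrite -ge0_integralZl//; last 2 first.
  + exact: mM.
  + by move=> w _; rewrite lee_fin mulr_ge0.
  by apply: eq_integral => w _; rewrite -mulrA EFinM.
- move=> F f mF F0 ndF Ff.
  rewrite (_ : (fun w => _) = fun w => limn (fun n => (F n (phi w) * X w)%:E)).
    apply: cvg_monotone_convergence => //.
    + by move=> n; exact: mM.
    + by move=> n w _; rewrite lee_fin mulr_ge0.
    + by move=> w _ a b ab; rewrite lee_fin ler_wpM2r// ndF.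
  apply/funext => w; apply/esym/cvg_lim => //; apply: cvg_EFin; first exact: nearW.
  by apply: cvgM; [exact: Ff|exact: cvg_cst].
Qed.

Lemma monotone_functional_kernel d (T : measurableType d) d' (S : measurableType d')
    d'' (U : measurableType d'') (R : realType) (m : {measure set T -> \bar R})
    (k : R.-ker U ~> S) (phi : T -> U) (X : T -> R) :
  measurable_fun setT phi -> measurable_fun setT X -> (forall w, 0 <= X w) ->
  monotone_functional (fun f => \int[m]_w ((\int[k (phi w)]_z (f z)%:E) * (X w)%:E))%E.
Proof.
move=> mphi mX X0.
have mK (f : S -> R) : measurable_fun setT f -> (forall x, 0 <= f x) ->
    measurable_fun setT (fun w => (\int[k (phi w)]_z (f z)%:E) * (X w)%:E)%E.
  move=> mf f0; apply: emeasurable_funM; last exact/measurable_EFinP.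
  apply: (measurable_fun_integral_kernel (l := fun w => k (phi w)))%E.
  - by move=> V mV; apply: (measurableT_comp (measurable_kernel k V mV)).
  - by move=> z; rewrite lee_fin.
  - exact/measurable_EFinP.
have K0 (f : S -> R) w : (forall x, 0 <= f x) ->
    (0 <= (\int[k (phi w)]_z (f z)%:E) * (X w)%:E)%E.
  move=> f0; apply: mule_ge0; last by rewrite lee_fin.
  by apply: integral_ge0 => z _; rewrite lee_fin.
split.
- move=> f g mf mg f0 g0; rewrite -ge0_integralD//; [|by move=> w _; exact: K0|exact: mK|
    by move=> w _; exact: K0|exact: mK].
  apply: eq_integral => w _.
  rewrite -ge0_muleDl; [|by apply: integral_ge0 => z _; rewrite lee_fin..].
  congr (_ * _)%E; rewrite -ge0_integralD//.
  + by move=> z _; rewrite lee_fin.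
  + exact/measurable_EFinP.
  + by move=> z _; rewrite lee_fin.
  + exact/measurable_EFinP.
- move=> c f mf f0 c0; rewrite -ge0_integralZl//; [|exact: mK|by move=> w _; exact: K0].
  apply: eq_integral => w _; rewrite muleA; congr (_ * _)%E.
  rewrite -ge0_integralZl//; first exact/measurable_EFinP.
  by move=> z _; rewrite lee_fin.
- move=> F f mF F0 ndF Ff.
  rewrite (_ : (fun w => _) = fun w => limn (fun n =>
      (\int[k (phi w)]_z (F n z)%:E) * (X w)%:E)%E).
    apply: cvg_monotone_convergence => //.
    + by move=> n; exact: mK.
    + by move=> n w _; exact: K0.
    + move=> w _ a b ab; apply: lee_wpmul2r; first by rewrite lee_fin.
      apply: ge0_le_integral => //.
      * by move=> z _; rewrite lee_fin.
      * exact/measurable_EFinP.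
      * exact/measurable_EFinP.
      * by move=> z _; rewrite lee_fin ndF.
  apply/funext => w; apply/esym/cvg_lim => //; apply: cvgeZr => //.
  rewrite (_ : (fun z => _) = fun z => limn (fun n => (F n z)%:E)).
    apply: cvg_monotone_convergence => //.
    + by move=> n; exact/measurable_EFinP.
    + by move=> n z _; rewrite lee_fin.
    + by move=> z _ a b ab; rewrite lee_fin ndF.
  apply/funext => z; apply/esym/cvg_lim => //; apply: cvg_EFin; first exact: nearW.
  exact: Ff.
Qed.

(** * Natural filtrations *)

Definition past_events (R : realType) (T : Type) (Z : R -> T -> R) (a : R) : set (set T) :=
  [set A | exists s : R, exists B : set R,
     [/\ 0 <= s <= a, measurable B & A = Z s @^-1` B] ].

Lemma measurable_wrt_naturalP (R : realType) (T : pointedType) (Z : R -> T -> R) (a : R)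
    (X : T -> R) :
  measurable_wrt (natural_filtration Z a) X <->
  measurable_fun setT (X : g_sigma_algebraType (past_events Z a) -> R).
Proof.
split=> [mX _ B mB|mX B mB]; first by rewrite setTI; exact: mX.
by have := mX measurableT B mB; rewrite setTI.
Qed.

Lemma natural_filtration_measurable (R : realType) d (T : measurableType d)
    (Z : R -> T -> R) (a : R) (A : set T) :
  (forall t, 0 <= t -> measurable_fun setT (Z t)) ->
  natural_filtration Z a A -> measurable A.
Proof.
move=> mZ; apply: smallest_sub; first exact: sigma_algebra_measurable.
move=> _ [s [B [/andP[s0 _] mB ->]]].
by rewrite -[X in measurable X]setTI; exact: mZ.
Qed.

Lemma natural_filtration_le (R : realType) (T : Type) (Z : R -> T -> R) (a b : R) :
  a <= b -> natural_filtration Z a `<=` natural_filtration Z b.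
Proof.
move=> ab; apply: sub_sigma_algebra2 => _ [s [B [/andP[s0 sa] mB ->]]].
by exists s, B; rewrite s0 (le_trans sa ab).
Qed.

Lemma measurable_wrt_sub (T : Type) (R : realType) (F G : set (set T)) (X : T -> R) :
  F `<=` G -> measurable_wrt F X -> measurable_wrt G X.
Proof. by move=> FG mX B mB; apply: FG; exact: mX. Qed.

Lemma measurable_wrt_marginal (R : realType) (T : Type) (Z : R -> T -> R) (a s : R) :
  0 <= s <= a -> measurable_wrt (natural_filtration Z a) (Z s).
Proof. by move=> sa B mB; apply: sub_sigma_algebra; exists s, B. Qed.

Lemma measurable_wrt_path_integral (R : realType) (T : pointedType) (Z : R -> T -> R)
    (a t : R) (g : R -> R) :
  0 <= t <= a -> measurable_fun setT g ->
  (forall w, right_regular t (fun s => g (Z s w))) ->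
  measurable_wrt (natural_filtration Z a)
    (fun w => \int[lebesgue_measure]_(s in `[0, t]) g (Z s w)).
Proof.
move=> /andP[t0 ta] mg rZ; apply/measurable_wrt_naturalP.
pose h n w := \sum_(k < n.+1) (t / n.+1%:R * g (Z (k.+1%:R * t / n.+1%:R) w)).
apply: (@measurable_fun_cvg _ (g_sigma_algebraType (past_events Z a)) R setT h) => [n|w _];
  last exact: riemann_sum_cvg.
apply: measurable_sum => k; apply: measurable_funM; first exact: measurable_cst.
apply: measurableT_comp => //.
apply/measurable_wrt_naturalP; apply: measurable_wrt_marginal; apply/andP; split.
  by rewrite divr_ge0// mulr_ge0.
apply: (le_trans _ ta); rewrite ler_pdivrMr ?ltr0n// mulrC ler_wpM2l// ler_nat.
exact: ltn_ord.
Qed.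

(** * Change of measure on a sub-sigma-algebra *)

(** An identity between densities that is checked on the sets of a sub-sigma-algebra
may be multiplied by any nonnegative function measurable for it; this is how a
density is inverted. *)
Lemma integral_sub_algebra_ext (R : realType) d (T : measurableType d)
    (P Q : {measure set T -> \bar R}) (G : set (set T)) (X1 X2 Y : T -> R) :
  <<s G >> `<=` measurable ->
  measurable_fun setT X1 -> measurable_fun setT X2 ->
  (forall w, 0 <= X1 w) -> (forall w, 0 <= X2 w) ->
  (forall A, <<s G >> A ->
     \int[P]_(w in A) (X1 w)%:E = \int[Q]_(w in A) (X2 w)%:E)%E ->
  measurable_wrt <<s G >> Y -> (forall w, 0 <= Y w) ->
  (\int[P]_w (Y w * X1 w)%:E = \int[Q]_w (Y w * X2 w)%:E)%E.
Proof.
move=> GT mX1 mX2 X10 X20 H mY Y0.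
have mid : measurable_fun setT (id : T -> g_sigma_algebraType G).
  by move=> _ B mB; rewrite setTI; exact: GT.
apply: (@monotone_functional_ext _ (g_sigma_algebraType G) R
  (fun f => \int[P]_w (f (id w) * X1 w)%:E)%E (fun f => \int[Q]_w (f (id w) * X2 w)%:E)%E).
- exact: monotone_functional_integral.
- exact: monotone_functional_integral.
- move=> A GA; have mA : measurable (A : set T) by exact: GT.
  have := H A GA; rewrite [LHS]integral_mkcond [RHS]integral_mkcond => E.
  rewrite (_ : (\int[P]_w _ = \int[P]_w ((EFin \o X1) \_ A) w)%E).
    rewrite E; apply: eq_integral => w _; rewrite /patch indicE.
    by case: ifP; rewrite ?mul1r ?mul0r.
  by apply: eq_integral => w _; rewrite /patch indicE; case: ifP; rewrite ?mul1r ?mul0r.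
- by move=> _ B mB; rewrite setTI; exact: mY.
- exact: Y0.
Qed.

(** * The Markov property on exponentials *)

Lemma kernel_markov_integral (R : realType) d (T : measurableType d)
    (P : probability T R) (k : R.-pker R ~> R) (Z Z' : T -> R) (A : set T) (g : R -> R) :
  measurable A -> measurable_fun setT Z -> measurable_fun setT Z' ->
  (forall B, measurable B -> P (A `&` Z' @^-1` B) = (\int[P]_(w in A) k (Z w) B)%E) ->
  measurable_fun setT g -> (forall z, 0 <= g z) ->
  (\int[P]_w (g (Z' w) * \1_A w)%:E =
   \int[P]_w ((\int[k (Z w)]_z (g z)%:E) * (\1_A w)%:E))%E.
Proof.
move=> mA mZ mZ' H mg g0.
have m1 : measurable_fun setT (\1_A : T -> R) by exact: measurable_indic.
apply: (@monotone_functional_ext _ _ R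
  (fun f => \int[P]_w (f (Z' w) * \1_A w)%:E)%E
  (fun f => \int[P]_w ((\int[k (Z w)]_z (f z)%:E) * (\1_A w)%:E))%E) => //.
- exact: monotone_functional_integral.
- exact: monotone_functional_kernel.
move=> B mB.
transitivity (P (A `&` Z' @^-1` B)).
  have mAB : measurable (A `&` Z' @^-1` B).
    by apply: measurableI => //; rewrite -[X in measurable X]setTI; exact: mZ'.
  rewrite -(setIT (A `&` _)) -(integral_indic P measurableT mAB).
  apply: eq_integral => w _; rewrite indicI !indicE mulrC; congr (_ * _)%:E.
rewrite H// integral_mkcond; apply: eq_integral => w _.
rewrite /patch integral_indic// setIT indicE.
by case: ifP; rewrite ?mule1 ?mule0.
Qed.

(** The Laplace transform of the transition kernel turns the Markov property for
the kernel into an identity that only involves the exponent [u]. *)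
Lemma markov_laplace (R : realType) d (T : measurableType d) (P : probability T R)
    (Z : R -> T -> R) (u : R -> R -> R) (p : R -> R.-pker R ~> R) (s h lam : R)
    (Y : T -> R) :
  (forall t, 0 <= t -> measurable_fun setT (Z t)) ->
  (forall t w, 0 <= t -> 0 <= Z t w) ->
  (forall a y lam : R, 0 <= a -> 0 <= y -> 0 <= lam ->
     (\int[p a y]_(z in `[0%R, +oo[) (expR (- lam * z))%:E = (expR (- y * u a lam))%:E)%E) ->
  (forall (s t : R) (B : set R) (A : set T),
     0 <= s -> 0 <= t -> measurable B -> natural_filtration Z s A ->
     P (A `&` Z (s + t) @^-1` B) = (\int[P]_(w in A) p t (Z s w) B)%E) ->
  0 <= s -> 0 <= h -> 0 <= lam ->
  measurable_wrt (natural_filtration Z s) Y -> (forall w, 0 <= Y w) ->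
  (\int[P]_w (Y w * expR (- lam * Z (s + h) w))%:E =
   \int[P]_w (Y w * expR (- u h lam * Z s w))%:E)%E.
Proof.
move=> mZ Z0 hp hM s0 h0 lam0 mY Y0.
have mexp c t : 0 <= t -> measurable_fun setT (fun w => expR (- c * Z t w)).
  move=> t0; apply: measurableT_comp; first exact: measurable_expR.
  by apply: measurable_funM; [exact: measurable_cst|exact: mZ].
apply: (@integral_sub_algebra_ext _ _ _ _ _ (past_events Z s)) => //.
- by move=> A; exact: natural_filtration_measurable.
- by apply: mexp; rewrite addr_ge0.
- exact: mexp.
move=> A FA; have mA : measurable A by exact: natural_filtration_measurable FA.
pose g (z : R) := \1_`[0, +oo[ z * expR (- lam * z).
have gE z : 0 <= z -> g z = expR (- lam * z).
  by move=> z0; rewrite /g indicE mem_set ?mul1r//= in_itv/= z0.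
have mg : measurable_fun setT g.
  apply: measurable_funM; first by apply: measurable_indic.
  apply: measurableT_comp; first exact: measurable_expR.
  by apply: measurable_funM; [exact: measurable_cst|exact: measurable_id].
have g0 z : 0 <= g z by rewrite mulr_ge0 ?expR_ge0.
have := kernel_markov_integral mA (mZ _ s0) (mZ _ (addr_ge0 s0 h0))
  (fun B mB => hM s h B A s0 h0 mB FA) mg g0.
have setE (F : T -> R) : (\int[P]_(w in A) (F w)%:E = \int[P]_w (F w * \1_A w)%:E)%E.
  rewrite integral_mkcond; apply: eq_integral => w _.
  by rewrite /patch indicE; case: ifP; rewrite ?mulr1 ?mulr0.
rewrite !setE => E; transitivity (\int[P]_w (g (Z (s + h) w) * \1_A w)%:E)%E.
  by apply: eq_integral => w _; rewrite gE// Z0// addr_ge0.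
rewrite E; apply: eq_integral => w _; rewrite EFinM; congr (_ * _)%E.
rewrite (_ : - u h lam * Z s w = - Z s w * u h lam); last by ring.
rewrite -hp// ?Z0// [RHS]integral_mkcond; apply: eq_integral => z _.
by rewrite /patch /g indicE; case: ifP => _; rewrite ?mul1r ?mul0r.
Qed.

(** * Differentiating expectations along the process *)

Lemma within_itv_of_sides (R : realType) (a b : R) (f : R -> R) :
  (forall t, a <= t < b -> f (t + h) @[h --> 0^'+] --> f t) ->
  (forall t, a < t <= b -> f (t - h) @[h --> 0^'+] --> f t) ->
  {within `[a, b], continuous f}.
Proof.
move=> fr fl; apply: within_itv_continuous => t /andP[at_ tb] e e0.
have [d1 d10 H1] : exists2 d, 0 < d & forall s, t < s <= b -> s - t < d -> `|f t - f s| < e.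
  have [tb'|bt] := ltP t b; last first.
    by exists 1 => // s /andP[ts sb]; have := lt_le_trans ts (le_trans sb bt); rewrite ltxx.
  have /cvgrPdist_lt/(_ e e0)[d /= d0 Hd] : f (t + h) @[h --> 0^'+] --> f t.
    by apply: fr; rewrite at_.
  exists d => // s /andP[ts sb] sd; have := Hd (s - t).
  rewrite /= sub0r normrN ger0_norm; last by lra.
  rewrite [t + _](_ : _ = s); last by ring.
  by rewrite subr_gt0; apply.
have [d2 d20 H2] : exists2 d, 0 < d & forall s, a <= s < t -> t - s < d -> `|f t - f s| < e.
  have [at'|ta] := ltP a t; last first.
    by exists 1 => // s /andP[as_ st]; have := lt_le_trans st (le_trans ta as_); rewrite ltxx.
  have /cvgrPdist_lt/(_ e e0)[d /= d0 Hd] : f (t - h) @[h --> 0^'+] --> f t.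
    by apply: fl; rewrite at'.
  exists d => // s /andP[as_ st] sd; have := Hd (t - s).
  rewrite /= sub0r normrN ger0_norm; last by lra.
  by rewrite subKr subr_gt0; apply.
exists (Num.min d1 d2); first by rewrite lt_min d10.
move=> s /andP[as_ sb]; rewrite lt_min => /andP[td1 td2].
case: (ltgtP s t) => [st|ts|->]; last by rewrite subrr normr0.
- apply: H2; first by rewrite as_.
  by move: td2; rewrite gtr0_norm // subr_gt0.
- apply: H1; first by rewrite ts.
  by move: td1; rewrite ltr0_norm ?subr_lt0// opprB.
Qed.

(** A CB process seen through its paths and through the Markov property tested on
exponentials. *)
Definition exponential_markov (R : realType) d (T : measurableType d)
    (P : probability T R) (Z : R -> T -> R) (u : R -> R -> R) : Prop :=
  [/\ forall t : R, 0 <= t -> measurable_fun setT (Z t),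
      forall (t : R) w, 0 <= t -> 0 <= Z t w,
      forall w, cadlag (Z ^~ w) &
      forall (s h lam : R) (Y : T -> R), 0 <= s -> 0 <= h -> 0 <= lam ->
        measurable_wrt (natural_filtration Z s) Y -> (forall w, 0 <= Y w) ->
        (\int[P]_w (Y w * expR (- lam * Z (s + h) w))%:E =
         \int[P]_w (Y w * expR (- u h lam * Z s w))%:E)%E ].

(** The differential form, at time [0], of the integral equation for [u]. *)
Definition flow_generator (R : realType) (f : R -> R) (u : R -> R -> R) : Prop :=
  [/\ forall h lam : R, 0 <= h -> 0 <= lam -> 0 <= u h lam,
      forall lam : R, 0 <= lam -> u 0 lam = lam &
      forall lam : R, 0 < lam -> is_rderive (u ^~ lam) 0 (- f lam)].

Section expectation_derivative.
Context (R : realType) d (T : measurableType d) (P : probability T R).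
Context (Z : R -> T -> R) (f : R -> R) (u : R -> R -> R).
Hypothesis hZ : exponential_markov P Z u.
Hypothesis hu : flow_generator f u.

Let mZ : forall t : R, 0 <= t -> measurable_fun setT (Z t). Proof. by case: hZ. Qed.
Let Z0 : forall (t : R) w, 0 <= t -> 0 <= Z t w. Proof. by case: hZ. Qed.
Let u0 : forall h lam : R, 0 <= h -> 0 <= lam -> 0 <= u h lam. Proof. by case: hu. Qed.

Lemma expectation_cst (c : R) : \int[P]_w c = c.
Proof.
transitivity (c * fine (P setT)); first exact: Rintegral_cst.
by rewrite probability_setT mulr1.
Qed.

Lemma probability_bounded_integrable (X : T -> R) (K : R) :
  measurable_fun setT X -> (forall w, `|X w| <= K) -> P.-integrable setT (EFin \o X).
Proof.
move=> mX XK; apply: (bounded_integrable (B := K)) => //.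
exact: (le_lt_trans (probability_le1 P measurableT) (ltry 1)).
Qed.

Lemma le_norm_expectation (X : T -> R) (K : R) :
  measurable_fun setT X -> (forall w, `|X w| <= K) -> `|\int[P]_w X w| <= K.
Proof.
move=> mX XK; apply: (le_trans (le_normr_Rintegral _ _)) => //.
  exact: probability_bounded_integrable XK.
rewrite -[leRHS]expectation_cst; apply: le_Rintegral => //.
- apply: (probability_bounded_integrable (K := K)).
    exact: measurableT_comp.
  by move=> w; rewrite normr_id.
- by apply: (probability_bounded_integrable (K := `|K|)).
Qed.

Lemma natural_measurable_fun (t : R) (X : T -> R) :
  measurable_wrt (natural_filtration Z t) X -> measurable_fun setT X.
Proof.
move=> mX _ B mB; rewrite setTI; apply: natural_filtration_measurable mZ _.
exact: mX.
Qed.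

Lemma measurable_exp_marginal (c t : R) :
  0 <= t -> measurable_fun setT (fun w => expR (- c * Z t w)).
Proof.
move=> t0; apply: measurableT_comp; first exact: measurable_expR.
by apply: measurable_funM; [exact: measurable_cst|exact: mZ].
Qed.

Lemma exp_marginal_le1 (c t : R) (w : T) : 0 <= c -> 0 <= t -> expR (- c * Z t w) <= 1.
Proof. by move=> c0 t0; rewrite expR_le1 mulNr oppr_le0 mulr_ge0// Z0. Qed.

Lemma markov_bounded (s h lam K : R) (Y : T -> R) :
  0 <= s -> 0 <= h -> 0 <= lam -> measurable_wrt (natural_filtration Z s) Y ->
  (forall w, `|Y w| <= K) ->
  \int[P]_w (Y w * expR (- lam * Z (s + h) w)) = \int[P]_w (Y w * expR (- u h lam * Z s w)).
Proof.
move=> s0 h0 l0 mY YK; have [_ _ _ M] := hZ.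
have mY' := natural_measurable_fun mY.
have sh0 : 0 <= s + h by rewrite addr_ge0.
have iY (X : T -> R) (c t L : R) : measurable_fun setT X -> (forall w, `|X w| <= L) ->
    0 <= c -> 0 <= t -> P.-integrable setT (EFin \o (fun w => X w * expR (- c * Z t w))).
  move=> mX XL c0 t0; apply: (probability_bounded_integrable (K := L)).
    by apply: measurable_funM => //; exact: measurable_exp_marginal.
  move=> w; rewrite normrM [ `|expR _|]ger0_norm ?expR_ge0//.
  by rewrite -[leRHS]mulr1 ler_pM ?expR_ge0// exp_marginal_le1.
have K0 (w : T) : 0 <= K by exact: le_trans (normr_ge0 _) (YK w).
have mK1 : measurable_wrt (natural_filtration Z s) (fun w => Y w + K).
  apply/measurable_wrt_naturalP; apply: measurable_funD.
    exact/measurable_wrt_naturalP.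
  exact: measurable_cst.
have mKc : measurable_wrt (natural_filtration Z s) (fun _ : T => `|K|).
  by apply/measurable_wrt_naturalP; exact: measurable_cst.
have E1 := congr1 fine (M s h lam _ s0 h0 l0 mK1 _).
have {}E1 : \int[P]_w ((Y w + K) * expR (- lam * Z (s + h) w)) =
   \int[P]_w ((Y w + K) * expR (- u h lam * Z s w)).
  by apply: E1 => w; have := YK w; rewrite ler_norml => /andP[+ _]; rewrite -lerBlDr sub0r.
have E2 : \int[P]_w (`|K| * expR (- lam * Z (s + h) w)) =
   \int[P]_w (`|K| * expR (- u h lam * Z s w)).
  by apply: (congr1 fine (M s h lam _ s0 h0 l0 mKc _)).
have split_ c t : 0 <= c -> 0 <= t ->
    \int[P]_w (Y w * expR (- c * Z t w)) = \int[P]_w ((Y w + K) * expR (- c * Z t w)) -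
      \int[P]_w (`|K| * expR (- c * Z t w)).
  clear M E1 E2; move=> c0 t0; rewrite -RintegralB//.
  - apply: eq_Rintegral => w _; rewrite (ger0_norm (K0 w)); ring.
  - apply: (iY _ c t (K + K)) => //; first exact: measurable_funD.
    move=> w; apply: (le_trans (ler_normD _ _)); rewrite lerD//.
    by rewrite ger0_norm// (K0 w).
  - by apply: (iY _ c t `|K|) => // w; rewrite normr_id.
rewrite (split_ lam (s + h) l0 sh0) (split_ (u h lam) s (u0 h0 l0) s0).
by rewrite E1 E2.
Qed.

End expectation_derivative.

(** Processes such as exponentials of path integrals, which multiply the
exponential of the process in the functionals below. *)
Definition adapted_factor (R : realType) d (T : measurableType d) (Z : R -> T -> R)
    (a b K : R) (D D' : R -> T -> R) : Prop :=
  [/\ forall t, a <= t <= b -> measurable_wrt (natural_filtration Z t) (D t),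
      forall t w, a <= t <= b -> `|D t w| <= K,
      forall s t w, a <= s -> s <= t -> t <= b -> `|D t w - D s w| <= K * (t - s) &
      forall t w, a <= t < b -> is_rderive (D ^~ w) t (D' t w) ].

Lemma rderive_bound (R : realType) (g : R -> R) (t l : R) :
  is_rderive g t l ->
  exists2 r, 0 < r & forall h, 0 < h < r -> `|g (t + h) - g t| <= (`|l| + 1) * h.
Proof.
move=> /cvgrPdist_lt/(_ 1 ltr01)[r /= r0 Hr]; exists r => // h /andP[h0 hr].
have H1 : `|l - (g (t + h) - g t) / h| < 1.
  by apply: Hr => //=; rewrite sub0r normrN gtr0_norm.
have h1 := ler_normB l (l - (g (t + h) - g t) / h); rewrite subKr in h1.
have : `|(g (t + h) - g t) / h| <= `|l| + 1.
  by apply: (le_trans h1); rewrite lerD2l ltW.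
by rewrite normrM normfV (gtr0_norm h0) ler_pdivrMr.
Qed.

Section exponential_functional.
Context (R : realType) d (T : measurableType d) (P : probability T R).
Context (Z : R -> T -> R) (f : R -> R) (u : R -> R -> R).
Hypothesis hZ : exponential_markov P Z u.
Hypothesis hu : flow_generator f u.

Let mZ : forall t : R, 0 <= t -> measurable_fun setT (Z t). Proof. by case: hZ. Qed.
Let Z0 : forall (t : R) w, 0 <= t -> 0 <= Z t w. Proof. by case: hZ. Qed.
Let cadZ : forall w, cadlag (Z ^~ w). Proof. by case: hZ. Qed.
Let u0 : forall h lam : R, 0 <= h -> 0 <= lam -> 0 <= u h lam. Proof. by case: hu. Qed.

Lemma flow_near (lam : R) : 0 < lam ->
  exists2 r, 0 < r & forall h, 0 < h < r ->
    lam / 2 <= u h lam /\ `|u h lam - lam| <= (`|f lam| + 1) * h.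
Proof.
move=> l0; have [_ u0l du] := hu.
have [r r0 Hr] := rderive_bound (du lam l0).
have K0 : 0 < `|f lam| + 1 by rewrite ltr_wpDl.
exists (Num.min r (lam / 2 / (`|f lam| + 1))).
  by rewrite lt_min r0 !divr_gt0.
move=> h /andP[h0]; rewrite lt_min => /andP[hr hl].
have := Hr h; rewrite h0 hr add0r u0l ?(ltW l0)// normrN => /(_ isT) H.
split=> //; move: hl; rewrite ltr_pdivlMr// => hl.
have : `|u h lam - lam| <= lam / 2 by apply: (le_trans H); rewrite mulrC ltW.
by rewrite ler_norml => /andP[]; lra.
Qed.

Section with_factor.
Variables (a b K c : R) (D D' : R -> T -> R) (v v' : R -> R).
Hypothesis a0 : 0 <= a.
Hypothesis c0 : 0 < c.
Hypothesis hD : adapted_factor Z a b K D D'.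
Hypothesis hv : forall t, a <= t <= b -> c <= v t.
Hypothesis cv : forall t, a < t <= b -> v (t - h) @[h --> 0^'+] --> v t.
Hypothesis dv : forall t, a <= t < b -> is_rderive v t (v' t).

Let mD t : a <= t <= b -> measurable_fun setT (D t).
Proof. by move=> tab; case: hD => H _ _ _; exact: (natural_measurable_fun hZ (H t tab)). Qed.

Let DK t w : a <= t <= b -> `|D t w| <= K. Proof. by case: hD => _ + _ _; exact. Qed.

Let DL s t w : a <= s -> s <= t -> t <= b -> `|D t w - D s w| <= K * (t - s).
Proof. by case: hD => _ _ + _; exact. Qed.

Let mE (lam t : R) : 0 <= t -> measurable_fun setT (fun w => expR (- lam * Z t w)).
Proof. by move=> t0; exact: (measurable_exp_marginal hZ). Qed.

Let E1 (lam t : R) w : 0 <= lam -> 0 <= t -> `|expR (- lam * Z t w)| <= 1.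
Proof. by move=> l0 t0; rewrite ger0_norm ?expR_ge0// (exp_marginal_le1 hZ). Qed.

Let iED (lam t s : R) : 0 <= lam -> 0 <= t -> a <= s <= b ->
  P.-integrable setT (EFin \o (fun w => D s w * expR (- lam * Z t w))).
Proof.
move=> l0 t0 sab; apply: (probability_bounded_integrable P (K := K)).
  by apply: measurable_funM; [exact: mD|exact: mE].
move=> w; rewrite normrM -[leRHS]mulr1; apply: ler_pM => //; first exact: DK.
exact: E1.
Qed.

(** The Markov property replaces [Z] at a later time by the flow. *)
Let flow_step (t h : R) : a <= t -> 0 < h -> t + h <= b -> 0 < v t ->
  \int[P]_w (D (t + h) w * expR (- v (t + h) * Z (t + h) w)) -
  \int[P]_w (D t w * expR (- v t * Z t w)) =
  \int[P]_w (D (t + h) w * expR (- v (t + h) * Z (t + h) w) -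
              D t w * expR (- v t * Z (t + h) w)) +
  \int[P]_w (D t w * (expR (- u h (v t) * Z t w) - expR (- v t * Z t w))).
Proof.
move=> at_ h0 thb vt0.
have tab : a <= t <= b by rewrite at_ (le_trans _ thb)// lerDl ltW.
have thab : a <= t + h <= b by rewrite thb (le_trans at_)// lerDl ltW.
have t0 : 0 <= t by exact: le_trans at_.
have th0 : 0 <= t + h by rewrite addr_ge0// ltW.
have vth : 0 <= v (t + h) by apply: (le_trans (ltW c0)); exact: hv.
have vt00 : 0 <= v t by exact: ltW.
rewrite RintegralB; [|by []|exact: iED|exact: iED].
have mDt : measurable_wrt (natural_filtration Z t) (D t) by case: hD => + _ _ _; exact.
rewrite (markov_bounded hZ hu t0 (ltW h0) (ltW vt0) mDt (fun w => DK w tab)).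
rewrite (_ : \int[P]_w (D t w * (_ - _)) =
  \int[P]_w (D t w * expR (- u h (v t) * Z t w)) - \int[P]_w (D t w * expR (- v t * Z t w))).
  by rewrite addrA subrK.
rewrite -RintegralB//; [|by apply: iED => //; apply: u0 => //; exact: ltW|
  by apply: iED => //; exact: ltW].
by apply: eq_Rintegral => w _; rewrite mulrBr.
Qed.

(** The increment of the functional has three parts: the change of [v], the change
of [D], and the change of [Z], which the Markov property turns into a change of
exponent along the flow. Each quotient is bounded by a constant, because
[expR (- v * z)] is Lipschitz in [v] uniformly in [z >= 0] when [v >= c > 0]. *)
Lemma functional_rderive (t : R) : a <= t < b ->
  is_rderive (fun r => \int[P]_w (D r w * expR (- v r * Z r w))) t
    (\int[P]_w (expR (- v t * Z t w) * ((f (v t) - v' t) * Z t w * D t w + D' t w))).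
Proof.
move=> /andP[at_ tb].
have tab : a <= t <= b by rewrite at_ ltW.
have t0 : 0 <= t by exact: le_trans at_.
have vt0 : 0 < v t by apply: (lt_le_trans c0); exact: hv.
have [_ u0l du] := hu.
have dvt : is_rderive v t (v' t) by apply: dv; rewrite at_.
have [r1 r10 H1] := rderive_bound dvt.
have [r2 r20 H2] := flow_near vt0.
pose r := Num.min (b - t) (Num.min r1 r2).
have r0 : 0 < r by rewrite !lt_min r10 r20 subr_gt0 tb.
have hr h : 0 < h < r -> [/\ 0 < h, t + h <= b, 0 < h < r1 & 0 < h < r2].
  move=> /andP[h0]; rewrite !lt_min => /and3P[hb h1 h2].
  by rewrite h0 h1 h2 -lerBrDl ltW.
pose F h w := ((D (t + h) w * expR (- v (t + h) * Z (t + h) w) -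
              D t w * expR (- v t * Z (t + h) w)) +
  D t w * (expR (- u h (v t) * Z t w) - expR (- v t * Z t w))) / h.
have FE h : 0 < h < r ->
  (\int[P]_w (D (t + h) w * expR (- v (t + h) * Z (t + h) w)) -
  \int[P]_w (D t w * expR (- v t * Z t w))) / h = \int[P]_w F h w.
  move=> /hr[h0 thb _ _].
  have thab : a <= t + h <= b by rewrite thb (le_trans at_)// lerDl ltW.
  have th0 : 0 <= t + h by rewrite addr_ge0// ltW.
  have vth : 0 <= v (t + h) by apply: (le_trans (ltW c0)); exact: hv.
  have uv0 : 0 <= u h (v t) by apply: u0; exact: ltW.
  have i1 : P.-integrable setT (EFin \o (fun w => D (t + h) w * expR (- v (t + h) * Z (t + h) w)
      - D t w * expR (- v t * Z (t + h) w))).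
    exact: (integrableB measurableT (iED vth th0 thab) (iED (ltW vt0) th0 tab)).
  have i2 : P.-integrable setT (EFin \o (fun w =>
      D t w * (expR (- u h (v t) * Z t w) - expR (- v t * Z t w)))).
    have := integrableB measurableT (iED uv0 t0 tab) (iED (ltW vt0) t0 tab).
    apply: eq_integrable => // w _ /=; congr EFin; ring.
  rewrite flow_step// -RintegralD// -RintegralZr//.
  exact: (integrableD measurableT i1 i2).
have B1 w h : 0 < h < r -> `|F h w| <= K * (`|v' t| + 1) / c + K +
    K * (`|f (v t)| + 1) / (v t / 2).
  move=> /[dup] hh /hr[h0 thb hr1 hr2].
  have thab : a <= t + h <= b by rewrite thb (le_trans at_)// lerDl ltW.
  have th0 : 0 <= t + h by rewrite addr_ge0// ltW.
  have [ul uh] := H2 h hr2; have vh := H1 h hr1.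
  have K0 : 0 <= K by exact: le_trans (normr_ge0 _) (DK w tab).
  rewrite normrM normfV (gtr0_norm h0) ler_pdivrMr//.
  rewrite (_ : D (t + h) w * expR (- v (t + h) * Z (t + h) w) -
              D t w * expR (- v t * Z (t + h) w) =
    D (t + h) w * (expR (- v (t + h) * Z (t + h) w) - expR (- v t * Z (t + h) w)) +
    (D (t + h) w - D t w) * expR (- v t * Z (t + h) w)); last by ring.
  rewrite [leRHS]mulrDl [X in _ <= X + _]mulrDl.
  apply: (le_trans (ler_normD _ _)); apply: lerD.
    apply: (le_trans (ler_normD _ _)); apply: lerD.
      rewrite normrM -mulrA -[leRHS]mulrA; apply: ler_pM => //; first exact: DK.
      apply: (le_trans (expRN_lip c0 (hv thab) (hv tab) (Z0 w th0))).
      by rewrite -mulrAC ler_pM2r ?invr_gt0// mulrC.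
    rewrite normrM -[leRHS]mulr1; apply: ler_pM => //; last exact: E1 (ltW vt0) th0.
    have := DL w at_ (_ : t <= t + h) thb; rewrite lerDl (ltW h0) => /(_ isT).
    by rewrite addrAC subrr add0r.
  rewrite normrM -mulrA -[leRHS]mulrA; apply: ler_pM => //; first exact: DK.
  have v20 : 0 < v t / 2 by rewrite divr_gt0.
  have vv : v t / 2 <= v t by rewrite ler_pdivrMr// ler_peMr ?(ltW vt0)// (ler_nat R 1 2).
  apply: (le_trans (expRN_lip v20 ul vv (Z0 w t0))).
  by rewrite -mulrAC ler_pM2r ?invr_gt0.
have C1 w : F h w @[h --> 0^'+] -->
    expR (- v t * Z t w) * ((f (v t) - v' t) * Z t w * D t w + D' t w).
  have cZ : Z (t + h) w @[h --> 0^'+] --> Z t w.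
    by have [rc _] := cadZ w; exact: cvg_right_shift (rc t t0).
  have cexp : expR (- v t * Z (t + h) w) @[h --> 0^'+] --> expR (- v t * Z t w).
    have cm : - v t * Z (t + h) w @[h --> 0^'+] --> - v t * Z t w.
      by apply: cvgM => //; exact: cvg_cst.
    exact: (cvg_comp _ _ cm (@continuous_expR R _)).
  have dD : is_rderive (D ^~ w) t (D' t w) by case: hD => _ _ _; apply; rewrite at_.
  have d1 : is_rderive (fun h => expR (- (v (t + h) - v t) * Z (t + h) w)) 0 (- v' t * Z t w).
    have : is_rderive (fun h => - (v (t + h) - v t) * Z (t + h) w) 0 (- v' t * Z t w).
      rewrite /is_rderive (_ : (fun h => _) = fun h => - ((v (t + h) - v t) / h) * Z (t + h) w).
        by apply: cvgM => //; apply: cvgN.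
      by apply/funext => h; rewrite addr0 add0r subrr oppr0 mul0r subr0; ring.
    by move=> /rderive_expR; rewrite addr0 subrr oppr0 mul0r expR0 mul1r.
  have d2 : is_rderive (fun h => expR (- u h (v t) * Z t w)) 0
      (expR (- v t * Z t w) * (f (v t) * Z t w)).
    have := rderive_expR (@rderiveZ R (- Z t w) _ _ _ (du _ vt0)).
    rewrite u0l ?(ltW vt0)// (_ : (fun s => expR _) = fun s => expR (- u s (v t) * Z t w)).
      rewrite (_ : - Z t w * v t = - v t * Z t w); last by ring.
      by rewrite (_ : - Z t w * - f (v t) = f (v t) * Z t w); last by ring.
    by apply/funext => s; congr expR; ring.
  rewrite (_ : expR _ * _ = (D t w * (expR (- v t * Z t w) * (- v' t * Z t w)) +
     expR (- v t * Z t w) * D' t w) +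
     D t w * (expR (- v t * Z t w) * (f (v t) * Z t w))); last by ring.
  rewrite (_ : F ^~ w = fun h =>
    (D (t + h) w * (expR (- v t * Z (t + h) w) *
      ((expR (- (v (t + (0 + h)) - v t) * Z (t + (0 + h)) w) -
        expR (- (v (t + 0) - v t) * Z (t + 0) w)) / h)) +
     expR (- v t * Z (t + h) w) * ((D (t + h) w - D t w) / h)) +
     D t w * ((expR (- u (0 + h) (v t) * Z t w) - expR (- u 0 (v t) * Z t w)) / h)).
    apply: cvgD.
      apply: cvgD; last exact: cvgM.
      by apply: cvgM; [exact: rderive_cvg dD|apply: cvgM].
    by apply: cvgM => //; exact: cvg_cst.
  apply/funext => h; rewrite /F add0r u0l ?(ltW vt0)// addr0 subrr oppr0 mul0r expR0.
  rewrite (_ : - v (t + h) * Z (t + h) w =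
    - v t * Z (t + h) w + - (v (t + h) - v t) * Z (t + h) w); last by ring.
  by rewrite expRD; ring.
rewrite /is_rderive.
have mF h : 0 < h < r -> measurable_fun setT (F h).
  move=> /hr[h0 thb _ _].
  have thab : a <= t + h <= b by rewrite thb (le_trans at_)// lerDl ltW.
  have th0 : 0 <= t + h by rewrite addr_ge0// ltW.
  apply: measurable_funM; last exact: measurable_cst.
  apply: measurable_funD.
    apply: measurable_funB; apply: measurable_funM;
      by [exact: mD|exact: mE].
  apply: measurable_funM; first exact: mD.
  by apply: measurable_funB; exact: mE.
have := Rintegral_dominated_at_right (mu := P) measurableT r0 mF (fun w _ => C1 w)
  (g := fun=> K * (`|v' t| + 1) / c + K + K * (`|f (v t)| + 1) / (v t / 2)).
move=> H; have {}H : \int[P]_w F h w @[h --> 0^'+] -->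
   \int[P]_w (expR (- v t * Z t w) * ((f (v t) - v' t) * Z t w * D t w + D' t w)).
  apply: H; last by move=> h w hh _; exact: B1.
  apply: (probability_bounded_integrable P) => //.
apply: (cvg_trans _ H); apply: near_eq_cvg; near=> h.
rewrite FE//; apply/andP; split; first by near: h; exact: nbhs_right_gt.
by near: h; exact: nbhs_right_lt.
Unshelve. all: by end_near. Qed.

(** On the left the Markov property is applied at time [t - h], so that only the
left-continuity of [v] matters and no left limit of [Z] appears. *)
Lemma functional_continuous :
  {within `[a, b], continuous (fun r => \int[P]_w (D r w * expR (- v r * Z r w)))}.
Proof.
apply: within_itv_of_sides => t /andP[at_ tb].
  have tab : a <= t < b by rewrite at_.
  exact: (rderive_cvg (functional_rderive tab)).
have tab : a <= t <= b by rewrite tb ltW.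
have t0 : 0 <= t by apply: (le_trans a0); exact: ltW.
have vt0 : 0 < v t by apply: (lt_le_trans c0); exact: hv.
have v20 : 0 < v t / 2 by rewrite divr_gt0.
have [r r0 Hr] := flow_near vt0.
pose B (h : R) := K * h + K * ((`|f (v t)| + 1) * h / (v t / 2)) + K * (`|v t - v (t - h)| / c).
have cB : B h @[h --> 0^'+] --> (0 : R).
  have ch : h @[h --> (0 : R)^'+] --> (0 : R) by apply: cvg_at_right_filter; exact: cvg_id.
  have vab : a < t <= b by rewrite at_.
  have c1 : `|v t - v (t - h)| @[h --> 0^'+] --> `|v t - v t|.
    by apply: cvg_norm; apply: cvgB; [exact: cvg_cst|exact: cv].
  rewrite subrr normr0 in c1.
  rewrite [X in _ --> X](_ : 0 = K * 0 + K * ((`|f (v t)| + 1) * 0 / (v t / 2)) + K * (0 / c)) //; last first.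
    by rewrite !mul0r !mulr0 mul0r mulr0 !addr0.
  apply: cvgD; last by apply: cvgMl_tmp; apply: cvgMr_tmp; exact: c1.
  apply: cvgD; first by apply: cvgMl_tmp; exact: ch.
  by apply: cvgMl_tmp; apply: cvgMr_tmp; apply: cvgMl_tmp; exact: ch.
apply/cvgrPdist_le => e e0; have /cvgrPdist_le/(_ e e0) HB := cB.
near=> h.
have h0 : 0 < h by near: h; exact: nbhs_right_gt.
have hr : h < r by near: h; exact: nbhs_right_lt.
have ha : h < t - a by near: h; apply: nbhs_right_lt; rewrite subr_gt0.
apply: (@le_trans _ _ (B h)); last first.
  apply: (le_trans (ler_norm _)); rewrite -[X in `|X|]opprK normrN -[- B h]sub0r.
  by near: h.
have ath : a <= t - h by rewrite lerBrDl -lerBrDr ltW.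
have th : t - h <= t by rewrite gerBl ltW.
have thab : a <= t - h <= b by rewrite ath (le_trans th tb).
have th0 : 0 <= t - h by exact: le_trans ath.
have vth : 0 <= v (t - h) by apply: (le_trans (ltW c0)); exact: hv.
have [ul uh] : v t / 2 <= u h (v t) /\ `|u h (v t) - v t| <= (`|f (v t)| + 1) * h.
  by apply: Hr; rewrite h0.
have uv0 : 0 <= u h (v t) by apply: (le_trans (ltW v20)).
have vv : v t / 2 <= v t by rewrite ler_pdivrMr// ler_peMr ?(ltW vt0)// (ler_nat R 1 2).
have mDt : measurable_wrt (natural_filtration Z (t - h)) (D (t - h)).
  by case: hD => + _ _ _; exact.
have M := markov_bounded hZ hu th0 (ltW h0) (ltW vt0) mDt (fun w => DK w thab).
rewrite subrK in M.
have mDE s l s' : 0 <= s' -> a <= s <= b ->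
    measurable_fun setT (fun w => D s w * expR (- l * Z s' w)).
  by move=> s'0 sab; apply: measurable_funM; [exact: mD|exact: mE].
rewrite (_ : _ - _ = \int[P]_w ((D t w - D (t - h) w) * expR (- v t * Z t w)) +
   \int[P]_w (D (t - h) w * (expR (- u h (v t) * Z (t - h) w) - expR (- v t * Z (t - h) w))) +
   \int[P]_w (D (t - h) w * (expR (- v t * Z (t - h) w) - expR (- v (t - h) * Z (t - h) w))));
  last first.
  rewrite (_ : \int[P]_w ((D t w - D (t - h) w) * _) =
    \int[P]_w (D t w * expR (- v t * Z t w)) -
    \int[P]_w (D (t - h) w * expR (- u h (v t) * Z (t - h) w))); last first.
    rewrite -M -RintegralB; [|by []|exact: iED (ltW vt0) t0 tab|exact: iED (ltW vt0) t0 thab].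
    by apply: eq_Rintegral => w _; rewrite mulrBl.
  rewrite (_ : \int[P]_w (D (t - h) w * (expR (- u h (v t) * _) - _)) =
    \int[P]_w (D (t - h) w * expR (- u h (v t) * Z (t - h) w)) -
    \int[P]_w (D (t - h) w * expR (- v t * Z (t - h) w))); last first.
    rewrite -RintegralB; [|by []|exact: iED uv0 th0 thab|exact: iED (ltW vt0) th0 thab].
    by apply: eq_Rintegral => w _; rewrite mulrBr.
  rewrite (_ : \int[P]_w (D (t - h) w * (expR (- v t * Z (t - h) w) - _)) =
    \int[P]_w (D (t - h) w * expR (- v t * Z (t - h) w)) -
    \int[P]_w (D (t - h) w * expR (- v (t - h) * Z (t - h) w))); last first.
    rewrite -RintegralB; [|by []|exact: iED (ltW vt0) th0 thab|exact: iED vth th0 thab].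
    by apply: eq_Rintegral => w _; rewrite mulrBr.
  by rewrite !subrKA.
have mdiff l l' : measurable_fun setT (fun w =>
    D (t - h) w * (expR (- l * Z (t - h) w) - expR (- l' * Z (t - h) w))).
  by apply: measurable_funM; [exact: mD|apply: measurable_funB; exact: mE].
apply: (le_trans (ler_normD _ _)); apply: lerD.
  apply: (le_trans (ler_normD _ _)); apply: lerD.
    apply: (le_norm_expectation P).
      by apply: measurable_funM; [apply: measurable_funB; exact: mD|exact: mE].
    move=> w; rewrite normrM -[leRHS]mulr1; apply: ler_pM => //; last exact: E1 (ltW vt0) t0.
    by have := DL w ath th tb; rewrite subKr.
  apply: (le_norm_expectation P); first exact: mdiff.
  move=> w; rewrite normrM; apply: ler_pM => //; first exact: DK.
  apply: (le_trans (expRN_lip v20 ul vv (Z0 w th0))).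
  by rewrite ler_pM2r ?invr_gt0.
apply: (le_norm_expectation P); first exact: mdiff.
move=> w; rewrite normrM; apply: ler_pM => //; first exact: DK.
exact: (expRN_lip c0 (hv tab) (hv thab) (Z0 w th0)).
Unshelve. all: by end_near. Qed.

End with_factor.
End exponential_functional.

(** * Flows of convex functions *)

Definition convex_on_half_line (R : realType) (f : R -> R) : Prop :=
  forall x y t : R, 0 <= x -> 0 <= y -> 0 <= t <= 1 ->
    f (t * x + (1 - t) * y) <= t * f x + (1 - t) * f y.

Section convex.
Context (R : realType) (f : R -> R).
Hypothesis cf : convex_on_half_line f.
Hypothesis f0 : f 0 = 0.

Lemma convex_chord (x y : R) : 0 < x -> 0 <= y <= x -> f y <= y / x * f x.
Proof.
move=> x0 /andP[y0 yx].
have := cf (t := y / x) (ltW x0) (lexx 0).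
rewrite mulr0 addr0 divfK ?gt_eqF// f0 mulr0 addr0; apply.
by rewrite divr_ge0 ?(ltW x0)//= ler_pdivrMr// mul1r.
Qed.

(** The slopes of the chords through [x] with other end in [[0, x + x]] lie between
those of the two extreme chords. *)
Lemma convex_lipschitz_at (x y : R) : 0 < x -> 0 <= y <= x + x ->
  `|f y - f x| <= (`|f x| + `|f (x + x) - f x|) / x * `|y - x|.
Proof.
move=> x0 /andP[y0 y2x].
suff : `|f y - f x| * x <= (`|f x| + `|f (x + x) - f x|) * `|y - x|.
  by rewrite -ler_pdivlMr// mulrAC.
have x20 : 0 < x + x by rewrite addr_gt0.
have A1 := ler_norm (f x); have A2 := ler_norm (- f x).
have B1 := ler_norm (f (x + x) - f x); have B2 := ler_norm (- (f (x + x) - f x)).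
rewrite !normrN in A2 B2.
have [xy|yx] := leP x y.
  have y0' : 0 < y by exact: lt_le_trans xy.
  have H1 : (f y - f x) * x <= (f (x + x) - f x) * (y - x).
    have := cf (t := (y - x) / x) (ltW x20) (ltW x0).
    rewrite (_ : (y - x) / x * (x + x) + (1 - (y - x) / x) * x = y); last first.
      by field; rewrite gt_eqF.
    have t01 : 0 <= (y - x) / x <= 1.
      rewrite divr_ge0 ?(ltW x0) ?subr_ge0//= ler_pdivrMr// mul1r; lra.
    move=> /(_ t01) h; have := ler_wpM2r (ltW x0) h.
    rewrite (_ : ((y - x) / x * f (x + x) + (1 - (y - x) / x) * f x) * x =
      (y - x) * f (x + x) + (x - (y - x)) * f x); last by field; rewrite gt_eqF.
    by set F := f (x + x); set G := f x; set H := f y => h2; lra.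
  have H2 : f x * (y - x) <= (f y - f x) * x.
    have := @convex_chord y x y0' _; rewrite (ltW x0) xy => /(_ isT) h.
    have := ler_wpM2l (ltW y0') h; rewrite mulrA mulrCA divff ?gt_eqF// mulr1 => h2.
    by move: h2; set F := f x; set H := f y => h2; lra.
  rewrite [ `|y - x|]ger0_norm ?subr_ge0// -[X in _ * X <= _](gtr0_norm x0) -normrM.
  have yx0 : 0 <= y - x by rewrite subr_ge0.
  rewrite ler_norml; apply/andP; split; nra.
have H1 : (f y - f x) * x <= f x * (y - x).
  have := @convex_chord x y x0 _; rewrite y0 (ltW yx) => /(_ isT) h.
  have := ler_wpM2r (ltW x0) h; rewrite mulrAC divfK ?gt_eqF// => h2.
  by move: h2; set F := f x; set H := f y => h2; lra.
have d0 : 0 < x + x - y by lra.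
have H2 : (x - y) * (f x - f (x + x)) <= (f y - f x) * x.
  have := cf (t := x / (x + x - y)) y0 (ltW x20).
  rewrite (_ : x / (x + x - y) * y + (1 - x / (x + x - y)) * (x + x) = x); last first.
    by field; rewrite gt_eqF.
  have t01 : 0 <= x / (x + x - y) <= 1.
    rewrite divr_ge0 ?(ltW x0) ?(ltW d0)//= ler_pdivrMr// mul1r; lra.
  move=> /(_ t01) h; have := ler_wpM2r (ltW d0) h.
  rewrite (_ : (x / (x + x - y) * f y + (1 - x / (x + x - y)) * f (x + x)) * (x + x - y) =
    x * f y + (x - y) * f (x + x)); last by field; rewrite gt_eqF.
  by set F := f (x + x); set G := f x; set H := f y => h2; lra.
rewrite distrC [ `|y - x|]distrC [ `|x - y|]gtr0_norm ?subr_gt0//.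
rewrite -[X in _ * X <= _](gtr0_norm x0) -normrM.
have yx0 : 0 < x - y by rewrite subr_gt0.
rewrite ler_norml; apply/andP; split; nra.
Qed.

Lemma convex_continuous_at (x : R) : 0 < x -> f y @[y --> x] --> f x.
Proof.
move=> x0; pose K := (`|f x| + `|f (x + x) - f x|) / x.
have K0 : 0 <= K by rewrite divr_ge0 ?addr_ge0// ltW.
apply/cvgrPdist_lt => e e0; near=> y.
have yx : `|x - y| < Num.min x (e / (K + 1)).
  near: y; apply/nbhs_ballP; exists (Num.min x (e / (K + 1))) => //=.
  by rewrite lt_min x0 divr_gt0// ltr_wpDl.
move: yx; rewrite lt_min ltr_pdivlMr ?ltr_wpDl// => /andP[yx ye].
have yI : 0 <= y <= x + x.
  by move: yx; rewrite ltr_norml => /andP[h1 h2]; apply/andP; split; lra.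
rewrite distrC; apply: (le_lt_trans (convex_lipschitz_at x0 yI)).
rewrite -/K distrC; apply: le_lt_trans ye; rewrite mulrC ler_wpM2l//; lra.
Unshelve. all: by end_near. Qed.

End convex.

Section flow.
Context (R : realType) (f : R -> R) (u : R -> R -> R).
Hypothesis cf : convex_on_half_line f.
Hypothesis f0 : f 0 = 0.
Hypothesis hu : laplace_exponent f u.

Lemma flow_ge0 (a lam : R) : 0 <= a -> 0 <= lam -> 0 <= u a lam.
Proof. by move=> a0 l0; have [] := hu l0 => + _; exact. Qed.

Lemma flow_start (lam : R) : 0 <= lam -> u 0 lam = lam.
Proof.
move=> l0; have [_ /(_ 0 (lexx 0))[_]] := hu l0.
by rewrite set_itv1 Rintegral_set1 addr0.
Qed.

Lemma flow_integrable (a lam : R) : 0 <= a -> 0 <= lam ->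
  (@lebesgue_measure R).-integrable `[0%R, a]%classic (EFin \o (fun s => f (u s lam))).
Proof. by move=> a0 l0; have [_ /(_ a a0)[]] := hu l0. Qed.

Lemma flowE (a lam : R) : 0 <= a -> 0 <= lam ->
  u a lam = lam - \int[lebesgue_measure]_(s in `[0, a]) f (u s lam).
Proof. by move=> a0 l0; have [_ /(_ a a0)[_ /(canRL (addrK _))]] := hu l0. Qed.

Lemma flow_continuous (a lam : R) : 0 <= a -> 0 <= lam ->
  {within `[0, a], continuous (u ^~ lam)}.
Proof.
move=> a0 l0.
have := parameterized_integral_continuous a0 (flow_integrable a0 l0).
move=> /subspace_continuousP H; apply/subspace_continuousP => t tI /=.
rewrite [X in _ --> X]flowE//; last by move: tI; rewrite /= in_itv/= => /andP[].
have {}H : (lam - \int[lebesgue_measure]_(r in `[0, s]) f (u r lam))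
    @[s --> within `[0, a] (nbhs t)] --> lam - \int[lebesgue_measure]_(r in `[0, t]) f (u r lam).
  by apply: cvgB; [exact: cvg_cst|exact: H].
apply: (cvg_trans _ H); apply: near_eq_cvg; rewrite near_withinE; near=> s => sI /=.
rewrite /from_subspace/= flowE//.
by move: sI; rewrite /= in_itv/= => /andP[].
Unshelve. all: by end_near. Qed.

Lemma flow_right (t lam : R) : 0 <= t -> 0 <= lam -> u (t + h) lam @[h --> 0^'+] --> u t lam.
Proof.
move=> t0 l0; have t1 : 0 <= t + 1 by rewrite addr_ge0.
have /subspace_continuousP H := flow_continuous t1 l0.
have := H t _; rewrite /= in_itv/= t0 lerDl ler01 => /(_ isT)/cvgrPdist_lt {}H.
apply/cvgrPdist_lt => e e0; have := H e e0; rewrite near_withinE => /nbhs_ballP[d /= d0 Hd].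
near=> h; have h0 : 0 < h by near: h; exact: nbhs_right_gt.
apply: Hd; last first.
  rewrite /= in_itv/= addr_ge0 ?(ltW h0)//= lerD2l.
  by near: h; exact: nbhs_right_le.
rewrite /ball/= opprD addrA subrr sub0r normrN gtr0_norm//.
Unshelve. all: by end_near. Qed.

Lemma flow_left (t lam : R) : 0 < t -> 0 <= lam -> u (t - h) lam @[h --> 0^'+] --> u t lam.
Proof.
move=> t0 l0; have /subspace_continuousP H := flow_continuous (ltW t0) l0.
have := H t _; rewrite /= in_itv/= (ltW t0) lexx => /(_ isT)/cvgrPdist_lt {}H.
apply/cvgrPdist_lt => e e0; have := H e e0; rewrite near_withinE => /nbhs_ballP[d /= d0 Hd].
near=> h; have h0 : 0 < h by near: h; exact: nbhs_right_gt.
apply: Hd; last first.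
  rewrite /= in_itv/= subr_ge0 gerBl (ltW h0) andbT.
  by near: h; exact: nbhs_right_le.
rewrite /ball/= subKr gtr0_norm//.
Unshelve. all: by end_near. Qed.

Lemma flow_rderive_pos (t lam : R) : 0 <= t -> 0 <= lam -> 0 < u t lam ->
  is_rderive (u ^~ lam) t (- f (u t lam)).
Proof.
move=> t0 l0 ut; have t1 : 0 <= t + 1 by rewrite addr_ge0.
have ig := flow_integrable t1 l0.
have := integral_rderive_right ig (t := t); rewrite t0 ltrDl ltr01 => /(_ isT).
have fu : f (u (t + h) lam) @[h --> 0^'+] --> f (u t lam).
  exact: (cvg_comp _ _ (flow_right t0 l0) (convex_continuous_at cf f0 ut)).
move=> /(_ fu) H; pose I r := \int[lebesgue_measure]_(s in `[0, r]) f (u s lam).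
have {}H : - ((I (t + h) - I t) / h) @[h --> 0^'+] --> - f (u t lam) by exact: cvgN H.
rewrite /is_rderive.
apply: (cvg_trans _ H); apply: near_eq_cvg; near=> h.
have h0 : 0 < h by near: h; exact: nbhs_right_gt.
rewrite !flowE ?addr_ge0 ?(ltW h0)// -mulNr; congr (_ / _).
by rewrite -/(I _) -/(I _); ring.
Unshelve. all: by end_near. Qed.

(** Convexity and [f 0 = 0] bound [f] by a linear function on bounded sets, so
the flow decays at most exponentially and cannot reach [0]. *)
Lemma flow_lower_bound (a lam : R) : 0 <= a -> 0 < lam ->
  exists2 c, 0 < c & forall t, 0 <= t <= a -> c <= u t lam.
Proof.
move=> a0 l0; have l00 := ltW l0.
have [Y Y0 HY] : exists2 Y, 0 < Y & forall t, 0 <= t <= a -> u t lam <= Y.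
  have [c _ Hc] := EVT_max a0 (flow_continuous a0 l00).
  exists (`|u c lam| + 1); first by rewrite ltr_wpDl.
  move=> t tI; apply: (le_trans (Hc t _)); first by rewrite in_itv.
  by apply: (le_trans (ler_norm _)); rewrite lerDl.
pose C := `|f Y| / Y.
have C0 : 0 <= C by rewrite divr_ge0// ltW.
have fC y : 0 <= y <= Y -> f y <= C * y.
  move=> yI; apply: (le_trans (convex_chord cf f0 Y0 yI)).
  rewrite (_ : C * y = y / Y * `|f Y|); last by rewrite /C; ring.
  by rewrite ler_wpM2l ?ler_norm//; case/andP: yI => y0 _; rewrite divr_ge0// ltW.
have decay b : 0 <= b <= a -> (forall t, 0 <= t < b -> 0 < u t lam) ->
    expR (- C * b) * lam <= u b lam.
  move=> /andP[b0 ba] up.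
  have cu : {within `[0, b], continuous (fun t => -1 * u t lam)}.
    by move=> x; apply: cvgM; [exact: cvg_cst|exact: flow_continuous].
  have := rderive_gronwall (f := fun t => -1 * u t lam) (C := - C) b0 cu.
  rewrite subr0 flow_start// => H; suff : -1 * u b lam <= expR (- C * b) * (-1 * lam) by lra.
  apply: H => t tb; have /andP[t0 tb'] := tb.
  exists (-1 * - f (u t lam)); first by apply: rderiveZ; apply: flow_rderive_pos => //; exact: up.
  have : f (u t lam) <= C * u t lam.
    by apply: fC; rewrite flow_ge0//= HY// t0 (le_trans (ltW tb')).
  lra.
have pos t : 0 <= t <= a -> 0 < u t lam.
  move=> /andP[t0 ta]; rewrite ltNge; apply/negP => ut.
  pose S := [set s | 0 <= s <= t /\ u s lam <= 0].
  have St : S t by split => //; rewrite t0 lexx.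
  have infS : has_inf S by split; [exists t|exists 0 => s -[/andP[]]].
  pose s := inf S.
  have s0 : 0 <= s by apply: lb_le_inf; [exists t|move=> r -[/andP[]]].
  have st : s <= t by apply: ge_inf; [case: infS|].
  have below r : 0 <= r < s -> 0 < u r lam.
    move=> /andP[r0 rs]; rewrite ltNge; apply/negP => ur.
    have : s <= r.
      by apply: ge_inf; [case: infS|split => //; rewrite r0 (le_trans (ltW rs))].
    by rewrite leNgt rs.
  have us : 0 < u s lam.
    apply: (lt_le_trans _ (decay s _ below)); first by rewrite mulr_gt0 ?expR_gt0.
    by rewrite s0 (le_trans st).
  have /cvgrPdist_lt/(_ _ us)[d /= d0 Hd] := flow_right s0 l00.
  have [r Sr rsd] := inf_adherent d0 infS.
  have sr : s <= r by apply: ge_inf; [case: infS|].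
  case: Sr => _; apply/negP; rewrite -ltNge.
  move: sr; rewrite le_eqVlt => /predU1P[<-//|sr].
  have := Hd (r - s); rewrite /= sub0r normrN gtr0_norm ?subr_gt0// => /(_ _ sr).
  rewrite [s + _](_ : _ = r); last by ring.
  move=> H; have {}H : `|u s lam - u r lam| < u s lam by apply: H; rewrite -/s in rsd; lra.
  by move: H; rewrite ltr_norml => /andP[]; lra.
exists (expR (- C * a) * lam); first by rewrite mulr_gt0 ?expR_gt0.
move=> t tI; have /andP[t0 ta] := tI.
apply: (le_trans _ (decay t tI _)).
  by rewrite ler_wpM2r// ler_expR !mulNr lerN2 ler_wpM2l.
by move=> r /andP[r0 rt]; apply: pos; rewrite r0 (le_trans (ltW rt)).
Qed.

Lemma flow_pos (t lam : R) : 0 <= t -> 0 < lam -> 0 < u t lam.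
Proof.
by move=> t0 /(flow_lower_bound t0)[c c0]; move/(_ t); rewrite t0 lexx => /(_ isT); exact: lt_le_trans.
Qed.

Lemma flow_rderive (t lam : R) : 0 <= t -> 0 < lam -> is_rderive (u ^~ lam) t (- f (u t lam)).
Proof. by move=> t0 l0; apply: flow_rderive_pos (ltW l0) _ => //; exact: flow_pos. Qed.

(** The flow run backwards from [b] solves the equation that makes the exponential
functionals below constant in mean. *)
Lemma flow_backward (b t lam : R) : t < b -> 0 < lam -> 0 <= t ->
  is_rderive (fun r => u (b - r) lam) t (f (u (b - t) lam)).
Proof.
move=> tb l0 t0; have bt0 : 0 < b - t by rewrite subr_gt0.
have ig := flow_integrable (ltW bt0) (ltW l0).
have := integral_rderive_left ig (t := b - t); rewrite bt0 lexx => /(_ isT).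
have fu : f (u (b - t - h) lam) @[h --> 0^'+] --> f (u (b - t) lam).
  apply: (cvg_comp _ _ (flow_left bt0 (ltW l0))).
  exact: (convex_continuous_at cf f0 (flow_pos (ltW bt0) l0)).
move=> /(_ fu) H; pose I r := \int[lebesgue_measure]_(s in `[0, r]) f (u s lam).
have {}H : - ((I (b - t - h) - I (b - t)) / h) @[h --> 0^'+] --> f (u (b - t) lam).
  by rewrite -[X in _ --> X]opprK; exact: cvgN H.
rewrite /is_rderive.
apply: (cvg_trans _ H); apply: near_eq_cvg; near=> h.
have h0 : 0 < h by near: h; exact: nbhs_right_gt.
have hb : h <= b - t by near: h; exact: nbhs_right_le.
rewrite opprD addrA !flowE ?(ltW bt0) ?(ltW l0) ?subr_ge0// -mulNr; congr (_ / _).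
by rewrite -/(I _) -/(I _); ring.
Unshelve. all: by end_near. Qed.

Lemma laplace_exponent_generator : flow_generator f u.
Proof.
split; [exact: flow_ge0|exact: flow_start|].
by move=> lam l0; have := flow_rderive (lexx 0) l0; rewrite flow_start// ltW.
Qed.

End flow.

Lemma integral_fatou_bound d (T : measurableType d) (R : realType)
    (mu : {measure set T -> \bar R}) (F : nat -> T -> R) (f : T -> R) (B : \bar R) :
  (forall n, measurable_fun setT (F n)) -> (forall n x, 0 <= F n x) ->
  (forall x, F n x @[n --> \oo] --> f x) ->
  (forall n, \int[mu]_x (F n x)%:E <= B)%E -> (\int[mu]_x (f x)%:E <= B)%E.
Proof.
move=> mF F0 Ff FB.
have H := @fatou _ T R mu setT measurableT (fun n x => (F n x)%:E) _ _.
apply: (le_trans (y := (\int[mu]_x (limn_einf (fun n => (F n x)%:E)))%E)).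
  rewrite (_ : (fun x => (f x)%:E) = (fun x => limn_einf (fun n => (F n x)%:E)))//.
  apply/funext => x; apply/esym.
  have h : (F n x)%:E @[n --> \oo] --> (f x)%:E by apply: cvg_EFin; [exact: nearW|exact: Ff].
  by have [-> _] := cvg_limn_einf_sup h.
apply: (le_trans (H _ _)).
- by move=> n; exact/measurable_EFinP.
- by move=> n x _; rewrite lee_fin.
rewrite limn_einf_lim; apply: lime_le; first exact: is_cvg_einfs.
apply: nearW => n; apply: le_trans (FB n).
by apply: ereal_inf_lbound; exists n => /=.
Qed.

(** * Adapted factors built from path integrals *)

Section factors.
Context (R : realType) d (T : measurableType d) (Z : R -> T -> R) (a b : R).
Hypothesis a0 : 0 <= a.
Hypothesis Z0 : forall (t : R) w, 0 <= t -> 0 <= Z t w.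
Hypothesis cadZ : forall w, cadlag (Z ^~ w).

Lemma right_regular_marginals (g : R -> R) (B t : R) (w : T) :
  continuous g -> (forall z, 0 <= z -> `|g z| <= B) ->
  right_regular t (fun s => g (Z s w)).
Proof.
move=> cg gB; apply: right_regular_comp => //; first exact: cadlag_right_regular.
by exists B => s /andP[s0 _]; apply: gB; exact: Z0.
Qed.

Lemma constant_factor (Y : T -> R) (K : R) :
  measurable_wrt (natural_filtration Z a) Y -> (forall w, `|Y w| <= K) ->
  adapted_factor Z a b K (fun _ => Y) (fun _ _ => 0).
Proof.
move=> mY YK; split.
- by move=> t /andP[at_ _]; apply: measurable_wrt_sub mY; exact: natural_filtration_le.
- by move=> t w _; exact: YK.
- move=> s t w _ st _; rewrite subrr normr0 mulr_ge0 ?subr_ge0//.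
  exact: le_trans (normr_ge0 _) (YK w).
- by move=> t w _; exact: rderive_cst.
Qed.

Lemma path_integral_factor (g : R -> R) (B : R) :
  continuous g -> (forall z, 0 <= z -> `|g z| <= B) ->
  adapted_factor Z a b (B * (1 + b))
    (fun t w => \int[lebesgue_measure]_(s in `[0, t]) g (Z s w)) (fun t w => g (Z t w)).
Proof.
move=> cg gB; have B0 : 0 <= B by exact: le_trans (normr_ge0 _) (gB 0 (lexx 0)).
have rr t w : right_regular t (fun s => g (Z s w)) by exact: right_regular_marginals gB.
have bd s t w : 0 <= s -> s <= t -> `|\int[lebesgue_measure]_(r in `[0, t]) g (Z r w) -
    \int[lebesgue_measure]_(r in `[0, s]) g (Z r w)| <= B * (t - s).
  move=> s0 st; apply: primitive_lip (rr t w) s0 st (lexx t) _.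
  by move=> r /andP[r0 _]; apply: gB; exact: Z0.
split.
- move=> t /andP[at_ tb]; apply: measurable_wrt_path_integral => //.
    by rewrite (le_trans a0 at_) lexx.
  exact: continuous_measurable_fun.
- move=> t w /andP[at_ tb]; have t0 := le_trans a0 at_.
  have := bd 0 t w (lexx 0) t0; rewrite primitive0 !subr0 => /le_trans; apply.
  by rewrite ler_wpM2l//; lra.
- move=> s t w as_ st tb; have s0 := le_trans a0 as_.
  apply: (le_trans (bd s t w s0 st)); rewrite ler_wpM2r ?subr_ge0//.
  by rewrite ler_peMr// lerDl; lra.
- move=> t w /andP[at_ tb]; apply: (primitive_rderive (rr b w)).
  by rewrite (le_trans a0 at_).
Qed.

Lemma mul_factor (K1 K2 : R) (D1 D1' D2 D2' : R -> T -> R) :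
  adapted_factor Z a b K1 D1 D1' -> adapted_factor Z a b K2 D2 D2' ->
  adapted_factor Z a b (2 * K1 * K2) (fun t w => D1 t w * D2 t w)
    (fun t w => D1' t w * D2 t w + D1 t w * D2' t w).
Proof.
move=> [m1 b1 l1 r1] [m2 b2 l2 r2]; split.
- move=> t tab; apply/measurable_wrt_naturalP; apply: measurable_funM;
    apply/measurable_wrt_naturalP; [exact: m1|exact: m2].
- move=> t w tab; rewrite normrM.
  have h1 := b1 t w tab; have h2 := b2 t w tab.
  have := ler_pM (normr_ge0 _) (normr_ge0 _) h1 h2.
  have := normr_ge0 (D1 t w); have := normr_ge0 (D2 t w); nra.
- move=> s t w as_ st tb.
  have tab : a <= t <= b by rewrite tb (le_trans as_).
  have sab : a <= s <= b by rewrite as_ (le_trans st).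
  rewrite (_ : _ - _ = (D1 t w - D1 s w) * D2 t w + D1 s w * (D2 t w - D2 s w)); last by ring.
  apply: (le_trans (ler_normD _ _)); rewrite !normrM.
  have h1 := ler_pM (normr_ge0 _) (normr_ge0 _) (l1 s t w as_ st tb) (b2 t w tab).
  have h2 := ler_pM (normr_ge0 _) (normr_ge0 _) (b1 s w sab) (l2 s t w as_ st tb).
  apply: (le_trans (lerD h1 h2)); rewrite le_eqVlt; apply/orP; left; apply/eqP; ring.
- by move=> t w tab; apply: rderiveM; [exact: r1|exact: r2].
Qed.

Lemma exp_factor (K : R) (D D' : R -> T -> R) :
  adapted_factor Z a b K D D' ->
  adapted_factor Z a b (expR K * (1 + K)) (fun t w => expR (D t w))
    (fun t w => expR (D t w) * D' t w).
Proof.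
move=> [m1 b1 l1 r1]; split.
- move=> t tab; apply/measurable_wrt_naturalP; apply: measurableT_comp.
    exact: measurable_expR.
  by apply/measurable_wrt_naturalP; exact: m1.
- move=> t w tab; have h := b1 t w tab; have K0 : 0 <= K by exact: le_trans (normr_ge0 _) h.
  rewrite ger0_norm ?expR_ge0// -[leLHS]mulr1; apply: ler_pM; rewrite ?expR_ge0 ?lerDl//.
  by rewrite ler_expR (le_trans (ler_norm _)).
- move=> s t w as_ st tb.
  have tab : a <= t <= b by rewrite tb (le_trans as_).
  have sab : a <= s <= b by rewrite as_ (le_trans st).
  have K0 : 0 <= K by exact: le_trans (normr_ge0 _) (b1 s w sab).
  have lip (x y : R) : `|x| <= K -> `|y| <= K -> expR x - expR y <= expR K * `|x - y|.
    move=> xK yK; have [xy|yx] := leP x y.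
      by apply: (@le_trans _ _ 0); rewrite ?subr_le0 ?ler_expR// mulr_ge0 ?expR_ge0.
    have := expR_sub1_le (x - y); rewrite expRB => h.
    have := ler_wpM2r (expR_ge0 y) h; rewrite mulrBl divfK ?gt_eqF ?expR_gt0// mul1r.
    rewrite -mulrA divfK ?gt_eqF ?expR_gt0// => /le_trans; apply.
    rewrite mulrC ger0_norm ?subr_ge0 ?(ltW yx)// ler_wpM2r ?subr_ge0 ?(ltW yx)//.
    by rewrite ler_expR (le_trans (ler_norm _)).
  have h : `|expR (D t w) - expR (D s w)| <= expR K * `|D t w - D s w|.
    rewrite ler_norml lip ?b1// andbT lerNl opprB distrC lip ?b1//.
  apply: (le_trans h); rewrite -mulrA ler_wpM2l ?expR_ge0//.
  apply: (le_trans (l1 s t w as_ st tb)); rewrite ler_wpM2r ?subr_ge0// lerDr//.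
- by move=> t w tab; apply: rderive_expR; exact: r1.
Qed.

End factors.

(** * The exponential martingale for nonnegative parameters *)

(** A bounded substitute for [z]; the path integral of [Z] in the exponential is
first replaced by that of [damp n], which makes it an adapted factor. *)
Definition damp (R : realType) (n : nat) (z : R) : R := z * expR (- n.+1%:R^-1 * z).

Section damp.
Context (R : realType).
Implicit Types (n : nat) (z : R).

Lemma damp_ge0 n z : 0 <= z -> 0 <= damp n z.
Proof. by move=> z0; rewrite mulr_ge0 ?expR_ge0. Qed.

Lemma damp_le n z : 0 <= z -> damp n z <= z.
Proof.
move=> z0; rewrite -[leRHS]mulr1 ler_wpM2l// expR_le1 mulNr oppr_le0 mulr_ge0//.
Qed.

Lemma damp_norm n z : 0 <= z -> `|damp n z| <= n.+1%:R.
Proof.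
move=> z0; rewrite ger0_norm ?damp_ge0//.
by rewrite -[leRHS]invrK; apply: mul_expRN_le; rewrite invr_gt0.
Qed.

Lemma damp_near n z : 0 <= z -> z - damp n z <= z ^+ 2 / n.+1%:R.
Proof.
move=> z0; have := expR_ge1Dx (- n.+1%:R^-1 * z).
rewrite /damp expr2 => /(ler_wpM2l z0); set e := expR _; set i := _^-1 => h.
by move: h; rewrite mulrDr mulr1; lra.
Qed.

Lemma continuous_damp n : continuous (@damp R n).
Proof.
move=> z; apply: cvgM; first exact: cvg_id.
exact: (cvg_comp _ _ (@continuous_lin R (- n.+1%:R^-1) z) (@continuous_expR R _)).
Qed.

(** Lowering the exponent by any [eta > 0] absorbs the quadratic damping
error. *)
Lemma damp_error n (q eta z : R) : 0 < eta -> 0 <= z ->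
  expR (- q * z) * (z - damp n z) <= 4 / eta ^+ 2 / n.+1%:R * expR (- (q - eta) * z).
Proof.
move=> e0 z0; have e20 : 0 < eta / 2 by rewrite divr_gt0.
have h := mul_expRN_le z e20.
have zE0 : 0 <= z * expR (- (eta / 2) * z) by rewrite mulr_ge0 ?expR_ge0.
have h2 := ler_pM zE0 zE0 h h.
have E : expR (- q * z) = expR (- (q - eta) * z) *
    (expR (- (eta / 2) * z) * expR (- (eta / 2) * z)).
  by rewrite -!expRD; congr expR; field.
apply: (@le_trans _ _ (expR (- q * z) * (z ^+ 2 / n.+1%:R))).
  by rewrite ler_wpM2l ?expR_ge0// damp_near.
rewrite E (_ : expR (- (q - eta) * z) * _ * _ = expR (- (q - eta) * z) *
  (z * expR (- (eta / 2) * z) * (z * expR (- (eta / 2) * z))) / n.+1%:R); last by ring.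
rewrite (_ : 4 / eta ^+ 2 / n.+1%:R * _ =
  expR (- (q - eta) * z) * ((eta / 2)^-1 * (eta / 2)^-1) / n.+1%:R); last first.
  by set i := n.+1%:R^-1; field; rewrite gt_eqF.
by rewrite ler_pM2r ?invr_gt0// ler_pM2l ?expR_gt0.
Qed.

End damp.

Section nonnegative_parameter.
Context (R : realType) d (T : measurableType d) (P : probability T R).
Context (Z : R -> T -> R) (f : R -> R) (u : R -> R -> R) (q : R).
Hypothesis hZ : exponential_markov P Z u.
Hypothesis cf : convex_on_half_line f.
Hypothesis f0 : f 0 = 0.
Hypothesis hu : flow_generator f u.
Hypothesis q0 : 0 <= q.

Let mZ : forall t : R, 0 <= t -> measurable_fun setT (Z t). Proof. by case: hZ. Qed.
Let Z0 : forall (t : R) w, 0 <= t -> 0 <= Z t w. Proof. by case: hZ. Qed.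
Let cadZ : forall w, cadlag (Z ^~ w). Proof. by case: hZ. Qed.

Definition discount n (t : R) (w : T) : R :=
  expR (\int[lebesgue_measure]_(s in `[0, t]) (- f q * damp n (Z s w))).

Lemma rate_continuous n : continuous (fun z => - f q * damp n z).
Proof. by move=> z; apply: cvgMl_tmp; exact: continuous_damp. Qed.

Lemma rate_bound n z : 0 <= z -> `|- f q * damp n z| <= `|f q| * n.+1%:R.
Proof. by move=> z0; rewrite normrM normrN ler_wpM2l// damp_norm. Qed.

Lemma discount_factor n (a b : R) : 0 <= a -> exists K, adapted_factor Z a b K
  (discount n) (fun t w => discount n t w * (- f q * damp n (Z t w))).
Proof.
move=> a0; have := path_integral_factor b a0 Z0 cadZ (@rate_continuous n) (@rate_bound n).
by move=> /exp_factor ?; eexists; eassumption.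
Qed.

Lemma discount_gt0 n t w : 0 < discount n t w. Proof. exact: expR_gt0. Qed.

Lemma discount0 n w : discount n 0 w = 1.
Proof. by rewrite /discount primitive0 expR0. Qed.

Lemma discount_le1 n t w : 0 <= f q -> 0 <= t -> discount n t w <= 1.
Proof.
move=> k0 t0; rewrite expR_le1; apply: Rintegral_le0 => r /=.
by rewrite in_itv/= => /andP[r0 _]; rewrite mulNr oppr_le0 mulr_ge0// damp_ge0// Z0.
Qed.

Lemma discount_measurable n t : 0 <= t -> measurable_fun setT (discount n t).
Proof.
move=> t0; have [K [m _ _ _]] := discount_factor n t (lexx 0).
by apply: (natural_measurable_fun hZ (m t _)); rewrite t0 lexx.
Qed.

Lemma discount_bounded n t : 0 <= t -> exists K, forall w, `|discount n t w| <= K.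
Proof.
move=> t0; have [K [_ b _ _]] := discount_factor n t (lexx 0).
by exists K => w; apply: b; rewrite t0 lexx.
Qed.

Lemma discounted_exp_integrable n c t : 0 <= c -> 0 <= t ->
  P.-integrable setT (EFin \o (fun w => discount n t w * expR (- c * Z t w))).
Proof.
move=> c0 t0; have [K HK] := discount_bounded n t0.
apply: (probability_bounded_integrable P (K := K)) => [|w].
  by apply: measurable_funM; [exact: discount_measurable|exact: (measurable_exp_marginal hZ)].
rewrite normrM -[leRHS]mulr1; apply: ler_pM => //.
by rewrite ger0_norm ?expR_ge0// (exp_marginal_le1 hZ).
Qed.

(** If [f q < 0] the discount grows with [Z], and boundedness in mean at an exponent
below [q] needs an argument: the exponent [q - q / 2 * expR (- C * t)] increases
fast enough for the exponential to decrease in mean, by convexity of [f], but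
stays below [q] up to any fixed time. *)
Lemma exponent_room (b : R) : 0 <= b -> 0 < q -> exists2 eta, 0 < eta <= q &
  forall n t, 0 <= t <= b -> \int[P]_w (discount n t w * expR (- (q - eta) * Z t w)) <= 1.
Proof.
move=> b0 q1.
have [k0|k0] := leP 0 (f q).
  exists q; first by rewrite q1 lexx.
  move=> n t /andP[t0 _]; apply: (le_trans (ler_norm _)).
  apply: (le_norm_expectation P).
    by apply: measurable_funM; [exact: discount_measurable|exact: (measurable_exp_marginal hZ)].
  move=> w; rewrite subrr oppr0 mul0r expR0 mulr1 ger0_norm ?(ltW (discount_gt0 _ _ _))//.
  exact: discount_le1.
pose C := - f q / q.
have C0 : 0 <= C by rewrite divr_ge0// oppr_ge0 ltW.
pose v t := q - q / 2 * expR (- C * t).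
have q20 : 0 < q / 2 by rewrite divr_gt0.
have ve t : 0 <= t -> expR (- C * t) <= 1.
  by move=> t0; rewrite expR_le1 mulNr oppr_le0 mulr_ge0.
have v2 t : 0 <= t -> q / 2 <= v t.
  move=> t0; have := ler_wpM2l (ltW q20) (ve t t0); rewrite mulr1 /v; lra.
have vq t : v t <= q by rewrite /v gerBl mulr_ge0 ?expR_ge0// ltW.
pose eta := q / 2 * expR (- C * b).
have eta0 : 0 < eta by rewrite mulr_gt0 ?expR_gt0.
exists eta.
  rewrite eta0/=; apply: (@le_trans _ _ (q / 2)); last by lra.
  by rewrite -[leRHS]mulr1 /eta ler_wpM2l ?(ltW q20)// ve.
have dv t : is_rderive v t (C * (q - v t)).
  have := rderiveD (rderive_cst q t) (@rderiveZ _ (- (q / 2)) _ _ _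
    (rderive_expR (@rderive_lin R (- C) t))).
  rewrite add0r (_ : - (q / 2) * _ = C * (q - v t)); last by rewrite /v; ring.
  by rewrite (_ : (fun s => _) = v)//; apply/funext => s; rewrite /v [- (q / 2) * _]mulNr.
have cvv : continuous v.
  move=> t; apply: cvgB; first exact: cvg_cst.
  apply: cvgMl_tmp.
  exact: (cvg_comp _ _ (@continuous_lin R (- C) t) (@continuous_expR R _)).
have lv t : v (t - h) @[h --> 0^'+] --> v t.
  have h1 : t - h @[h --> 0^'+] --> t.
    rewrite -[X in _ --> X]subr0; apply: cvgB; first exact: cvg_cst.
    by apply: cvg_at_right_filter; exact: cvg_id.
  exact: (cvg_comp _ _ h1 (cvv t)).
move=> n t /andP[t0 tb].
have [K hD] := discount_factor n t (lexx 0).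
have hv2 s : 0 <= s <= t -> q / 2 <= v s by move=> /andP[s0 _]; exact: v2.
have dec : \int[P]_w (discount n t w * expR (- v t * Z t w)) <=
    \int[P]_w (discount n 0 w * expR (- v 0 * Z 0 w)).
  apply: (rderive_nonincreasing (f := fun r => \int[P]_w (discount n r w * expR (- v r * Z r w)))
    t0).
    apply: (functional_continuous hZ hu (lexx 0) q20 hD hv2 (fun s _ => lv s) (fun s _ => dv s)).
  move=> s st; have := functional_rderive hZ hu (lexx 0) q20 hD hv2 (fun s _ => dv s) st.
  move=> H; eexists; first exact: H.
  have /andP[s0 _] := st.
  have vs0 : 0 < v s by apply: (lt_le_trans q20); exact: v2.
  have fv : f (v s) - C * (q - v s) - f q <= 0.
    have := convex_chord cf f0 q1 (y := v s); rewrite vq (ltW vs0) => /(_ isT) h.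
    have -> : C * (q - v s) = v s / q * f q - f q by rewrite /C; field; rewrite gt_eqF.
    lra.
  apply: Rintegral_le0 => w _.
  rewrite (_ : _ + _ = discount n s w *
    ((f (v s) - C * (q - v s)) * Z s w - f q * damp n (Z s w))); last by ring.
  rewrite mulr_ge0_le0 ?expR_ge0// mulr_ge0_le0 ?(ltW (discount_gt0 _ _ _))//.
  have z0 := Z0 w s0; have := damp_le n z0; nra.
apply: (@le_trans _ _ (\int[P]_w (discount n t w * expR (- v t * Z t w)))).
  have ve1 : v t <= q - eta.
    rewrite /v /eta lerD2l lerN2 ler_wpM2l ?(ltW q20)// ler_expR !mulNr lerN2 ler_wpM2l//.
  have vt0 : 0 <= v t by apply: (le_trans (ltW q20)); exact: v2.
  apply: le_Rintegral => //; [exact: discounted_exp_integrable (le_trans vt0 ve1) t0|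
    exact: discounted_exp_integrable vt0 t0|].
  move=> w _; rewrite ler_wpM2l ?(ltW (discount_gt0 _ _ _))// ler_expR.
  by rewrite ler_wpM2r ?Z0// lerN2.
apply: (le_trans dec); apply: (le_trans (ler_norm _)); apply: (le_norm_expectation P).
  by apply: measurable_funM; [exact: discount_measurable|exact: (measurable_exp_marginal hZ)].
move=> w; rewrite discount0 mul1r ger0_norm ?expR_ge0//.
by rewrite (exp_marginal_le1 hZ)//; apply: (le_trans (ltW q20)); exact: v2.
Qed.

Definition damping_defect n c t w : R :=
  discount n t w * (expR (- c * Z t w) * (Z t w - damp n (Z t w))).

Lemma damping_defect_ge0 n c t w : 0 <= t -> 0 <= damping_defect n c t w.
Proof.
move=> t0; rewrite /damping_defect mulr_ge0 ?(ltW (discount_gt0 _ _ _))//.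
by rewrite mulr_ge0 ?expR_ge0// subr_ge0 damp_le// Z0.
Qed.

Lemma damping_defect_le n c eta t w : 0 <= t -> 0 < eta ->
  damping_defect n c t w <=
    4 / eta ^+ 2 / n.+1%:R * (discount n t w * expR (- (c - eta) * Z t w)).
Proof.
move=> t0 e0; rewrite mulrCA ler_wpM2l ?(ltW (discount_gt0 _ _ _))//.
exact: damp_error e0 (Z0 w t0).
Qed.

Lemma damping_defect_integrable n c t : 0 < c -> 0 <= t ->
  P.-integrable setT (EFin \o damping_defect n c t).
Proof.
move=> c0 t0.
have i1 : P.-integrable setT (EFin \o (fun w =>
    4 / c ^+ 2 / n.+1%:R * (discount n t w * expR (- (c - c) * Z t w)))).
  have cc : 0 <= c - c by rewrite subrr.
  have := integrableZl measurableT (4 / c ^+ 2 / n.+1%:R) (discounted_exp_integrable n cc t0).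
  exact: eq_integrable.
apply: dominated_integrable_real i1 _ => //.
  apply: measurable_funM; first exact: discount_measurable.
  apply: measurable_funM; first exact: (measurable_exp_marginal hZ).
  apply: measurable_funB; first exact: mZ.
  by apply: measurableT_comp; [apply: continuous_measurable_fun; exact: continuous_damp|exact: mZ].
move=> w _; rewrite ger0_norm ?damping_defect_ge0//.
exact: damping_defect_le.
Qed.

Lemma damping_error_bound (b : R) : 0 <= b -> exists K, forall n t, 0 <= t <= b ->
  `|f q| * \int[P]_w damping_defect n q t w <= K / n.+1%:R.
Proof.
move=> b0; have [fq0|fq0] := eqVneq (f q) 0.
  by exists 0 => n t _; rewrite fq0 normr0 !mul0r.
have q1 : 0 < q by rewrite lt_neqAle q0 andbT; apply: contra_neq fq0 => <-.
have [eta /andP[e0 eq] H] := exponent_room b0 q1.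
exists (`|f q| * (4 / eta ^+ 2)) => n t tb; have /andP[t0 _] := tb.
rewrite -mulrA ler_wpM2l//.
have qe0 : 0 <= q - eta by rewrite subr_ge0.
have i2 := discounted_exp_integrable n qe0 t0.
have i3 : P.-integrable setT (EFin \o (fun w =>
    4 / eta ^+ 2 / n.+1%:R * (discount n t w * expR (- (q - eta) * Z t w)))).
  have := integrableZl measurableT (4 / eta ^+ 2 / n.+1%:R) i2.
  exact: eq_integrable.
apply: (@le_trans _ _ (\int[P]_w (4 / eta ^+ 2 / n.+1%:R *
    (discount n t w * expR (- (q - eta) * Z t w))))).
  apply: le_Rintegral => //; first exact: damping_defect_integrable.
  by move=> w _; exact: damping_defect_le.
rewrite RintegralZl// -[leRHS]mulr1 ler_wpM2l ?H//.
by rewrite divr_ge0// divr_ge0// exprn_ge0 // ltW.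
Qed.

(** With [v' = f v - f q] the drift of [expR (- v * Z)] cancels the potential
[f q * Z]; the drift that remains comes from the damping alone. *)
Section exponent_path.
Variables (a b c : R) (v : R -> R) (Y : T -> R).
Hypothesis a0 : 0 <= a.
Hypothesis ab : a <= b.
Hypothesis c0 : 0 < c.
Hypothesis hv : forall t, a <= t <= b -> c <= v t.
Hypothesis qv : forall t, a <= t <= b -> q <= v t.
Hypothesis cv : forall t, a < t <= b -> v (t - h) @[h --> 0^'+] --> v t.
Hypothesis dv : forall t, a <= t < b -> is_rderive v t (f (v t) - f q).
Hypothesis mY : measurable_wrt (natural_filtration Z a) Y.
Hypothesis Y1 : forall w, `|Y w| <= 1.

Lemma damped_martingale : exists K, forall n,
  `|\int[P]_w (Y w * discount n b w * expR (- v b * Z b w)) -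
    \int[P]_w (Y w * discount n a w * expR (- v a * Z a w))| <= K / n.+1%:R.
Proof.
have b0 := le_trans a0 ab.
have [K HK] := damping_error_bound b0.
exists (K * (b - a)) => n; rewrite mulrAC.
have [Kd hdisc] := discount_factor n b a0.
have hD := mul_factor (constant_factor b mY Y1) hdisc.
apply: (rderive_lip (f := fun t => \int[P]_w (Y w * discount n t w * expR (- v t * Z t w)))) => //.
  exact: (functional_continuous hZ hu a0 c0 hD hv cv dv).
move=> t tab; have /andP[at_ tb] := tab; have t0 := le_trans a0 at_.
have tab' : a <= t <= b by rewrite at_ ltW.
eexists; first exact: (functional_rderive hZ hu a0 c0 hD hv dv tab).
apply: (le_trans _ (HK n t _)); last by rewrite t0 ltW.
have E w : expR (- v t * Z t w) * ((f (v t) - (f (v t) - f q)) * Z t w *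
    (Y w * discount n t w) + (0 * discount n t w +
      Y w * (discount n t w * (- f q * damp n (Z t w))))) =
    f q * (Y w * damping_defect n (v t) t w).
  by rewrite /damping_defect; ring.
under eq_Rintegral do rewrite E.
have [fq0|fq0] := eqVneq (f q) 0.
  under eq_Rintegral do rewrite fq0 mul0r.
  by rewrite Rintegral_cst// mul0r fq0 !normr0 mul0r.
have q1 : 0 < q by rewrite lt_neqAle q0 andbT; apply: contra_neq fq0 => <-.
have vt0 : 0 < v t by apply: (lt_le_trans c0); exact: hv.
have dom w : `|Y w * damping_defect n (v t) t w| <= damping_defect n q t w.
  rewrite normrM (ger0_norm (damping_defect_ge0 _ _ _ t0)) -[leRHS]mul1r.
  apply: ler_pM => //; first exact: damping_defect_ge0.
  rewrite ler_wpM2l ?(ltW (discount_gt0 _ _ _))// ler_wpM2r ?subr_ge0 ?damp_le ?Z0//.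
  by rewrite ler_expR ler_wpM2r ?Z0// lerN2 qv.
have iq := damping_defect_integrable n q1 t0.
have iv : P.-integrable setT (EFin \o (fun w => Y w * damping_defect n (v t) t w)).
  apply: dominated_integrable_real iq _ => //.
  apply: measurable_funM; first exact: (natural_measurable_fun hZ mY).
  have := damping_defect_integrable n vt0 t0.
  by move=> /integrableP[/measurable_EFinP].
rewrite RintegralZl// normrM ler_wpM2l//.
apply: (le_trans (le_normr_Rintegral _ iv)) => //.
apply: le_Rintegral => //.
by have := integrable_abse iv; apply: eq_integrable.
Qed.

End exponent_path.

(** For [c = q] this is the density [M], up to the factor [expR (q * x)]. *)
Definition exp_functional (c t : R) (w : T) : R :=
  expR (- c * Z t w - f q * \int[lebesgue_measure]_(s in `[0, t]) Z s w).

Lemma right_regular_path (t : R) w : right_regular t (Z ^~ w).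
Proof. exact: cadlag_right_regular. Qed.

Lemma discount_cvg t w : 0 <= t ->
  discount n t w @[n --> \oo] --> expR (- f q * \int[lebesgue_measure]_(s in `[0, t]) Z s w).
Proof.
move=> t0; rewrite -RintegralZl//; last exact: right_regular_integrable (right_regular_path t w).
have := @continuous_expR R (\int[lebesgue_measure]_(s in `[0, t]) (- f q * Z s w)).
apply: cvg_comp.
have [_ [B HB]] := right_regular_path t w.
have B0 : 0 <= B by apply: (le_trans (normr_ge0 (Z 0 w))); apply: HB; rewrite lexx.
apply/cvgrPdist_le => e e0.
pose D := `|f q| * B ^+ 2 * t.
have D0 : 0 <= D by rewrite !mulr_ge0.
near=> n.
rewrite distrC; apply: (@le_trans _ _ (`|f q| * B ^+ 2 / n.+1%:R * t)).
  apply: primitive_uniform_cvg => //.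
  - exact: right_regularZ (right_regular_path t w).
  - exact: (right_regular_marginals Z0 cadZ t w (@rate_continuous n) (@rate_bound n)).
  move=> s /andP[s0 st]; have z0 := Z0 w s0.
  rewrite -mulrBr normrM normrN -mulrA ler_wpM2l// distrC ger0_norm ?subr_ge0 ?damp_le//.
  apply: (le_trans (damp_near n z0)); rewrite ler_pM2r ?invr_gt0//.
  rewrite !expr2; apply: ler_pM => //.
    by have := HB s; rewrite s0 st => /(_ isT); rewrite ger0_norm.
  by have := HB s; rewrite s0 st => /(_ isT); rewrite ger0_norm.
rewrite mulrAC -/D ler_pdivrMr ?ltr0n//.
have : D / e <= n.+1%:R.
  near: n; exists (Num.truncn (D / e)) => // m /= hm.
  have /truncn_itv/andP[_ /ltW/le_trans] : 0 <= D / e by rewrite divr_ge0// ltW.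
  by apply; rewrite ler_nat ltnS.
by rewrite ler_pdivrMr// mulrC.
Unshelve. all: by end_near. Qed.

Lemma exp_functionalE c t w : exp_functional c t w =
  expR (- f q * \int[lebesgue_measure]_(s in `[0, t]) Z s w) * expR (- c * Z t w).
Proof. by rewrite -expRD; congr expR; ring. Qed.

Lemma exp_functional_cvg c t w : 0 <= t ->
  discount n t w * expR (- c * Z t w) @[n --> \oo] --> exp_functional c t w.
Proof.
move=> t0; rewrite exp_functionalE.
by apply: cvgMr_tmp; exact: discount_cvg.
Qed.

Lemma exp_functional_measurable c t : 0 <= t -> measurable_fun setT (exp_functional c t).
Proof.
move=> t0; apply: (measurable_fun_cvg (h := fun n w => discount n t w * expR (- c * Z t w))).
  move=> n; apply: measurable_funM; first exact: discount_measurable.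
  exact: (measurable_exp_marginal hZ).
by move=> w _; exact: exp_functional_cvg.
Qed.

Lemma discount_le_limit n t w : 0 <= t -> f q <= 0 ->
  discount n t w <= expR (- f q * \int[lebesgue_measure]_(s in `[0, t]) Z s w).
Proof.
move=> t0 k0; rewrite ler_expR -RintegralZl//; last first.
  exact: right_regular_integrable (right_regular_path t w).
apply: le_Rintegral => //.
- apply: right_regular_integrable.
  exact: (right_regular_marginals Z0 cadZ t w (@rate_continuous n) (@rate_bound n)).
- exact: right_regular_integrable (right_regularZ _ (right_regular_path t w)).
move=> s /=; rewrite in_itv/= => /andP[s0 _].
by rewrite ler_wpM2l ?oppr_ge0// damp_le// Z0.
Qed.

Lemma exp_functional_integrable t : 0 < q -> 0 <= t ->
  P.-integrable setT (EFin \o exp_functional q t).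
Proof.
move=> q1 t0; apply/integrableP; split.
  by apply/measurable_EFinP; exact: exp_functional_measurable.
have m1 : measurable_wrt (natural_filtration Z 0) (fun _ : T => 1 : R).
  by apply/measurable_wrt_naturalP; exact: measurable_cst.
have b1 : forall w : T, `|1 : R| <= 1 by rewrite normr1.
have cq s : 0 < s <= t -> (fun=> q) (s - h) @[h --> 0^'+] --> q by move=> _; exact: cvg_cst.
have dq s : 0 <= s < t -> is_rderive (fun=> q) s (f q - f q).
  by move=> _; rewrite subrr; exact: rderive_cst.
have [K HK] := damped_martingale (lexx 0) t0 q1 (v := fun=> q) (fun _ _ => lexx q)
  (fun _ _ => lexx q) cq dq m1 b1.
apply: (@le_lt_trans _ _ (1 + `|K|)%:E); last exact: ltry.
under eq_integral do rewrite /= ger0_norm ?expR_ge0//.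
apply: (@integral_fatou_bound _ _ _ P (fun n w => discount n t w * expR (- q * Z t w))) => //.
- move=> n; apply: measurable_funM; first exact: discount_measurable.
  exact: (measurable_exp_marginal hZ).
- by move=> n w; rewrite mulr_ge0 ?expR_ge0// ltW// discount_gt0.
- by move=> w; exact: exp_functional_cvg.
move=> n; have iD := discounted_exp_integrable n (ltW q1) t0.
rewrite -[leLHS]fineK; last exact: integrable_fin_num.
rewrite lee_fin -/(Rintegral _ _ _).
have -> : \int[P]_w (discount n t w * expR (- q * Z t w)) =
   \int[P]_w (1 * discount n 0 w * expR (- q * Z 0 w)) +
  (\int[P]_w (1 * discount n t w * expR (- q * Z t w)) -
   \int[P]_w (1 * discount n 0 w * expR (- q * Z 0 w))).
  by rewrite addrC subrK; apply: eq_Rintegral => w _; rewrite mul1r.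
apply: lerD.
  apply: (le_trans (ler_norm _)); apply: (le_norm_expectation P).
    apply: measurable_funM; last exact: (measurable_exp_marginal hZ).
    by apply: measurable_funM; [exact: measurable_cst|exact: discount_measurable].
  move=> w; rewrite discount0 !mul1r ger0_norm ?expR_ge0//.
  exact: (exp_marginal_le1 hZ).
apply: (le_trans (ler_norm _)); apply: (le_trans (HK n)).
rewrite ler_pdivrMr ?ltr0n//; apply: (le_trans (ler_norm K)).
by rewrite ler_peMr// ler1n.
Qed.

(** The damping disappears in the limit: the functionals are dominated by [1] if
[f q >= 0], and by the integrable [exp_functional q] if [f q < 0]. *)
Lemma exp_functional_martingale (a b c : R) (v : R -> R) (Y : T -> R) :
  0 <= a -> a <= b -> 0 < c -> (forall t, a <= t <= b -> c <= v t) ->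
  (forall t, a <= t <= b -> q <= v t) ->
  (forall t, a < t <= b -> v (t - h) @[h --> 0^'+] --> v t) ->
  (forall t, a <= t < b -> is_rderive v t (f (v t) - f q)) ->
  measurable_wrt (natural_filtration Z a) Y -> (forall w, `|Y w| <= 1) ->
  \int[P]_w (Y w * exp_functional (v b) b w) = \int[P]_w (Y w * exp_functional (v a) a w).
Proof.
move=> a0 ab c0 hv qv cv dv mY Y1.
have [K HK] := damped_martingale a0 ab c0 hv qv cv dv mY Y1.
have mYT := natural_measurable_fun hZ mY.
have lim t : a <= t <= b -> \int[P]_w (Y w * discount n t w * expR (- v t * Z t w))
    @[n --> \oo] --> \int[P]_w (Y w * exp_functional (v t) t w).
  move=> tab; have /andP[at_ tb] := tab; have t0 := le_trans a0 at_.
  have [g ig Hg] : exists2 g : T -> R, P.-integrable setT (EFin \o g) &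
      forall n w, discount n t w * expR (- v t * Z t w) <= g w.
    have vt0 : 0 < v t by apply: (lt_le_trans c0); exact: hv.
    have [k0|k0] := leP 0 (f q).
      exists (fun=> 1).
        by apply: (probability_bounded_integrable P (K := 1)) => // w; rewrite normr1.
      move=> n w; rewrite -[leRHS]mulr1; apply: ler_pM; rewrite ?expR_ge0//.
        exact: discount_le1.
      exact: (exp_marginal_le1 hZ w (ltW vt0) t0).
    have q1 : 0 < q.
      by rewrite lt_neqAle q0 andbT; apply: contraTneq k0 => <-; rewrite f0 ltxx.
    exists (exp_functional q t); first exact: exp_functional_integrable.
    move=> n w; rewrite exp_functionalE; apply: ler_pM; rewrite ?expR_ge0//.
      exact: discount_le_limit t0 (ltW k0).
    by rewrite ler_expR ler_wpM2r ?Z0// lerN2 qv.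
  apply: (Rintegral_dominated_cvg (g := g)) => //.
  - move=> n; apply: measurable_funM; last exact: (measurable_exp_marginal hZ).
    by apply: measurable_funM => //; exact: discount_measurable.
  - move=> w _; under eq_fun do rewrite -mulrA.
    by apply: cvgMl_tmp; exact: exp_functional_cvg.
  move=> n w _; rewrite -mulrA normrM -[leRHS]mul1r; apply: ler_pM => //.
  by rewrite ger0_norm ?Hg// mulr_ge0 ?expR_ge0// ltW// discount_gt0.
have aab : a <= a <= b by rewrite lexx.
have bab : a <= b <= b by rewrite lexx andbT.
pose X t n := \int[P]_w (Y w * discount n t w * expR (- v t * Z t w)).
have L : X b n - X a n @[n --> \oo] --> \int[P]_w (Y w * exp_functional (v b) b w) -
    \int[P]_w (Y w * exp_functional (v a) a w) by apply: cvgB; exact: lim.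
suff L0 : X b n - X a n @[n --> \oo] --> (0 : R).
  by apply/eqP; rewrite -subr_eq0; apply/eqP; exact: (cvg_unique _ L L0).
apply/cvgr0Pnorm_le => e e0; near=> n.
apply: (le_trans (HK n)); rewrite ler_pdivrMr ?ltr0n//.
have : `|K| / e <= n.+1%:R.
  near: n; exists (Num.truncn (`|K| / e)) => // m /= hm.
  have /truncn_itv/andP[_ /ltW/le_trans] : 0 <= `|K| / e by rewrite divr_ge0// ltW.
  by apply; rewrite ler_nat ltnS.
by rewrite ler_pdivrMr// mulrC => h; apply: (le_trans (ler_norm K)).
Unshelve. all: by end_near. Qed.

End nonnegative_parameter.

(** * Girsanov identity for nonnegative parameters *)

(** The exponent is about [n * expR (n * c)]; its product with [expR (- n * z)] tends
to [0] if [c < z] and to infinity otherwise. *)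
Lemma exp_indicator_cvg (R : realType) (c z : R) : 0 <= c -> 0 <= z ->
  (1 - expR (- n%:R * z)) ^+ (n * (Num.truncn (expR (n%:R * c))).+1) @[n --> \oo] -->
    (\1_(`]c, +oo[) z : R).
Proof.
move=> c0 z0.
pose K n := (n * (Num.truncn (expR (n%:R * c : R))).+1)%N.
pose e n : R := expR (- n%:R * z).
have e1 n : 0 <= e n <= 1 by rewrite expR_ge0 expR_le1 mulNr oppr_le0 mulr_ge0.
have K1 n : n%:R * expR (n%:R * c) <= (K n)%:R :> R.
  rewrite natrM ler_wpM2l// ltW//.
  by have /truncn_itv/andP[] := expR_ge0 (n%:R * c : R).
have K2 n : (K n)%:R <= 2 * n%:R * expR (n%:R * c) :> R.
  rewrite natrM [2 * _]mulrC -mulrA ler_wpM2l//.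
  have /truncn_itv/andP[h _] := expR_ge0 (n%:R * c : R).
  have : 1 <= expR (n%:R * c : R) by rewrite -expR0 ler_expR mulr_ge0.
  rewrite -natr1; move: h; set k := (_%:R); set x := expR _ => h1 h2; lra.
rewrite -/(K _); have [zc|cz] := leP z c.
  rewrite indicE memNset; last by rewrite /= in_itv/= andbT => /lt_geF; rewrite zc.
  apply: (squeeze_cvgr (f := fun=> 0) (h := fun n => expR (- n%:R))).
  - apply: nearW => n; have /andP[h0 h1] := e1 n.
    rewrite exprn_ge0 ?subr_ge0//=.
    apply: (@le_trans _ _ (expR (- e n) ^+ K n)).
      by rewrite lerXn2r ?nnegrE ?expR_ge0 ?subr_ge0//; exact: expR_ge1Dx.
    rewrite -expRM_natl ler_expR mulrN lerN2.
    apply: (@le_trans _ _ (n%:R * expR (n%:R * c) * e n)); last by rewrite ler_wpM2r.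
    rewrite -mulrA -expRD ler_peMr// -expR0 ler_expR mulNr -mulrBr mulr_ge0// subr_ge0//.
  - exact: cvg_cst.
  - exact: cvgn_expR.
rewrite indicE mem_set; last by rewrite /= in_itv/= cz.
have dz : 0 < (z - c) / 2 by rewrite divr_gt0// subr_gt0.
pose M : R := 2 * ((z - c) / 2)^-1 ^+ 2.
have bound n : 1 - M * n.+1%:R^-1 <= (1 - e n.+1) ^+ K n.+1 <= 1.
  have /andP[h0 h1] := e1 n.+1.
  rewrite exprn_ile1 ?subr_ge0// ?gerBl// andbT.
  have Ke : (K n.+1)%:R * e n.+1 <= M * n.+1%:R^-1.
    apply: (@le_trans _ _ (2 * n.+1%:R * expR (n.+1%:R * c) * e n.+1)).
      by rewrite ler_wpM2r.
    rewrite -mulrA -expRD.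
    have h := mul_expRN_le n.+1%:R dz.
    have hp : 0 <= n.+1%:R * expR (- ((z - c) / 2) * n.+1%:R) by rewrite mulr_ge0 ?expR_ge0.
    have h2 := ler_pM hp hp h h.
    rewrite -(ler_pM2r (ltr0Sn R n)) mulfVK ?pnatr_eq0// /M.
    have -> : expR (n.+1%:R * c + - n.+1%:R * z) =
        expR (- ((z - c) / 2) * n.+1%:R) * expR (- ((z - c) / 2) * n.+1%:R).
      by rewrite -expRD; congr expR; field.
    move: h2; set x := expR _; set y := _^-1; set m := n.+1%:R; rewrite expr2 => h2; nra.
  have bern k : 1 - k%:R * e n.+1 <= (1 - e n.+1) ^+ k.
    elim: k => [|k ih]; first by rewrite mul0r subr0 expr0.
    rewrite exprS; apply: (@le_trans _ _ ((1 - e n.+1) * (1 - k%:R * e n.+1))).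
      rewrite -natr1; have k0 : (0 : R) <= k%:R by []. nra.
    by rewrite ler_wpM2l// subr_ge0.
  by apply: (le_trans _ (bern (K n.+1))); rewrite lerD2l lerN2.
rewrite -(cvg_shiftS _) /=.
apply: (squeeze_cvgr (f := fun n => 1 - M * n.+1%:R^-1) (h := fun=> 1)).
- by apply: nearW => n; exact: bound.
- rewrite -[X in _ --> X]subr0 -[X in _ - X](mulr0 M); apply: cvgB; first exact: cvg_cst.
  by apply: cvgMl_tmp; exact: cvg_harmonic.
- exact: cvg_cst.
Qed.

(** Times are nondecreasing along the construction, so that two cylinders can
be merged into one. *)
Inductive cylinder (R : realType) (T : Type) (Z : R -> T -> R) : nat -> R -> set T -> Prop :=
| cylinder0 : cylinder Z 0 0 setT
| cylinderS n s t c A : cylinder Z n s A -> s <= t -> 0 <= c ->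
    cylinder Z n.+1 t (A `&` [set w | c < Z t w]).

Section cylinders.
Context (R : realType) (T : pointedType) (Z : R -> T -> R).
Hypothesis Z0 : forall (t : R) w, 0 <= t -> 0 <= Z t w.

Lemma cylinder_ge0 n s A : cylinder Z n s A -> 0 <= s.
Proof. by elim=> // {}n {}s t c {}A _ s0 st _; exact: le_trans st. Qed.

Lemma cylinderI m n s t A B : cylinder Z m s A -> cylinder Z n t B ->
  cylinder Z (m + n) (Num.max s t) (A `&` B).
Proof.
move: {2}(m + n)%N (leqnn (m + n)) => k; elim: k m n s t A B => [|k ih] m n s t A B.
  rewrite leqn0 addn_eq0 => /andP[/eqP -> /eqP ->] cA cB.
  inversion cA; subst; inversion cB; subst.
  by rewrite maxxx setIT; exact: cylinder0.
move=> mnk cA cB.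
have [st|ts] := leP s t.
  case: cB mnk st => [|{}n r {}t c {}B cB rt c0] mnk st.
    have e : s = 0 by apply/eqP; rewrite eq_le st (cylinder_ge0 cA).
    by rewrite addn0 setIT; rewrite e in cA.
  rewrite addnS setIA; apply: (cylinderS (s := Num.max s r)) => //; last first.
    by rewrite ge_max st.
  by apply: ih => //; move: mnk; rewrite addnS ltnS.
case: cA mnk ts => [|{}m r {}s c {}A cA rs c0] mnk ts.
  by have := le_lt_trans (cylinder_ge0 cB) ts; rewrite ltxx.
rewrite addSn setIAC; apply: (cylinderS (s := Num.max r t)) => //; last first.
  by rewrite ge_max rs ltW.
by apply: ih => //; move: mnk; rewrite addSn ltnS.
Qed.

Lemma cylinder_past n s A : cylinder Z n s A -> natural_filtration Z s A.
Proof.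
elim=> [|{}n {}s t c {}A cA FA st c0].
  exact: (@measurableT _ (g_sigma_algebraType (past_events Z 0))).
have t0 : 0 <= t by exact: le_trans (cylinder_ge0 cA) st.
apply: (@measurableI _ (g_sigma_algebraType (past_events Z t))).
  exact: natural_filtration_le FA.
apply: sub_sigma_algebra; exists t, `]c, +oo[%classic; split => //.
  by rewrite t0 lexx.
by apply/seteqP; split => w /=; rewrite in_itv/= andbT.
Qed.

Lemma natural_filtration_cylinder a : 0 <= a -> natural_filtration Z a `<=`
  <<s [set A | exists n s, s <= a /\ cylinder Z n s A] >>.
Proof.
move=> a0; pose G := [set A | exists n s, s <= a /\ cylinder Z n s A].
apply: smallest_sub; first exact: smallest_sigma_algebra.
move=> _ [s [B [/andP[s0 sa] mB ->]]].
have : measurable_fun setT (Z s : g_sigma_algebraType G -> R).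
  apply: (measurability _ (RGenOInfty.measurableE R)) => //.
  move=> _ [_ [c ->] <-]; rewrite setTI.
  have [c0|c0] := leP 0 c.
    apply: sub_sigma_algebra; exists 1%N, s; split => //.
    rewrite (_ : _ @^-1` _ = setT `&` [set w | c < Z s w]).
      by apply: (cylinderS (s := 0)) => //; exact: cylinder0.
    by rewrite setTI; apply/seteqP; split => w /=; rewrite in_itv/= andbT.
  rewrite (_ : _ @^-1` _ = setT); first exact: measurableT.
  apply/seteqP; split => // w _ /=; rewrite in_itv/= andbT.
  by apply: (lt_le_trans c0); exact: Z0.
by move=> /(_ measurableT B mB); rewrite setTI.
Qed.

End cylinders.

Lemma convex_shift (R : realType) (f : R -> R) (q : R) : 0 <= q ->
  convex_on_half_line f -> convex_on_half_line (shift_mechanism f q).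
Proof.
move=> q0 cf x y t x0 y0 t01; rewrite /shift_mechanism.
rewrite (_ : t * x + (1 - t) * y + q = t * (x + q) + (1 - t) * (y + q)); last by ring.
have := cf (x + q) (y + q) t (addr_ge0 x0 q0) (addr_ge0 y0 q0) t01.
rewrite (_ : t * (f (x + q) - f q) + (1 - t) * (f (y + q) - f q) =
  t * f (x + q) + (1 - t) * f (y + q) - f q); last by ring.
by rewrite lerD2r.
Qed.

Section girsanov.
Context (R : realType) d (T : measurableType d) (P Q : probability T R).
Context (Z : R -> T -> R) (f : R -> R) (u u' : R -> R -> R) (q x : R).
Hypothesis hP : exponential_markov P Z u.
Hypothesis cf : convex_on_half_line f.
Hypothesis f0 : f 0 = 0.
Hypothesis hu : flow_generator f u.
Hypothesis q0 : 0 <= q.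

Let mZ : forall t : R, 0 <= t -> measurable_fun setT (Z t). Proof. by case: hP. Qed.
Let Z0 : forall (t : R) w, 0 <= t -> 0 <= Z t w. Proof. by case: hP. Qed.

Local Notation W := (exp_functional Z f q).

Lemma exp_functional_q0 t w : q = 0 -> W q t w = 1.
Proof. by move=> ->; rewrite /exp_functional f0 !mul0r !oppr0 mul0r add0r expR0. Qed.

Lemma exp_functional_le c t w : 0 <= t -> q <= c -> W c t w <= W q t w.
Proof. by move=> t0 qc; rewrite ler_expR lerD2r ler_wpM2r ?Z0// lerN2. Qed.

Lemma exp_functional_integrable_ge0 t : 0 <= t -> P.-integrable setT (EFin \o W q t).
Proof.
move=> t0; have [qz|qn] := eqVneq q 0.
  apply: (probability_bounded_integrable P (K := 1)).
    exact: (exp_functional_measurable f q hP).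
  by move=> w; rewrite exp_functional_q0// normr1.
apply: (exp_functional_integrable hP cf f0 hu q0) => //.
by rewrite lt_neqAle eq_sym qn.
Qed.

Lemma exp_functional_weighted_integrable c t (Y : T -> R) :
  0 <= t -> q <= c -> measurable_fun setT Y -> (forall w, `|Y w| <= 1) ->
  P.-integrable setT (EFin \o (fun w => Y w * W c t w)).
Proof.
move=> t0 qc mY Y1; apply: dominated_integrable_real (exp_functional_integrable_ge0 t0) _ => //.
  by apply: measurable_funM => //; exact: (exp_functional_measurable f q hP).
move=> w _; rewrite normrM -[leRHS]mul1r; apply: ler_pM => //.
by rewrite ger0_norm ?expR_ge0// exp_functional_le.
Qed.

Lemma exp_functional_martingale_q s t (Y : T -> R) : 0 <= s -> s <= t ->
  measurable_wrt (natural_filtration Z s) Y -> (forall w, `|Y w| <= 1) ->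
  \int[P]_w (Y w * W q t w) = \int[P]_w (Y w * W q s w).
Proof.
move=> s0 st mY Y1; have [qz|qn] := eqVneq q 0.
  by apply: eq_Rintegral => w _; rewrite !exp_functional_q0.
have q1 : 0 < q by rewrite lt_neqAle eq_sym qn.
apply: (exp_functional_martingale hP cf f0 hu q0 s0 st q1 (v := fun=> q)) => //.
- by move=> r _; exact: cvg_cst.
- by move=> r _; rewrite subrr; exact: rderive_cst.
Qed.

Hypothesis hQ : exponential_markov Q Z u'.
Hypothesis hu' : laplace_exponent (shift_mechanism f q) u'.
Hypothesis startP : {ae P, forall w, Z 0 w = x}.
Hypothesis startQ : {ae Q, forall w, Z 0 w = x}.

Let cf' : convex_on_half_line (shift_mechanism f q). Proof. exact: convex_shift. Qed.
Let f0' : shift_mechanism f q 0 = 0. Proof. by rewrite /shift_mechanism add0r subrr. Qed.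
Let hg' : flow_generator (shift_mechanism f q) u'.
Proof. exact: laplace_exponent_generator. Qed.

(** Under the measure with density [W q t], the process is Markov with the flow
[u'] of the shifted mechanism: the exponent [q + u' (t - r) lam] solves the
equation required along [[s, t]]. *)
Lemma exp_functional_flow s t lam (Y : T -> R) : 0 <= s -> s <= t -> 0 < lam ->
  measurable_wrt (natural_filtration Z s) Y -> (forall w, `|Y w| <= 1) ->
  \int[P]_w (Y w * W (q + lam) t w) = \int[P]_w (Y w * W (q + u' (t - s) lam) s w).
Proof.
move=> s0 st l0 mY Y1; have ts0 : 0 <= t - s by rewrite subr_ge0.
have [c c0 Hc] := flow_lower_bound cf' f0' hu' ts0 l0.
have ge r : s <= r <= t -> c <= u' (t - r) lam.
  by move=> /andP[sr rt]; apply: Hc; rewrite subr_ge0 rt lerD2l lerN2.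
pose v r := q + u' (t - r) lam.
have vt : v t = q + lam by rewrite /v subrr (flow_start hu')// ltW.
rewrite -vt; apply: (exp_functional_martingale hP cf f0 hu q0 s0 st c0 (v := v) _ _ _ _ mY Y1).
- by move=> r /ge cu; apply: (le_trans cu); rewrite lerDr.
- by move=> r /ge cu; rewrite lerDl; exact: le_trans (ltW c0) cu.
- move=> r /andP[sr rt]; apply: cvgD; first exact: cvg_cst.
  have tr0 : 0 <= t - r by rewrite subr_ge0.
  rewrite (_ : (fun h => _) = fun h => u' (t - r + h) lam); first exact: (flow_right hu' tr0 (ltW l0)).
  by apply/funext => h; congr u'; ring.
- move=> r /andP[sr rt]; have := rderiveD (rderive_cst q r)
    (flow_backward cf' f0' hu' rt l0 (le_trans s0 sr)).
  by rewrite add0r /shift_mechanism [u' _ _ + q]addrC.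
Qed.

(* The factor [expR (- mu * Z s w)] makes the identity pass from one time to the
next. *)
Let agree (s : R) (Y : T -> R) (g : T -> R) : Prop := forall mu, 0 <= mu ->
  \int[Q]_w (Y w * (g w * expR (- mu * Z s w))) =
  expR (q * x) * \int[P]_w (Y w * (g w * W (q + mu) s w)).

Let mW c s : 0 <= s -> measurable_fun setT (W c s).
Proof. by move=> s0; exact: (exp_functional_measurable f q hP). Qed.

Let mE c s : 0 <= s -> measurable_fun setT (fun w => expR (- c * Z s w)).
Proof. by move=> s0; exact: (measurable_exp_marginal hP). Qed.

Let iQ (Y : T -> R) c s : 0 <= s -> 0 <= c -> measurable_fun setT Y -> (forall w, `|Y w| <= 1) ->
  Q.-integrable setT (EFin \o (fun w => Y w * expR (- c * Z s w))).
Proof.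
move=> s0 c0 mY Y1; apply: (probability_bounded_integrable Q (K := 1)).
  by apply: measurable_funM => //; exact: mE.
move=> w; rewrite normrM -[leRHS]mul1r; apply: ler_pM => //.
by rewrite ger0_norm ?expR_ge0// (exp_marginal_le1 hP).
Qed.

Let agree_indicator s (Y : T -> R) c : 0 <= s -> 0 <= c ->
  measurable_fun setT Y -> (forall w, `|Y w| <= 1) ->
  agree s Y (fun=> 1) -> agree s Y (\1_[set w | c < Z s w]).
Proof.
move=> s0 c0 mY Y1 base.
pose g rho k w := (1 - expR (- rho * Z s w)) ^+ k : R.
have g1 rho k w : 0 <= rho -> `|g rho k w| <= 1.
  move=> r0; have e1 := exp_marginal_le1 hP w r0 s0.
  by rewrite ger0_norm ?exprn_ge0 ?exprn_ile1 ?subr_ge0// gerBl expR_ge0.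
have mg rho k : measurable_fun setT (g rho k).
  apply: measurable_funX; apply: measurable_funB; first exact: measurable_cst.
  exact: mE.
have mYg rho k : measurable_fun setT (fun w => Y w * g rho k w) by exact: measurable_funM.
have Yg1 rho k w : 0 <= rho -> `|Y w * g rho k w| <= 1.
  by move=> r0; rewrite normrM -[leRHS]mulr1; apply: ler_pM => //; exact: g1.
have poly_ rho k : 0 <= rho -> agree s Y (g rho k).
  move=> r0; elim: k => [|k ih] mu mu0.
    rewrite (_ : g rho 0 = fun=> 1); first exact: base.
    by apply/funext => w; rewrite /g expr0.
  have rm0 : 0 <= rho + mu by rewrite addr_ge0.
  transitivity (\int[Q]_w (Y w * (g rho k w * expR (- mu * Z s w))) -
     \int[Q]_w (Y w * (g rho k w * expR (- (rho + mu) * Z s w)))).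
    rewrite -RintegralB//.
    - apply: eq_Rintegral => w _.
      rewrite (_ : - (rho + mu) * Z s w = - rho * Z s w + - mu * Z s w); last by ring.
      by rewrite /g exprS expRD; ring.
    - have := iQ s0 mu0 (mYg rho k) (fun w => Yg1 rho k w r0).
      by apply: eq_integrable => // w _ /=; rewrite mulrA.
    - have := iQ s0 rm0 (mYg rho k) (fun w => Yg1 rho k w r0).
      by apply: eq_integrable => // w _ /=; rewrite mulrA.
  rewrite (ih mu mu0) (ih _ rm0) -mulrBr; congr (_ * _).
  rewrite -RintegralB//.
  - apply: eq_Rintegral => w _.
    rewrite (_ : W (q + (rho + mu)) s w = expR (- rho * Z s w) * W (q + mu) s w).
      by rewrite /g exprS; ring.
    by rewrite /exp_functional -expRD; congr expR; ring.
  - have := exp_functional_weighted_integrable (c := q + mu) s0 _ (mYg rho k)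
      (fun w => Yg1 rho k w r0).
    rewrite lerDl => /(_ mu0); apply: eq_integrable => // w _ /=; by rewrite mulrA.
  - have := exp_functional_weighted_integrable (c := q + (rho + mu)) s0 _ (mYg rho k)
      (fun w => Yg1 rho k w r0).
    rewrite lerDl => /(_ rm0); apply: eq_integrable => // w _ /=; by rewrite mulrA.
move=> mu mu0.
pose F n := g n%:R (n * (Num.truncn (expR (n%:R * c))).+1)%N.
have Fc w : F n w @[n --> \oo] --> (\1_[set w | c < Z s w] w : R).
  have := exp_indicator_cvg c0 (Z0 w s0).
  rewrite !indicE (_ : (Z s w \in _) = (w \in [set w | c < Z s w])) //.
  by apply/idP/idP => /set_mem h; apply/mem_set; move: h; rewrite /= in_itv/= andbT.
have L1 : \int[Q]_w (Y w * (F n w * expR (- mu * Z s w))) @[n --> \oo] -->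
    \int[Q]_w (Y w * (\1_[set w | c < Z s w] w * expR (- mu * Z s w))).
  apply: (Rintegral_dominated_cvg (g := fun=> 1)) => //.
  - move=> n; apply: measurable_funM => //; apply: measurable_funM; [exact: mg|exact: mE].
  - by move=> w _; apply: cvgMl_tmp; apply: cvgMr_tmp; exact: Fc.
  - by apply: (probability_bounded_integrable Q (K := 1)) => // w; rewrite normr1.
  - move=> n w _; rewrite mulrA normrM -[leRHS]mulr1; apply: ler_pM => //.
      by rewrite /F Yg1.
    by rewrite ger0_norm ?expR_ge0// (exp_marginal_le1 hP).
have L2 : \int[P]_w (Y w * (F n w * W (q + mu) s w)) @[n --> \oo] -->
    \int[P]_w (Y w * (\1_[set w | c < Z s w] w * W (q + mu) s w)).
  apply: (Rintegral_dominated_cvg (g := W q s)) => //.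
  - move=> n; apply: measurable_funM => //; apply: measurable_funM; [exact: mg|exact: mW].
  - by move=> w _; apply: cvgMl_tmp; apply: cvgMr_tmp; exact: Fc.
  - exact: exp_functional_integrable_ge0.
  - move=> n w _; rewrite mulrA normrM -[leRHS]mul1r; apply: ler_pM => //.
      by rewrite /F Yg1.
    by rewrite ger0_norm ?expR_ge0// exp_functional_le// lerDl.
have {}L2 : (expR (q * x) * \int[P]_w (Y w * (F n w * W (q + mu) s w))) @[n --> \oo] -->
    expR (q * x) * \int[P]_w (Y w * (\1_[set w | c < Z s w] w * W (q + mu) s w)).
  exact: cvgMl_tmp.
apply: (cvg_unique _ L1) => //; apply: (cvg_trans _ L2); apply: near_eq_cvg; apply: nearW => n /=.
by rewrite poly_.
Qed.

(** By induction on the number of times: [exp_functional_flow] moves the identity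
to the next time, where the indicator of [c < Z] is a limit of polynomials in
exponentials of [Z]. *)
Lemma girsanov_cylinder n s A : cylinder Z n s A -> agree s \1_A (fun=> 1).
Proof.
elim=> [|{}n {}s t c {}A cA ih st c0] mu mu0.
  rewrite (_ : \int[Q]_w _ = expR (- mu * x)); last first.
    transitivity (\int[Q]_w expR (- mu * x)).
      rewrite /Rintegral; congr fine; apply: ae_eq_integral => //.
      - apply/measurable_EFinP; apply: measurable_funM; first exact: measurable_indic.
        by apply: measurable_funM; [exact: measurable_cst|exact: mE].
      - case: startQ => N [mN N0 sN]; exists N; split => // w /= h; apply: sN => /= e; apply: h => _.
        by rewrite indicT mul1r mul1r e.
    exact: expectation_cst.
  rewrite (_ : \int[P]_w _ = expR (- (q + mu) * x)).
    by rewrite -expRD; congr expR; ring.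
  transitivity (\int[P]_w expR (- (q + mu) * x)).
    rewrite /Rintegral; congr fine; apply: ae_eq_integral => //.
    - apply/measurable_EFinP; apply: measurable_funM; first exact: measurable_indic.
      by apply: measurable_funM; [exact: measurable_cst|exact: mW].
    - case: startP => N [mN N0 sN]; exists N; split => // w /= h; apply: sN => /= e; apply: h => _.
      by rewrite indicT mul1r mul1r /exp_functional primitive0 mulr0 subr0 e.
  exact: expectation_cst.
have s0 := cylinder_ge0 cA; have t0 := le_trans s0 st.
have FA := cylinder_past cA.
have mA : measurable A by exact: natural_filtration_measurable mZ FA.
have m1 : measurable_fun setT (\1_A : T -> R) by exact: measurable_indic.
have b1 w : `|\1_A w : R| <= 1 by exact: norm_indic_le1.
have w1 : measurable_wrt (natural_filtration Z s) (\1_A : T -> R).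
  by apply/measurable_wrt_naturalP; apply: measurable_indic.
have base : agree t \1_A (fun=> 1).
  move=> rho rho0.
  under eq_Rintegral do rewrite mul1r; under [in RHS]eq_Rintegral do rewrite mul1r.
  have [->|rn] := eqVneq rho 0.
    under eq_Rintegral do rewrite oppr0 mul0r expR0 mulr1.
    rewrite addr0 (exp_functional_martingale_q s0 st w1 b1).
    have := ih 0 (lexx 0); rewrite addr0.
    under eq_Rintegral do rewrite oppr0 mul0r expR0 mul1r mulr1.
    by under [in RHS]eq_Rintegral do rewrite mul1r.
  have r0 : 0 < rho by rewrite lt_neqAle eq_sym rn.
  have ts0 : 0 <= t - s by rewrite subr_ge0.
  have := markov_bounded hQ hg' s0 ts0 rho0 w1 b1; rewrite addrC subrK => ->.
  rewrite (exp_functional_flow s0 st r0 w1 b1).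
  have := ih (u' (t - s) rho) (flow_ge0 hu' ts0 rho0).
  by under eq_Rintegral do rewrite mul1r; under [in RHS]eq_Rintegral do rewrite mul1r.
have := agree_indicator t0 c0 m1 b1 base mu0.
rewrite indicI.
by under eq_Rintegral do rewrite mulrA -[X in X * _]mulr1 -mulrA;
  under [in RHS]eq_Rintegral do rewrite mulrA -[X in X * _]mulr1 -mulrA.
Qed.

Lemma girsanov_natural a A : 0 <= a -> natural_filtration Z a A ->
  fine (Q A) = expR (q * x) * \int[P]_w (\1_A w * W q a w).
Proof.
move=> a0 FA.
pose H := [set A : set T | measurable A /\
  fine (Q A) = expR (q * x) * \int[P]_w (\1_A w * W q a w)].
suff : <<s [set A | exists n s, s <= a /\ cylinder Z n s A] >> `<=` H.
  by move=> /(_ A); move=> /(_ (natural_filtration_cylinder Z0 a0 FA))[].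
have ind1 (B : set T) (w : T) : `|\1_B w : R| <= 1 by exact: norm_indic_le1.
have indm (B : set T) : measurable B -> measurable_fun setT (\1_B : T -> R).
  by move=> mB; exact: measurable_indic.
have cyl n s B : s <= a -> cylinder Z n s B -> H B.
  move=> sa cB; have s0 := cylinder_ge0 cB; have FB := cylinder_past cB.
  have mB : measurable B by exact: natural_filtration_measurable mZ FB.
  split=> //; have := girsanov_cylinder cB (lexx 0); rewrite addr0.
  under eq_Rintegral do rewrite oppr0 mul0r expR0 mul1r mulr1.
  under [in RHS]eq_Rintegral do rewrite mul1r.
  rewrite -(exp_functional_martingale_q s0 sa _ (ind1 B)); last first.
    by apply/measurable_wrt_naturalP; apply: measurable_indic.
  by rewrite /Rintegral integral_indic// setIT.
have intW B : measurable B -> P.-integrable setT (EFin \o (fun w => \1_B w * W q a w)).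
  move=> mB; exact: exp_functional_weighted_integrable a0 (lexx q) (indm B mB) (ind1 B).
apply: lambda_system_subset => //.
- move=> B C [n [s [sa cB]]] [m [t [ta cC]]]; exists (n + m)%N, (Num.max s t).
  by split; [rewrite ge_max sa|exact: cylinderI].
- split=> //.
  + exact: (cyl 0%N 0 setT a0 (cylinder0 Z)).
  + move=> B C CB [mB HB] [mC HC]; split; first exact: measurableD.
    rewrite measureD// ?(setIidr CB); last first.
      by rewrite (le_lt_trans (probability_le1 _ _))// ltry.
    have fQ D : measurable D -> Q D \is a fin_num by move=> mD; exact: fin_num_measure.
    rewrite fineB ?fQ// HB HC -mulrBr -RintegralB//; [|exact: intW..].
    congr (_ * _); apply: eq_Rintegral => w _; rewrite -mulrBl; congr (_ * _).
    rewrite !indicE in_setD; have [wC|wC] := boolP (w \in C); last by rewrite andbT subr0.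
    have -> : w \in B by apply/mem_set/CB/set_mem.
    by rewrite subrr.
  + move=> F ndF HF; have mF i : measurable (F i) by case: (HF i).
    have mU : measurable (\bigcup_i F i) by exact: bigcupT_measurable.
    split=> //.
    have L1 : fine (Q (F i)) @[i --> \oo] --> fine (Q (\bigcup_i F i)).
      by apply: fine_cvg; rewrite fineK ?fin_num_measure//; exact: nondecreasing_cvg_mu.
    have L2 : \int[P]_w (\1_(F i) w * W q a w) @[i --> \oo] -->
        \int[P]_w (\1_(\bigcup_i F i) w * W q a w).
      apply: (Rintegral_dominated_cvg (g := W q a)) => //.
      * by move=> n; apply: measurable_funM; [exact: indm|exact: mW].
      * move=> w _; apply: cvgMr_tmp.
        have [[n _ Fn]|nF] := pselect ((\bigcup_i F i) w).
          rewrite [X in _ --> X]indicE mem_set; last by exists n.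
          have c1 : (fun _ : nat => 1 : R) @ \oo --> (1 : R) by exact: cvg_cst.
          apply: (cvg_trans _ c1); apply: near_eq_cvg; exists n => // m /= nm.
          by rewrite indicE mem_set//; have /subsetPset := ndF _ _ nm; exact.
        rewrite [X in _ --> X]indicE memNset//.
        have c0 : (fun _ : nat => 0 : R) @ \oo --> (0 : R) by exact: cvg_cst.
        apply: (cvg_trans _ c0); apply: near_eq_cvg; apply: nearW => m.
        by rewrite indicE memNset// => Fm; apply: nF; exists m.
      * exact: exp_functional_integrable_ge0.
      * move=> n w _; rewrite normrM -[leRHS]mul1r; apply: ler_pM => //.
        by rewrite ger0_norm ?expR_ge0.
    have {}L2 : (expR (q * x) * \int[P]_w (\1_(F i) w * W q a w)) @[i --> \oo] -->
        expR (q * x) * \int[P]_w (\1_(\bigcup_i F i) w * W q a w).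
      exact: cvgMl_tmp.
    apply: (cvg_unique _ L1) => //; apply: (cvg_trans _ L2); apply: near_eq_cvg; apply: nearW => n /=.
    by case: (HF n).
- by move=> B [n [s [sa cB]]]; exact: cyl cB.
Qed.

End girsanov.

(** * Branching mechanisms *)

Definition levy_integrand (R : realType) (lam l : R) : R :=
  expR (- lam * l) - 1 + lam * l * (l <= 1)%R%:R.

Lemma measurable_levy_integrand (R : realType) (lam : R) (D : set R) :
  measurable_fun D (levy_integrand lam).
Proof.
apply: measurable_funTS; apply: measurable_funD.
  apply: measurable_funB; last exact: measurable_cst.
  apply: measurableT_comp; first exact: measurable_expR.
  by apply: measurable_funM; [exact: measurable_cst|exact: measurable_id].
apply: measurable_funM.
  by apply: measurable_funM; [exact: measurable_cst|exact: measurable_id].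
rewrite (_ : (fun l => _) = \1_(`]-oo, 1] : set R)); first exact: measurable_indic.
apply/funext => l; rewrite indicE; congr ((nat_of_bool _)%:R).
by apply/idP/idP => [h|/set_mem]; [apply/mem_set|]; rewrite /= in_itv.
Qed.

Lemma levy_integrand_small (R : realType) (lam l : R) : 0 < l -> l <= 1 ->
  `|levy_integrand lam l| <= lam ^+ 2 * expR `|lam| * Num.min 1 (l ^+ 2).
Proof.
move=> l0 l1; rewrite /levy_integrand l1 mulr1.
have := expR_taylor2 (- lam * l); rewrite -addrA mulNr opprK => h.
rewrite -addrA; apply: (le_trans h).
rewrite min_r ?expr_le1 ?(ltW l0)//.
rewrite (_ : _ * expR `|lam| * _ = lam ^+ 2 * (l ^+ 2 * expR `|lam|)); last by ring.
rewrite sqrrN exprMn -mulrA ler_wpM2l ?sqr_ge0// ler_wpM2l ?sqr_ge0// ler_expR normrN normrM.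
by rewrite ler_piMr// gtr0_norm.
Qed.

Lemma levy_integrand_large (R : realType) (theta lam l : R) : 1 < l -> - theta <= lam ->
  0 <= theta -> `|levy_integrand lam l| <= expR (theta * l).
Proof.
move=> l1 tl t0; have l0 : 0 < l by exact: lt_trans l1.
rewrite /levy_integrand [l <= 1]leNgt l1 mulr0 addr0.
have h1 : expR (- lam * l) <= expR (theta * l).
  by rewrite ler_expR ler_wpM2r ?(ltW l0)// lerNl.
have h2 : 1 <= expR (theta * l) by rewrite -expR0 ler_expR mulr_ge0 ?(ltW l0).
have h3 := expR_ge0 (- lam * l).
by rewrite ler_norml; apply/andP; split; lra.
Qed.

(** Dominates the integrands of [psi] for the exponents down to [- theta]. The
factor [theta != 0] makes it the function [1 /\ l ^ 2] when [theta = 0], a case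
without exponential moments. *)
Definition levy_dominator (R : realType) (theta l : R) : R :=
  Num.min 1 (l ^+ 2) + (theta != 0)%:R * (1 < l)%R%:R * (l * expR (theta * l)).

Section mechanism.
Context (R : realType) (alpha beta : R) (pi : {measure set R -> \bar R}) (theta : R).
Hypothesis hbeta : 0 <= beta.
Hypothesis hpi : levy_measure pi.
Hypothesis theta0 : 0 <= theta.
Hypothesis htheta : theta != 0 ->
  (\int[pi]_(l in `]1%R, +oo[) (l * expR (theta * l))%:E < +oo)%E.

Let mpos : measurable (`]0, +oo[%classic : set R) := measurable_itv _.

Lemma levy_dominator_ge0 l : 0 < l -> 0 <= levy_dominator theta l.
Proof.
move=> l0; rewrite addr_ge0 ?le_min ?ler01 ?sqr_ge0// mulr_ge0 ?mulr_ge0 ?expR_ge0//.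
exact: ltW.
Qed.

Lemma measurable_min_sqr (D : set R) : measurable_fun D (fun l : R => Num.min 1 (l ^+ 2)).
Proof.
apply: measurable_funTS; apply: measurable_minr; first exact: measurable_cst.
by apply: measurable_funX; exact: measurable_id.
Qed.

Lemma measurable_mul_exp (D : set R) : measurable_fun D (fun l : R => l * expR (theta * l)).
Proof.
apply: measurable_funTS; apply: measurable_funM; first exact: measurable_id.
apply: measurableT_comp; first exact: measurable_expR.
by apply: measurable_funM; [exact: measurable_cst|exact: measurable_id].
Qed.

Lemma levy_dominator_integrable :
  pi.-integrable `]0, +oo[ (EFin \o levy_dominator theta).
Proof.
have i1 : pi.-integrable `]0, +oo[ (EFin \o (fun l : R => Num.min 1 (l ^+ 2))).
  apply/integrableP; split; first by apply/measurable_EFinP; exact: measurable_min_sqr.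
  have [_] := hpi; apply: le_lt_trans; rewrite le_eqVlt; apply/orP; left; apply/eqP.
  apply: eq_integral => l _ /=; rewrite ger0_norm// le_min ler01/=.
  exact: sqr_ge0.
have [t0|tn] := eqVneq theta 0.
  move: i1; apply: eq_integrable => // l _ /=.
  by rewrite /levy_dominator t0 eqxx !mul0r addr0.
have i2 : pi.-integrable `]0, +oo[ (EFin \o (fun l : R => (1 < l)%R%:R * (l * expR (theta * l)))).
  have -> : EFin \o (fun l : R => (1 < l)%R%:R * (l * expR (theta * l))) =
      (EFin \o (fun l : R => l * expR (theta * l))) \_ `]1, +oo[.
    apply/funext => l; rewrite /patch /= -[X in _ = if X then _ else _]/(l \in _).
    have -> : (l \in `]1%R, +oo[%classic) = (1 < l).
      by apply/idP/idP => [/set_mem|h]; [|apply/mem_set]; rewrite /= in_itv/= andbT.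
    by case: ifP => _; rewrite ?mul1r ?mul0r.
  apply/integrable_restrict => //; rewrite setIidr; last first.
    by apply: subset_itvr; rewrite bnd_simp.
  apply/integrableP; split; first by apply/measurable_EFinP; exact: measurable_mul_exp.
  apply: le_lt_trans (htheta tn); rewrite le_eqVlt; apply/orP; left; apply/eqP.
  apply: eq_integral => l /set_mem /=; rewrite in_itv/= andbT => l1.
  by rewrite ger0_norm// mulr_ge0 ?expR_ge0// ltW// (lt_trans _ l1).
have := integrableD mpos i1 i2; apply: eq_integrable => // l _ /=.
by rewrite /levy_dominator tn mul1r.
Qed.

Lemma levy_integrand_bound lam l : - theta <= lam -> 0 < l ->
  `|levy_integrand lam l| <= (lam ^+ 2 * expR `|lam| + 1) * levy_dominator theta l.
Proof.
move=> tl l0; have K0 : 0 <= lam ^+ 2 * expR `|lam| by rewrite mulr_ge0 ?sqr_ge0 ?expR_ge0.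
have G0 := levy_dominator_ge0 l0.
have [l1|l1] := leP l 1.
  apply: (le_trans (levy_integrand_small lam l0 l1)).
  have m0 : 0 <= Num.min 1 (l ^+ 2) by rewrite le_min ler01 sqr_ge0.
  apply: ler_pM => //; first by rewrite lerDl.
  by rewrite lerDl mulr_ge0 ?mulr_ge0 ?expR_ge0// ltW.
apply: (le_trans (levy_integrand_large l1 tl theta0)).
apply: (@le_trans _ _ (levy_dominator theta l)); last by rewrite ler_peMl// lerDr.
rewrite /levy_dominator l1 mulr1 min_l ?expr_ge1 ?(ltW l1) ?(ltW l0)//.
have [->|tn] := eqVneq theta 0; first by rewrite !mul0r expR0 addr0.
rewrite mul1r -[leLHS]mul1r; apply: ler_wpDl => //.
by rewrite ler_wpM2r ?expR_ge0// ltW.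
Qed.

Lemma levy_integrand_integrable lam : - theta <= lam ->
  pi.-integrable `]0, +oo[ (EFin \o levy_integrand lam).
Proof.
move=> tl.
have i1 : pi.-integrable `]0, +oo[ (EFin \o (fun l =>
    (lam ^+ 2 * expR `|lam| + 1) * levy_dominator theta l)).
  have := integrableZl mpos (lam ^+ 2 * expR `|lam| + 1) levy_dominator_integrable.
  exact: eq_integrable.
apply: dominated_integrable_real i1 _ => //; first exact: measurable_levy_integrand.
by move=> l /=; rewrite in_itv/= andbT; exact: levy_integrand_bound.
Qed.

Local Notation Psi := (psi alpha beta pi).

Lemma psi0 : Psi 0 = 0.
Proof.
rewrite /psi mulr0 expr0n/= mulr0 !add0r.
under eq_Rintegral do rewrite oppr0 !mul0r expR0 subrr addr0.
by rewrite Rintegral_cst// mul0r.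
Qed.

Lemma psi_convex (x y t : R) : - theta <= x -> - theta <= y -> 0 <= t <= 1 ->
  Psi (t * x + (1 - t) * y) <= t * Psi x + (1 - t) * Psi y.
Proof.
move=> tx ty /andP[t0 t1].
have t1' : 0 <= 1 - t by rewrite subr_ge0.
have txy : - theta <= t * x + (1 - t) * y.
  have h1 := ler_wpM2l t0 tx; have h2 := ler_wpM2l t1' ty.
  by apply: (le_trans _ (lerD h1 h2)); rewrite -mulrDl addrC subrK mul1r.
have ix := levy_integrand_integrable tx; have iy := levy_integrand_integrable ty.
have I : \int[pi]_(l in `]0, +oo[) levy_integrand (t * x + (1 - t) * y) l <=
    t * \int[pi]_(l in `]0, +oo[) levy_integrand x l +
    (1 - t) * \int[pi]_(l in `]0, +oo[) levy_integrand y l.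
  have ixt : pi.-integrable `]0, +oo[ (EFin \o (fun l => t * levy_integrand x l)).
    by have := integrableZl mpos t ix; exact: eq_integrable.
  have iyt : pi.-integrable `]0, +oo[ (EFin \o (fun l => (1 - t) * levy_integrand y l)).
    by have := integrableZl mpos (1 - t) iy; exact: eq_integrable.
  rewrite -!RintegralZl// -RintegralD//; apply: le_Rintegral => //.
  - exact: levy_integrand_integrable.
  - by have := integrableD mpos ixt iyt; exact: eq_integrable.
  move=> l _; rewrite /levy_integrand.
  have : expR (t * (- x * l) + (1 - t) * (- y * l)) <=
      t * expR (- x * l) + (1 - t) * expR (- y * l).
    exact: (@convex_expR R (Itv01 t0 t1) (- x * l) (- y * l)).
  rewrite (_ : t * (- x * l) + (1 - t) * (- y * l) = - (t * x + (1 - t) * y) * l); last by ring.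
  set e := expR _; set ex := expR _; set ey := expR _; set i := _%:R => h.
  rewrite [leRHS](_ : _ = (t * ex + (1 - t) * ey) - 1 + (t * x + (1 - t) * y) * l * i).
    by rewrite 2!lerD2r.
  by ring.
rewrite /psi -/(levy_integrand _ _).
have S : (t * x + (1 - t) * y) ^+ 2 <= t * x ^+ 2 + (1 - t) * y ^+ 2.
  rewrite -subr_ge0 [leRHS](_ : _ = t * (1 - t) * (x - y) ^+ 2); last by ring.
  by apply: mulr_ge0; [exact: mulr_ge0|exact: sqr_ge0].
have B := ler_wpM2l hbeta S.
move: I B; rewrite /levy_integrand; set I0 := Rintegral _ _ _; set Ix := Rintegral _ _ _.
set Iy := Rintegral _ _ _; set s := (_ + _) ^+ 2; set X2 := x ^+ 2; set Y2 := y ^+ 2 => I B.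
by lra.
Qed.

End mechanism.

(** * The generator on polynomials in [exp (- eps z)] *)

(** In the variable [x = expR (- eps * z)], the derivative in [z] is [- eps] times
the operator [x d/dx]. *)
Definition euler (R : realType) (p : {poly R}) : {poly R} := 'X * p^`().

Lemma size_euler (R : realType) (p : {poly R}) : (size (euler p) <= size p)%N.
Proof.
rewrite /euler mulrC; have [->|p0] := eqVneq p 0; first by rewrite derivC mul0r size_poly0.
have [->|d0] := eqVneq p^`() 0; first by rewrite mul0r size_poly0.
by rewrite size_mulX// (leq_ltn_trans (leqnn _))// lt_size_deriv.
Qed.

Lemma coef_euler (R : realType) (p : {poly R}) i : (euler p)`_i = i%:R * p`_i.
Proof.
rewrite /euler coefXM; case: i => [|i] /=; first by rewrite mul0r.
by rewrite coef_deriv mulr_natl.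
Qed.

Lemma horner_euler (R : realType) (p : {poly R}) (x : R) :
  (euler p).[x] = \sum_(i < size p) i%:R * p`_i * x ^+ i.
Proof.
rewrite (horner_coef_wide _ (size_euler p)); apply: eq_bigr => i _.
by rewrite coef_euler.
Qed.

Lemma horner_euler2 (R : realType) (p : {poly R}) (x : R) :
  (euler (euler p)).[x] = \sum_(i < size p) i%:R ^+ 2 * p`_i * x ^+ i.
Proof.
rewrite (horner_coef_wide _ (leq_trans (size_euler _) (size_euler p))).
by apply: eq_bigr => i _; rewrite !coef_euler expr2 mulrA.
Qed.

(** The jump part of the generator on [p], at a jump of size [l]. *)
Definition jump_term (R : realType) (eps x : R) (p : {poly R}) (l : R) : R :=
  p.[x * expR (- eps * l)] - p.[x] + eps * l * (l <= 1)%R%:R * (euler p).[x].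

Lemma jump_termE (R : realType) (eps x : R) (p : {poly R}) (l : R) :
  jump_term eps x p l =
  \sum_(i < size p) p`_i * x ^+ i * levy_integrand (i%:R * eps) l.
Proof.
rewrite /jump_term horner_euler !horner_coef -sumrB mulr_sumr -big_split/=.
apply: eq_bigr => i _; rewrite /levy_integrand exprMn -expRM_natl.
rewrite (_ : i%:R * (- eps * l) = - (i%:R * eps) * l); last by ring.
ring.
Qed.

Section polynomial_generator.
Context (R : realType) (alpha beta : R) (pi : {measure set R -> \bar R}).
Hypothesis hpi : levy_measure pi.
Variable eps : R.
Hypothesis eps0 : 0 <= eps.

Local Notation Psi := (psi alpha beta pi).

Let ile i : - 0 <= i%:R * eps :> R. Proof. by rewrite oppr0 mulr_ge0. Qed.

Let ii (i : nat) : pi.-integrable `]0, +oo[ (EFin \o levy_integrand (i%:R * eps)).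
Proof. by apply: (levy_integrand_integrable hpi (theta := 0)) => //; rewrite eqxx. Qed.

Let iZ (c : R) (i : nat) :
  pi.-integrable `]0, +oo[ (EFin \o (fun l => c * levy_integrand (i%:R * eps) l)).
Proof. apply: eq_integrable (integrableZl (measurable_itv _) c (ii i)) => //. Qed.

Lemma jump_term_integrable (x : R) (p : {poly R}) :
  pi.-integrable `]0, +oo[ (EFin \o jump_term eps x p).
Proof.
have H : pi.-integrable `]0, +oo[
    (fun l => \sum_(i < size p) (p`_i * x ^+ i * levy_integrand (i%:R * eps) l)%:E)%E.
  by apply: integrable_sum => // i _; exact: (iZ (p`_i * x ^+ i) i).
apply: eq_integrable H => // l _ /=.
by rewrite sumEFin jump_termE.
Qed.

(** Each monomial is an exponential, on which the generator is multiplication by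
[z * psi]; for polynomials this adds up to the usual second order
integro-differential operator divided by [z]. *)
Lemma polynomial_generatorE (x : R) (p : {poly R}) :
  \sum_(i < size p) p`_i * x ^+ i * Psi (i%:R * eps) =
  alpha * eps * (euler p).[x] + beta * eps ^+ 2 * (euler (euler p)).[x] +
  \int[pi]_(l in `]0, +oo[) jump_term eps x p l.
Proof.
have -> : \int[pi]_(l in `]0, +oo[) jump_term eps x p l =
    \sum_(i < size p) \int[pi]_(l in `]0, +oo[)
      (p`_i * x ^+ i * levy_integrand (i%:R * eps) l).
  rewrite -(Rintegral_sum (size p)
    (f := fun (i : nat) l => p`_i * x ^+ i * levy_integrand (i%:R * eps) l))//.
  by apply: eq_Rintegral => l _; rewrite jump_termE.
rewrite horner_euler horner_euler2 !mulr_sumr -!big_split/=.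
apply: eq_bigr => i _; rewrite RintegralZl//.
rewrite /psi -/(levy_integrand _ _) exprMn; set I := Rintegral _ _ _.
rewrite (_ : (fun _ => _) = levy_integrand (i%:R * eps)) in I *; last by [].
ring.
Qed.

End polynomial_generator.

(** * Expectations of polynomials along the process *)

Section polynomial_functional.
Context (R : realType) d (T : measurableType d) (P : probability T R).
Context (Z : R -> T -> R) (f : R -> R) (u : R -> R -> R).
Hypothesis hZ : exponential_markov P Z u.
Hypothesis hu : flow_generator f u.
Hypothesis f0 : f 0 = 0.
Variables (a b K : R) (D D' : R -> T -> R).
Hypothesis a0 : 0 <= a.
Hypothesis hD : adapted_factor Z a b K D D'.

Let Z0 : forall (t : R) w, 0 <= t -> 0 <= Z t w. Proof. by case: hZ. Qed.

Let mD t : a <= t <= b -> measurable_fun setT (D t).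
Proof. by move=> tab; case: hD => H _ _ _; exact: (natural_measurable_fun hZ (H t tab)). Qed.

Let iD t : a <= t <= b -> P.-integrable setT (EFin \o D t).
Proof.
move=> tab; apply: (probability_bounded_integrable P (K := K)); first exact: mD.
by move=> w; case: hD => _ + _ _; apply.
Qed.

Lemma factor_continuous : {within `[a, b], continuous (fun t => \int[P]_w D t w)}.
Proof.
apply: (lipschitz_within_continuous (K := K)) => s t as_ st tb.
have tab : a <= t <= b by rewrite tb (le_trans as_).
have sab : a <= s <= b by rewrite as_ (le_trans st).
rewrite -RintegralB; [|by []|exact: iD|exact: iD].
apply: (le_norm_expectation P); first by apply: measurable_funB; exact: mD.
by move=> w; case: hD => _ _ + _; apply.
Qed.

Lemma factor_rderive t : a <= t < b ->
  is_rderive (fun t => \int[P]_w D t w) t (\int[P]_w D' t w).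
Proof.
move=> /andP[at_ tb]; have bt0 : 0 < b - t by rewrite subr_gt0.
have tab : a <= t <= b by rewrite at_ ltW.
have th h : 0 < h < b - t -> a <= t + h <= b.
  by move=> /andP[h0 hb]; apply/andP; split; lra.
have H : \int[P]_w ((D (t + h) w - D t w) / h) @[h --> 0^'+] --> \int[P]_w D' t w.
  apply: (Rintegral_dominated_at_right (g := fun=> K) (r := b - t)) => //.
  - move=> h hb; apply: measurable_funM; last exact: measurable_cst.
    by apply: measurable_funB; apply: mD => //; exact: th.
  - by move=> w _; case: hD => _ _ _; apply; rewrite at_.
  - by apply: (probability_bounded_integrable P (K := `|K|)).
  - move=> h w hb _; have /andP[_ thb] := th h hb; have /andP[h0 _] := hb.
    rewrite normrM normfV (gtr0_norm h0) ler_pdivrMr//.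
    have [_ _ /(_ t (t + h) w at_ _ thb) + _] := hD.
    by rewrite lerDl (ltW h0) => /(_ isT); rewrite [t + h - t]addrAC subrr add0r.
apply: (cvg_trans _ H); apply: near_eq_cvg; near=> h.
have h0 : 0 < h by near: h; exact: nbhs_right_gt.
have hb : h < b - t by near: h; exact: nbhs_right_lt.
have hI : 0 < h < b - t by rewrite h0.
have iB : P.-integrable setT (EFin \o (fun w => D (t + h) w - D t w)).
  exact: (integrableB measurableT (iD (th h hI)) (iD tab)).
by rewrite RintegralZr// RintegralB//; apply: iD => //; apply: th.
Unshelve. all: by end_near. Qed.

Variables (eps : R) (p : {poly R}).
Hypothesis eps0 : 0 < eps.

Let X (t : R) w : R := expR (- eps * Z t w).

Let mX t : 0 <= t -> measurable_fun setT (X t).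
Proof. by move=> t0; exact: (measurable_exp_marginal hZ). Qed.

Let Xi (i : nat) t w : X t w ^+ i = expR (- (i%:R * eps) * Z t w).
Proof. by rewrite /X -expRM_natl; congr expR; ring. Qed.

Let phi (i : nat) t : R := \int[P]_w (D t w * X t w ^+ i).

Let X01 t w : 0 <= t -> 0 <= X t w <= 1.
Proof. by move=> t0; rewrite expR_ge0 (exp_marginal_le1 hZ w (ltW eps0) t0). Qed.

Let iphi i t : a <= t <= b -> P.-integrable setT (EFin \o (fun w => D t w * X t w ^+ i)).
Proof.
move=> tab; have /andP[at_ _] := tab; have t0 := le_trans a0 at_.
apply: (probability_bounded_integrable P (K := K)).
  by apply: measurable_funM; [exact: mD|apply: measurable_funX; exact: mX].
move=> w; rewrite normrM -[leRHS]mulr1; apply: ler_pM => //.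
  by case: hD => _ H _ _; exact: H.
have /andP[h0 h1] := X01 w t0.
by rewrite ger0_norm ?exprn_ge0// exprn_ile1.
Qed.

Let phiE t : a <= t <= b -> \int[P]_w (D t w * p.[X t w]) = \sum_(i < size p) p`_i * phi i t.
Proof.
move=> tab.
have iP (i : nat) : P.-integrable setT (EFin \o (fun w => p`_i * (D t w * X t w ^+ i))).
  by apply: eq_integrable (integrableZl measurableT p`_i (iphi i tab)).
transitivity (\int[P]_w (\sum_(i < size p) p`_i * (D t w * X t w ^+ i))).
  apply: eq_Rintegral => w _; rewrite horner_coef mulr_sumr.
  by apply: eq_bigr => i _; rewrite mulrCA.
rewrite (Rintegral_sum (size p) (f := fun (i : nat) w => p`_i * (D t w * X t w ^+ i)))//.
by apply: eq_bigr => i _; rewrite RintegralZl//; exact: iphi.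
Qed.

Lemma poly_functional_continuous :
  {within `[a, b], continuous (fun t => \int[P]_w (D t w * p.[X t w]))}.
Proof.
have phic i : {within `[a, b], continuous (phi i)}.
  case: i => [|i].
    rewrite (_ : phi 0 = fun t => \int[P]_w D t w); first exact: factor_continuous.
    by apply/funext => t; apply: eq_Rintegral => w _; rewrite expr0 mulr1.
  have e0 : 0 < i.+1%:R * eps by rewrite mulr_gt0.
  rewrite (_ : phi i.+1 = fun t => \int[P]_w (D t w * expR (- (i.+1%:R * eps) * Z t w))).
    apply: (functional_continuous hZ hu a0 e0 hD (v := fun=> i.+1%:R * eps) (v' := fun=> 0)) => //.
    - by move=> t _; exact: cvg_cst.
    - by move=> t _; exact: rderive_cst.
  by apply/funext => t; apply: eq_Rintegral => w _; rewrite Xi.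
have H : {within `[a, b], continuous (fun t => \sum_(i < size p) p`_i * phi i t)}.
  elim: (size p) => [|n ih].
    rewrite (_ : (fun t => _) = fun=> 0); first by move=> t; exact: cvg_cst.
    by apply/funext => t; rewrite big_ord0.
  rewrite (_ : (fun t => _) = fun t => \sum_(i < n) p`_i * phi i t + p`_n * phi n t).
    by move=> t; apply: cvgD; [exact: ih|apply: cvgMl_tmp; exact: phic].
  by apply/funext => t; rewrite big_ord_recr.
apply: subspace_eq_continuous H => t /set_mem/=; rewrite in_itv/= => tab.
exact/esym/(phiE tab).
Qed.

Let mD' t : a <= t < b -> measurable_fun setT (D' t).
Proof.
move=> /andP[at_ tb]; have bt0 : 0 < b - t by rewrite subr_gt0.
have tab : a <= t <= b by rewrite at_ ltW.
pose h (n : nat) := (b - t) / n.+1%:R.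
have h0 n : 0 < h n by rewrite divr_gt0.
have hb n : t + h n <= b.
  by rewrite -lerBrDl ler_pdivrMr// ler_peMr ?(ltW bt0)// ler1n.
apply: (measurable_fun_cvg (h := fun n w => (D (t + h n) w - D t w) / h n)).
  move=> n; apply: measurable_funM; last exact: measurable_cst.
  by apply: measurable_funB; apply: mD => //; rewrite hb (le_trans at_)// lerDl ltW.
move=> w _; case: hD => _ _ _ /(_ t w); rewrite at_ => /(_ tb) H.
have hc : h n @[n --> \oo] --> (0 : R).
  rewrite -(mulr0 (b - t)); apply: cvgMl_tmp; exact: cvg_harmonic.
have hr : h n @[n --> \oo] --> (0 : R)^'+.
  move=> S [e /= e0 He]; have /cvgrPdist_lt/(_ e e0) := hc.
  apply: filterS => n /= hn; apply: He => //=.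
exact: (cvg_comp _ _ hr H).
Qed.

Let D'K t w : a <= t < b -> `|D' t w| <= K.
Proof.
move=> /andP[at_ tb]; have bt0 : 0 < b - t by rewrite subr_gt0.
case: hD => _ _ L /(_ t w); rewrite at_ tb => /(_ isT) H.
have H' : `|(D (t + h) w - D t w) / h| @[h --> (0 : R)^'+] --> `|D' t w| by exact: cvg_norm H.
suff h : \forall h \near (0 : R)^'+, [set y : R | y <= K] `|(D (t + h) w - D t w) / h|.
  exact: (closed_cvg _ (@closed_le R K) h _ H').
near=> h; rewrite /=.
have h0 : 0 < h by near: h; exact: nbhs_right_gt.
have hb : h < b - t by near: h; exact: nbhs_right_lt.
rewrite normrM normfV (gtr0_norm h0) ler_pdivrMr//.
have := L t (t + h) w at_; rewrite lerDl (ltW h0) [t + h - t]addrAC subrr add0r.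
by apply => //; lra.
Unshelve. all: by end_near. Qed.

Let q t (i : nat) w : R := X t w ^+ i * (f (i%:R * eps) * Z t w * D t w + D' t w).

Let iq t i : a <= t < b -> P.-integrable setT (EFin \o q t i).
Proof.
move=> tab; have /andP[at_ tb] := tab; have t0 := le_trans a0 at_.
have tab' : a <= t <= b by rewrite at_ ltW.
have qb w : `|X t w ^+ i * (f (i%:R * eps) * Z t w * D t w)| <=
    `|f (i%:R * eps)| * (i%:R * eps)^-1 * K.
  case: i => [|i]; first by rewrite mul0r f0 normr0 !mul0r mulr0 normr0.
  have e0 : 0 < i.+1%:R * eps by rewrite mulr_gt0.
  rewrite (_ : _ * _ = f (i.+1%:R * eps) * (Z t w * X t w ^+ i.+1) * D t w); last by ring.
  rewrite normrM; apply: ler_pM => //; last by case: hD => _ H _ _; exact: H.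
  rewrite normrM; apply: ler_wpM2l => //.
  rewrite ger0_norm ?mulr_ge0 ?Z0 ?exprn_ge0 ?expR_ge0//.
  by rewrite Xi mul_expRN_le.
apply: (probability_bounded_integrable P
  (K := `|f (i%:R * eps)| * (i%:R * eps)^-1 * K + K)).
  apply: measurable_funM; first by apply: measurable_funX; exact: mX.
  apply: measurable_funD; last exact: mD'.
  apply: measurable_funM; last exact: mD.
  apply: measurable_funM; first exact: measurable_cst.
  by case: hZ => mZ _ _ _; exact: mZ.
move=> w; rewrite /q mulrDr; apply: (le_trans (ler_normD _ _)); apply: lerD => //.
rewrite normrM -[leRHS]mul1r; apply: ler_pM => //; last exact: D'K.
have /andP[h0 h1] := X01 w t0.
by rewrite ger0_norm ?exprn_ge0// exprn_ile1.
Qed.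

Let derivativeE t w :
  Z t w * (\sum_(i < size p) p`_i * X t w ^+ i * f (i%:R * eps)) * D t w + p.[X t w] * D' t w =
  \sum_(i < size p) p`_i * q t i w.
Proof.
rewrite horner_coef mulr_sumr !mulr_suml -big_split/=.
by apply: eq_bigr => i _; rewrite /q; ring.
Qed.

Let iP t (i : nat) : a <= t < b -> P.-integrable setT (EFin \o (fun w => p`_i * q t i w)).
Proof. by move=> tab; apply: eq_integrable (integrableZl measurableT p`_i (iq i tab)). Qed.

Lemma poly_derivative_integrable t : a <= t < b -> P.-integrable setT (EFin \o
  (fun w => Z t w * (\sum_(i < size p) p`_i * X t w ^+ i * f (i%:R * eps)) * D t w +
            p.[X t w] * D' t w)).
Proof.
move=> tab.
have H : P.-integrable setT (fun w => \sum_(i < size p) (p`_i * q t i w)%:E)%E.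
  by apply: integrable_sum => // i _; exact: iP.
by apply: eq_integrable H => // w _ /=; rewrite derivativeE sumEFin.
Qed.

Lemma poly_functional_rderive t : a <= t < b ->
  is_rderive (fun t => \int[P]_w (D t w * p.[X t w])) t
    (\int[P]_w (Z t w * (\sum_(i < size p) p`_i * X t w ^+ i * f (i%:R * eps)) * D t w +
                p.[X t w] * D' t w)).
Proof.
move=> tab; have /andP[at_ tb] := tab; have t0 := le_trans a0 at_.
have tab' : a <= t <= b by rewrite at_ ltW.
have phid i : is_rderive (phi i) t (\int[P]_w q t i w).
  case: i => [|i].
    rewrite (_ : phi 0 = fun t => \int[P]_w D t w); last first.
      by apply/funext => s; apply: eq_Rintegral => w _; rewrite expr0 mulr1.
    rewrite (_ : \int[P]_w q t 0 w = \int[P]_w D' t w); first exact: factor_rderive.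
    by apply: eq_Rintegral => w _; rewrite /q expr0 mul0r f0 !mul0r add0r mul1r.
  have e0 : 0 < i.+1%:R * eps by rewrite mulr_gt0.
  rewrite (_ : phi i.+1 = fun t => \int[P]_w (D t w * expR (- (i.+1%:R * eps) * Z t w))); last first.
    by apply/funext => s; apply: eq_Rintegral => w _; rewrite Xi.
  rewrite (_ : \int[P]_w q t i.+1 w = \int[P]_w (expR (- (i.+1%:R * eps) * Z t w) *
      ((f (i.+1%:R * eps) - 0) * Z t w * D t w + D' t w))); last first.
    by apply: eq_Rintegral => w _; rewrite /q Xi subr0.
  apply: (functional_rderive hZ hu a0 e0 hD (v := fun=> i.+1%:R * eps) (v' := fun=> 0)) => //.
  by move=> s _; exact: rderive_cst.
have H : is_rderive (fun t => \sum_(i < size p) p`_i * phi i t) t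
    (\sum_(i < size p) p`_i * \int[P]_w q t i w).
  have dphi (i : nat) : is_rderive (fun t => p`_i * phi i t) t (p`_i * \int[P]_w q t i w).
    exact: rderiveZ.
  exact: (rderive_sum dphi).
rewrite (_ : \int[P]_w _ = \sum_(i < size p) p`_i * \int[P]_w q t i w).
  rewrite /is_rderive (phiE tab').
  apply: (cvg_trans _ H); apply: near_eq_cvg; near=> h; rewrite phiE//.
  have h0 : 0 < h by near: h; exact: nbhs_right_gt.
  have hb : h < b - t by near: h; apply: nbhs_right_lt; rewrite subr_gt0.
  by apply/andP; split; lra.
transitivity (\int[P]_w (\sum_(i < size p) p`_i * q t i w)).
  by apply: eq_Rintegral => w _; rewrite derivativeE.
rewrite (Rintegral_sum (size p) (f := fun (i : nat) w => p`_i * q t i w))//; last first.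
  by move=> i; exact: iP.
by apply: eq_bigr => i _; rewrite RintegralZl//; exact: iq.
Unshelve. all: by end_near. Qed.

End polynomial_functional.

(** * Polynomial approximations of an increasing exponential *)

Section saturation.
Context (R : realType).

(** A bounded concave substitute for [z], linear in [expR (- eps * z)]. *)
Definition saturation (eps z : R) : R := (1 - expR (- eps * z)) / eps.

Lemma saturation_le (eps z : R) : 0 < eps -> saturation eps z <= z.
Proof.
move=> e0; rewrite /saturation ler_pdivrMr//.
by have := expR_ge1Dx (- eps * z); lra.
Qed.

Lemma saturation_ge (eps z : R) : 0 < eps -> z * expR (- eps * z) <= saturation eps z.
Proof.
move=> e0; rewrite /saturation ler_pdivlMr//.
by have := expR_sub1_le (- eps * z); lra.
Qed.

Lemma saturation_ge0 (eps z : R) : 0 < eps -> 0 <= z -> 0 <= saturation eps z.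
Proof.
move=> e0 z0; apply: le_trans (saturation_ge z e0); exact: mulr_ge0 z0 (expR_ge0 _).
Qed.

Lemma harmonic_cvg0 : (n.+1%:R^-1 : R) @[n --> \oo] --> (0 : R).
Proof. exact: cvg_harmonic. Qed.

Lemma expR_harmonic_cvg (z : R) : expR (- n.+1%:R^-1 * z) @[n --> \oo] --> (1 : R).
Proof.
rewrite -[X in _ --> X]expR0 -(mul0r z) -oppr0.
apply: continuous_cvg; first exact: continuous_expR.
apply: cvgMr_tmp; apply: cvgN; exact: harmonic_cvg0.
Qed.

Lemma saturation_cvg (z : R) : 0 <= z -> saturation n.+1%:R^-1 z @[n --> \oo] --> z.
Proof.
move=> z0; have e0 n : (0 : R) < n.+1%:R^-1 by rewrite invr_gt0.
have H : (z * expR (- n.+1%:R^-1 * z)) @[n --> \oo] --> z.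
  rewrite -[X in _ --> X]mulr1; apply: cvgMl_tmp; exact: expR_harmonic_cvg.
apply: (squeeze_cvgr _ H (cvg_cst z)).
by apply: nearW => n; rewrite saturation_ge//= saturation_le.
Qed.

Lemma pow_le_expR (y : R) (N : nat) : 0 <= y -> (1 + y) ^+ N <= expR (N%:R * y).
Proof.
move=> y0; rewrite expRM_natl; apply: lerXn2r; rewrite ?nnegrE ?expR_ge0 ?addr_ge0//.
exact: expR_ge1Dx.
Qed.

Lemma bernoulli (y : R) (N : nat) : 0 <= y -> 1 + N%:R * y <= (1 + y) ^+ N.
Proof.
move=> y0; elim: N => [|N ih]; first by rewrite mul0r addr0 expr0.
rewrite exprS; have := ler_wpM2l (addr_ge0 ler01 y0) ih; apply: le_trans.
rewrite -natr1 -subr_ge0 (_ : _ - _ = N%:R * y ^+ 2); last by ring.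
by rewrite mulr_ge0 ?sqr_ge0.
Qed.

(** Since [1 + y] lies between [expR (y / (1 + y))] and [expR y]. *)
Lemma pow_cvg_expR (y : nat -> R) (N : nat -> nat) (x : R) :
  (forall n, 0 <= y n) -> y n @[n --> \oo] --> (0 : R) ->
  (N n)%:R * y n @[n --> \oo] --> x ->
  (1 + y n) ^+ N n @[n --> \oo] --> expR x.
Proof.
move=> y0 yc Nc; have cE := continuous_cvg _ (@continuous_expR R _).
have H1 : expR ((N n)%:R * y n) @[n --> \oo] --> expR x by exact: cE.
have H2 : expR ((N n)%:R * y n / (1 + y n)) @[n --> \oo] --> expR x.
  apply: cE; rewrite -[X in _ --> X]divr1; apply: cvgM => //.
  have yc1 : 1 + y n @[n --> \oo] --> (1 : R).
    by rewrite -[X in _ --> X]addr0; apply: cvgD => //; exact: cvg_cst.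
  exact: cvgV (oner_neq0 _) yc1.
apply: (squeeze_cvgr _ H2 H1); apply: nearW => n; rewrite pow_le_expR// andbT.
have p0 : 0 < 1 + y n by rewrite ltr_wpDr.
rewrite -mulrA expRM_natl; apply: lerXn2r; rewrite ?nnegrE ?expR_ge0 ?(ltW p0)//.
have := expR_ge1Dx (- (y n / (1 + y n))); rewrite expRN => h.
rewrite -[leRHS]invrK -[leLHS]invrK lef_pV2 ?posrE ?invr_gt0 ?expR_gt0//.
apply: le_trans h; rewrite le_eqVlt; apply/orP; left; apply/eqP.
by field; rewrite gt_eqF.
Qed.

End saturation.

Section tilt_polynomial.
Context (R : realType).
Implicit Types (c e : R) (p q : {poly R}) (N : nat).

Lemma eulerM p q : euler (p * q) = euler p * q + p * euler q.
Proof. by rewrite /euler derivM; ring. Qed.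

Lemma eulerD p q : euler (p + q) = euler p + euler q.
Proof. by rewrite /euler derivD; ring. Qed.

Lemma eulerZX c : euler (c *: 'X) = c *: 'X :> {poly R}.
Proof. by rewrite /euler derivZ derivX -scalerAr mulr1. Qed.

Definition tilt_base c : {poly R} := 1 + c *: (1 - 'X).

Lemma horner_tilt_base c e : (tilt_base c).[e] = 1 + c * (1 - e).
Proof. by rewrite /tilt_base !hornerE. Qed.

Lemma euler_tilt_base c : euler (tilt_base c) = (- c) *: 'X.
Proof.
rewrite /tilt_base /euler derivD derivZ derivB derivX -[1]/(1%:P) derivC.
by rewrite add0r sub0r scalerN mulrN -scalerAr mulr1 scaleNr.
Qed.

Lemma euler_tilt_pow c N e : 1 + c * (1 - e) != 0 ->
  (euler (tilt_base c ^+ N)).[e] =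
  - (N%:R * (c * e / (1 + c * (1 - e)))) * (1 + c * (1 - e)) ^+ N.
Proof.
move=> A0; elim: N => [|N ih].
  by rewrite expr0 /euler -[1]/(1%:P) derivC mulr0 horner0 mul0r oppr0 mul0r.
rewrite !exprS eulerM hornerD (hornerM (euler _)) (hornerM (tilt_base _)) ih.
rewrite horner_exp euler_tilt_base hornerZ hornerX.
rewrite horner_tilt_base -natr1; set A := 1 + _ in A0 *; field.
exact: A0.
Qed.

Lemma euler2_tilt_pow c N e : 1 + c * (1 - e) != 0 ->
  (euler (euler (tilt_base c ^+ N))).[e] =
  (N%:R * (N%:R - 1) * (c * e / (1 + c * (1 - e))) ^+ 2 -
   N%:R * (c * e / (1 + c * (1 - e)))) * (1 + c * (1 - e)) ^+ N.
Proof.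
move=> A0; elim: N => [|N ih].
  by rewrite expr0 /euler -[1]/(1%:P) derivC mulr0 -[0]/(0%:P) derivC mulr0 horner0; ring.
rewrite !exprS eulerM eulerD (eulerM (euler _)) (eulerM (tilt_base _)).
rewrite !hornerD (hornerM (euler (euler _))).
rewrite (hornerM (euler _)) (hornerM (tilt_base _)) ih euler_tilt_pow//.
rewrite horner_exp euler_tilt_base eulerZX hornerZ hornerX.
rewrite horner_tilt_base -natr1; set A := 1 + _ in A0 *; field.
exact: A0.
Qed.

End tilt_polynomial.

Section tilt_estimates.
Context (R : realType) (alpha beta : R) (pi : {measure set R -> \bar R}) (theta : R).
Hypothesis hbeta : 0 <= beta.
Hypothesis hpi : levy_measure pi.
Hypothesis theta0 : 0 < theta.
Hypothesis htheta : theta != 0 ->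
  (\int[pi]_(l in `]1%R, +oo[) (l * expR (theta * l))%:E < +oo)%E.

Local Notation Psi := (psi alpha beta pi).
Local Notation G := (levy_dominator theta).
Local Notation eps n := (n.+1%:R^-1 : R).

Let eps0 n : 0 < eps n. Proof. by rewrite invr_gt0. Qed.
Let eps1 n : eps n <= 1. Proof. by rewrite invf_le1// ler1n. Qed.
Let epsN n : (n.+1 ^ 2)%:R * eps n ^+ 2 = 1 :> R.
Proof. by rewrite natrX -exprMn divff ?expr1n// pnatr_eq0. Qed.

Let scale n (b s : R) : (n.+1 ^ 2)%:R * (b * eps n ^+ 2 * s) = b * s.
Proof.
rewrite (_ : b * eps n ^+ 2 * s = eps n ^+ 2 * (b * s)); last by ring.
by rewrite mulrA epsN mul1r.
Qed.

Let mpos : measurable (`]0, +oo[%classic : set R) := measurable_itv _.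

(** [tilt n] evaluated at [expR (- z / n)] tends to [expR (theta * z)]. *)
Definition tilt (n : nat) : {poly R} := tilt_base (theta * eps n) ^+ (n.+1 ^ 2).

(** The logarithmic derivative in [z] of the approximation, as a function of
[e = expR (- z / n)]. *)
Definition tilt_slope (n : nat) (e : R) : R :=
  theta * e / (1 + theta * eps n * (1 - e)).

Definition tilt_jump (n : nat) (b l : R) : R :=
  (1 + b * eps n ^+ 2 * saturation (eps n) l) ^+ (n.+1 ^ 2) - 1 - b * l * (l <= 1)%R%:R.

(** The generator applied to the approximation, divided by [z] and by the
approximation itself; the limit is [psi (- theta)]. *)
Definition tilt_rate (n : nat) (e : R) : R :=
  - alpha * tilt_slope n e +
  beta * ((1 - eps n ^+ 2) * tilt_slope n e ^+ 2 - eps n * tilt_slope n e) +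
  \int[pi]_(l in `]0, +oo[) tilt_jump n (tilt_slope n e) l.

Let denom n (e : R) : e <= 1 -> 1 <= 1 + theta * eps n * (1 - e).
Proof. by move=> e1; rewrite lerDl mulr_ge0 ?subr_ge0// ltW// mulr_gt0. Qed.

Let denom0 n (e : R) : e <= 1 -> 1 + theta * eps n * (1 - e) != 0.
Proof. by move=> e1; rewrite gt_eqF// (lt_le_trans ltr01)// denom. Qed.

Lemma tilt_slope_ge0 n e : 0 <= e <= 1 -> 0 <= tilt_slope n e.
Proof.
move=> /andP[e0 e1]; rewrite divr_ge0 ?mulr_ge0 ?(ltW theta0)//.
exact: le_trans ler01 (denom n e1).
Qed.

Lemma tilt_slope_le n e : 0 <= e <= 1 -> tilt_slope n e <= theta * e.
Proof.
move=> /andP[e0 e1]; rewrite ler_pdivrMr; last exact: lt_le_trans ltr01 (denom n e1).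
by rewrite ler_peMr ?denom// mulr_ge0// ltW.
Qed.

Lemma tilt_slope_le_theta n e : 0 <= e <= 1 -> tilt_slope n e <= theta.
Proof.
move=> e01; apply: (le_trans (tilt_slope_le n e01)).
by rewrite ler_piMr// ?(ltW theta0)//; case/andP: e01.
Qed.

Lemma horner_tilt n e : (tilt n).[e] = (1 + theta * eps n * (1 - e)) ^+ (n.+1 ^ 2).
Proof. by rewrite /tilt horner_exp horner_tilt_base. Qed.

Lemma tilt_gt0 n e : e <= 1 -> 0 < (tilt n).[e].
Proof. by move=> e1; rewrite horner_tilt exprn_gt0// (lt_le_trans ltr01)// denom. Qed.

Lemma tilt_saturation n z : (tilt n).[expR (- eps n * z)] =
  (1 + theta * eps n ^+ 2 * saturation (eps n) z) ^+ (n.+1 ^ 2).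
Proof.
rewrite horner_tilt; congr ((1 + _) ^+ _); rewrite /saturation.
by move: (eps n) (lt0r_neq0 (eps0 n)) => d d0; field.
Qed.

Let jump_pow n (b l : R) : 0 <= b -> 0 <= l ->
  1 + b * saturation (eps n) l <=
    (1 + b * eps n ^+ 2 * saturation (eps n) l) ^+ (n.+1 ^ 2) <=
  expR (b * saturation (eps n) l).
Proof.
move=> b0 l0; have s0 := saturation_ge0 (eps0 n) l0.
have y0 : 0 <= b * eps n ^+ 2 * saturation (eps n) l.
  by apply: mulr_ge0 s0; apply: mulr_ge0 b0 (sqr_ge0 _).
have E := scale n b (saturation (eps n) l).
by rewrite -E bernoulli// pow_le_expR.
Qed.

Lemma tilt_le n z : 0 <= z ->
  (tilt n).[expR (- eps n * z)] <= expR (theta * saturation (eps n) z).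
Proof. by move=> z0; rewrite tilt_saturation; case/andP: (jump_pow n (ltW theta0) z0). Qed.

Let pow_sat_cvg (b : nat -> R) (bb l : R) : 0 <= l -> (forall n, 0 <= b n) ->
  b n @[n --> \oo] --> bb ->
  (1 + b n * eps n ^+ 2 * saturation (eps n) l) ^+ (n.+1 ^ 2) @[n --> \oo] --> expR (bb * l).
Proof.
move=> l0 b0 bc; have sc := saturation_cvg l0.
have bs : b n * saturation (eps n) l @[n --> \oo] --> bb * l by exact: cvgM.
have e2 : eps n ^+ 2 @[n --> \oo] --> (0 : R).
  by rewrite -(mulr0 0); apply: cvgM; exact: harmonic_cvg0.
apply: pow_cvg_expR.
- move=> n; apply: mulr_ge0 (saturation_ge0 (eps0 n) l0).
  exact: mulr_ge0 (b0 n) (sqr_ge0 _).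
- rewrite (_ : (fun n => _) = fun n => eps n ^+ 2 * (b n * saturation (eps n) l)); last first.
    by apply/funext => n; ring.
  by rewrite -[X in _ --> X](mul0r (bb * l)); exact: cvgM.
- rewrite (_ : (fun n => _) = fun n => b n * saturation (eps n) l)//.
  by apply/funext => n; rewrite scale.
Qed.

Lemma tilt_cvg z : 0 <= z ->
  (tilt n).[expR (- eps n * z)] @[n --> \oo] --> expR (theta * z).
Proof.
move=> z0; rewrite (_ : (fun n => _) =
    fun n => (1 + theta * eps n ^+ 2 * saturation (eps n) z) ^+ (n.+1 ^ 2)); last first.
  by apply/funext => n; rewrite tilt_saturation.
apply: (pow_sat_cvg (b := fun=> theta)) => //; first by move=> _; exact: ltW.
exact: cvg_cst.
Qed.

(** The factor [b], which is at most [theta * e], is what makes [z * tilt_rate]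
bounded by a multiple of [saturation]. *)
Lemma tilt_jump_bound n b l : 0 <= b <= theta -> 0 < l ->
  `|tilt_jump n b l| <= b * (theta * expR theta + 1) * G l.
Proof.
move=> /andP[b0 bt] l0; have l00 := ltW l0.
have s0 := saturation_ge0 (eps0 n) l00; have sl := saturation_le l (eps0 n).
have /andP[r1 r2] := jump_pow n b0 l00.
have bs := ler_wpM2l b0 sl.
have {}r2 := le_trans r2 (_ : _ <= expR (b * l)); rewrite ler_expR in r2.
have {}r2 := r2 bs; move: r1 r2; rewrite /tilt_jump; set r := (_ ^+ _) => r1 r2.
have K0 : 0 <= theta * expR theta by rewrite mulr_ge0 ?expR_ge0 ?ltW.
have Eb := expR_sub1_le (b * l).
have [l1|l1] := leP l 1.
  have l2 : Num.min 1 (l ^+ 2) = l ^+ 2 by rewrite min_r// expr_le1.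
  have GE : G l = l ^+ 2 by rewrite /levy_dominator l2 [1 < l]ltNge l1 mulr0 mul0r addr0.
  rewrite mulr1 GE.
  have bl : expR (b * l) <= expR theta.
    by rewrite ler_expR (le_trans _ bt)// ler_piMr.
  have up : expR (b * l) - 1 - b * l <= b * (theta * expR theta) * l ^+ 2.
    have h := expR_taylor2 (b * l); rewrite ger0_norm in h; last first.
      by have := expR_ge1Dx (b * l); lra.
    apply: (le_trans h); rewrite ger0_norm ?mulr_ge0//.
    rewrite (_ : (b * l) ^+ 2 * _ = b * l ^+ 2 * (b * expR (b * l))); last by ring.
    rewrite [leRHS](_ : _ = b * l ^+ 2 * (theta * expR theta)); last by ring.
    rewrite ler_wpM2l ?mulr_ge0 ?sqr_ge0//.
    by apply: ler_pM => //; exact: expR_ge0.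
  have lo : b * (l - saturation (eps n) l) <= b * l ^+ 2.
    rewrite ler_wpM2l//; have h := saturation_ge l (eps0 n).
    have h1 := expR_ge1Dx (- eps n * l); have h2 := ler_wpM2l l00 h1.
    have h3 : eps n * l ^+ 2 <= l ^+ 2 by rewrite ler_piMl ?sqr_ge0.
    rewrite (_ : l * (1 + - eps n * l) = l - eps n * l ^+ 2) in h2; last by ring.
    move: (le_trans h2 h) h3; set s := saturation _ _; set y := _ * _ ^+ 2 => h5 h6.
    by apply: le_trans h6; rewrite lerBlDr -lerBlDl.
  have P1 : 0 <= b * l ^+ 2 by rewrite mulr_ge0 ?sqr_ge0.
  have P2 : 0 <= b * (theta * expR theta) * l ^+ 2 by apply: mulr_ge0 (sqr_ge0 _); exact: mulr_ge0 b0 K0.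
  by rewrite ler_norml; apply/andP; split; lra.
have G1 : l * expR (theta * l) <= G l.
  rewrite /levy_dominator l1 (gt_eqF theta0) mul1r mul1r lerDr.
  by rewrite le_min ler01 sqr_ge0.
have up : expR (b * l) - 1 <= b * G l.
  apply: (le_trans Eb); rewrite -mulrA ler_wpM2l//; apply: le_trans G1.
  by rewrite ler_wpM2l// ler_expR ler_wpM2r.
have P1 : 0 <= b * (theta * expR theta) * G l.
  by apply: mulr_ge0; [exact: mulr_ge0 b0 K0|exact: levy_dominator_ge0].
have P2 : 0 <= b * saturation (eps n) l by rewrite mulr_ge0.
by rewrite mulr0 subr0 ler_norml; apply/andP; split; lra.
Qed.

Lemma measurable_tilt_jump n b (D : set R) : measurable_fun D (tilt_jump n b).
Proof.
have m : measurable_fun D (levy_integrand (eps n)) by exact: measurable_levy_integrand.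
have mi : measurable_fun D (fun l : R => (l <= 1)%R%:R : R).
  rewrite (_ : (fun l => _) = \1_(`]-oo, 1] : set R)); first exact: measurable_indic.
  apply/funext => l; rewrite indicE; congr ((nat_of_bool _)%:R).
  by apply/idP/idP => [h|/set_mem]; [apply/mem_set|]; rewrite /= in_itv.
have mid : measurable_fun D (fun l : R => l) by exact: measurable_id.
apply: measurable_funB; last first.
  by apply: measurable_funM => //; apply: measurable_funM => //; exact: measurable_cst.
apply: measurable_funB; last exact: measurable_cst.
apply: measurable_funX; apply: measurable_funD; first exact: measurable_cst.
apply: measurable_funM; first exact: measurable_cst.
apply: measurable_funM; last exact: measurable_cst.
apply: measurable_funB; first exact: measurable_cst.
apply: measurableT_comp; first exact: measurable_expR.
by apply: measurable_funM => //; exact: measurable_cst.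
Qed.

Let iG : pi.-integrable `]0, +oo[ (EFin \o G).
Proof. exact: levy_dominator_integrable. Qed.

Let iGZ (c : R) : pi.-integrable `]0, +oo[ (EFin \o (fun l => c * G l)).
Proof. by apply: eq_integrable (integrableZl mpos c iG). Qed.

Lemma tilt_jump_integrable n b : 0 <= b <= theta ->
  pi.-integrable `]0, +oo[ (EFin \o tilt_jump n b).
Proof.
move=> b01; apply: dominated_integrable_real (iGZ (b * (theta * expR theta + 1))) _ => //.
  exact: measurable_tilt_jump.
by move=> l /=; rewrite in_itv/= andbT; exact: tilt_jump_bound.
Qed.

Definition tilt_rate_const : R :=
  theta * (`|alpha| + beta * (theta + 1) +
           (theta * expR theta + 1) * \int[pi]_(l in `]0, +oo[) G l).

Let IG0 : 0 <= \int[pi]_(l in `]0, +oo[) G l.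
Proof. by apply: Rintegral_ge0 => l /=; rewrite in_itv/= andbT; exact: levy_dominator_ge0. Qed.

Lemma tilt_rate_const_ge0 : 0 <= tilt_rate_const.
Proof.
apply: mulr_ge0 (ltW theta0) _; apply: addr_ge0.
  apply: addr_ge0 => //; apply: mulr_ge0 => //; exact: addr_ge0 (ltW theta0) ler01.
apply: mulr_ge0 IG0; apply: addr_ge0 ler01.
exact: mulr_ge0 (ltW theta0) (expR_ge0 _).
Qed.

Lemma tilt_rate_bound n e : 0 <= e <= 1 -> `|tilt_rate n e| <= tilt_rate_const * e.
Proof.
move=> e01; have b0 := tilt_slope_ge0 n e01; have be := tilt_slope_le n e01.
have bt := tilt_slope_le_theta n e01; have /andP[e0 e1] := e01.
have b01 : 0 <= tilt_slope n e <= theta by rewrite b0.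
rewrite /tilt_rate; set b := tilt_slope n e in b0 be bt b01 *.
have K0 : 0 <= theta * expR theta + 1 by rewrite addr_ge0// mulr_ge0 ?expR_ge0 ?ltW.
have I : `|\int[pi]_(l in `]0, +oo[) tilt_jump n b l| <=
    theta * e * ((theta * expR theta + 1) * \int[pi]_(l in `]0, +oo[) G l).
  apply: (le_trans (le_normr_Rintegral mpos (tilt_jump_integrable n b01))).
  rewrite mulrA -RintegralZl//; apply: le_Rintegral => //.
  - exact: integrable_norm (tilt_jump_integrable n b01).
  - move=> l /=; rewrite in_itv/= andbT => l0.
    apply: (le_trans (tilt_jump_bound n b01 l0)); rewrite ler_wpM2r ?levy_dominator_ge0//.
    by rewrite ler_wpM2r.
have A1 : `|- alpha * b| <= `|alpha| * (theta * e).
  by rewrite normrM normrN ler_wpM2l// ger0_norm.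
have e2 : 0 <= eps n ^+ 2 <= 1 by rewrite exprn_ge0 ?(ltW (eps0 n))//= expr_le1// ltW.
have A2 : `|beta * ((1 - eps n ^+ 2) * b ^+ 2 - eps n * b)| <= beta * (theta + 1) * (theta * e).
  rewrite normrM (ger0_norm hbeta) -mulrA ler_wpM2l//.
  apply: (le_trans (ler_normB _ _)); rewrite [leRHS]mulrDl [X in _ <= _ + X]mul1r; apply: lerD.
    have /andP[h1 h2] := e2.
    rewrite ger0_norm; last by rewrite mulr_ge0 ?subr_ge0 ?sqr_ge0.
    apply: (@le_trans _ _ (b ^+ 2)); first by rewrite ler_piMl ?sqr_ge0// lerBlDr lerDl.
    by rewrite expr2; apply: ler_pM.
  rewrite ger0_norm; last exact: mulr_ge0 (ltW (eps0 n)) b0.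
  apply: le_trans be.
  by rewrite ler_piMl.
apply: (le_trans (ler_normD _ _)); apply: (le_trans (lerD (ler_normD _ _) (lexx _))).
rewrite /tilt_rate_const; move: I A1 A2; set J := \int[_]_(_ in _) G _.
by move=> I A1 A2; apply: (le_trans (lerD (lerD A1 A2) I)); rewrite le_eqVlt; apply/orP; left; apply/eqP; ring.
Qed.

Lemma tilt_generator n e : 0 <= e <= 1 ->
  \sum_(i < size (tilt n)) (tilt n)`_i * e ^+ i * Psi (i%:R * eps n) =
  (tilt n).[e] * tilt_rate n e.
Proof.
move=> e01; have /andP[e0 e1] := e01.
have b01 : 0 <= tilt_slope n e <= theta by rewrite tilt_slope_ge0// tilt_slope_le_theta.
have A0 := denom0 n e1.
have eE : eps n * (n.+1%:R : R) = 1 by rewrite mulVf// pnatr_eq0.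
have J l : jump_term (eps n) e (tilt n) l = (tilt n).[e] * tilt_jump n (tilt_slope n e) l.
  rewrite /jump_term /tilt euler_tilt_pow// -/(tilt n) !horner_tilt.
  rewrite (_ : 1 + theta * eps n * (1 - e * expR (- eps n * l)) =
    (1 + theta * eps n * (1 - e)) *
    (1 + tilt_slope n e * eps n ^+ 2 * saturation (eps n) l)); last first.
    rewrite /tilt_slope /saturation; move: (eps n) A0 (lt0r_neq0 (eps0 n)) => d A0 d0.
    by field; rewrite A0 d0.
  rewrite exprMn /tilt_jump natrX /tilt_slope.
  set r := (1 + _ * saturation _ _) ^+ _; clearbody r.
  set AN := (1 + _ * (1 - e)) ^+ _; clearbody AN.
  have m0 : n.+1%:R != 0 :> R by rewrite pnatr_eq0.
  set A := (1 + _ * (1 - e)) in A0 *; clearbody A.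
  move: (n.+1%:R) m0 => m m0; field.
  by rewrite A0 m0.
rewrite (polynomial_generatorE alpha beta hpi (ltW (eps0 n))).
under eq_Rintegral do rewrite J.
rewrite RintegralZl//; last exact: tilt_jump_integrable.
rewrite /tilt euler_tilt_pow// euler2_tilt_pow// -/(tilt n) !horner_tilt /tilt_rate.
set I := Rintegral _ _ _; clearbody I; rewrite natrX /tilt_slope.
set AN := (1 + _ * (1 - e)) ^+ _; clearbody AN.
have m0 : n.+1%:R != 0 :> R by rewrite pnatr_eq0.
set A := (1 + _ * (1 - e)) in A0 *; clearbody A.
clear eE J b01; move: (n.+1%:R) m0 => m m0; field.
by rewrite A0 m0.
Qed.

Lemma tilt_rate_cvg (e : nat -> R) : (forall n, 0 <= e n <= 1) ->
  e n @[n --> \oo] --> (1 : R) -> tilt_rate n (e n) @[n --> \oo] --> Psi (- theta).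
Proof.
move=> e01 ec.
have e0c : eps n @[n --> \oo] --> (0 : R) by exact: harmonic_cvg0.
have e2c : eps n ^+ 2 @[n --> \oo] --> (0 : R).
  by rewrite -(mulr0 0); apply: cvgM; exact: harmonic_cvg0.
pose b n := tilt_slope n (e n).
have b01 n : 0 <= b n <= theta by rewrite tilt_slope_ge0// tilt_slope_le_theta.
have bc : b n @[n --> \oo] --> theta.
  have h1 : theta * e n @[n --> \oo] --> theta.
    by rewrite -[X in _ --> X]mulr1; apply: cvgMl_tmp.
  have h2 : 1 + theta * eps n * (1 - e n) @[n --> \oo] --> (1 : R).
    rewrite -[X in _ --> X]addr0; apply: cvgD; first exact: cvg_cst.
    have k1 : theta * eps n @[n --> \oo] --> theta * 0 by apply: cvgMl_tmp.
    have k2 : 1 - e n @[n --> \oo] --> (1 - 1 : R) by apply: cvgB => //; exact: cvg_cst.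
    by have k := cvgM k1 k2; rewrite mulr0 mul0r in k; exact: k.
  have h3 : (1 + theta * eps n * (1 - e n))^-1 @[n --> \oo] --> (1^-1 : R).
    exact: cvgV (oner_neq0 _) h2.
  by have h4 := cvgM h1 h3; rewrite invr1 mulr1 in h4; exact: h4.
have Ic : \int[pi]_(l in `]0, +oo[) tilt_jump n (b n) l @[n --> \oo] -->
    \int[pi]_(l in `]0, +oo[) levy_integrand (- theta) l.
  apply: (Rintegral_dominated_cvg (g := fun l => theta * (theta * expR theta + 1) * G l)) => //.
  - by move=> n; exact: measurable_tilt_jump.
  - move=> l /=; rewrite in_itv/= andbT => l0; rewrite /tilt_jump /levy_integrand.
    rewrite opprK mulNr mulNr; apply: cvgB; last by apply: cvgMr_tmp; exact: cvgMr_tmp.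
    apply: cvgB; last exact: cvg_cst.
    by apply: pow_sat_cvg => //; [exact: ltW|by move=> n; case/andP: (b01 n)].
  - move=> n l /=; rewrite in_itv/= andbT => l0.
    apply: (le_trans (tilt_jump_bound n (b01 n) l0)).
    rewrite ler_wpM2r ?levy_dominator_ge0// ler_wpM2r//; last by case/andP: (b01 n).
    by apply: addr_ge0 ler01; exact: mulr_ge0 (ltW theta0) (expR_ge0 _).
rewrite /psi -/(levy_integrand _ _) /tilt_rate.
apply: cvgD; last exact: Ic.
apply: cvgD; first by rewrite mulrN -mulNr; exact: cvgMl_tmp.
apply: cvgMl_tmp; rewrite sqrrN.
have h1 : (1 - eps n ^+ 2) * b n ^+ 2 @[n --> \oo] --> theta ^+ 2.
  rewrite -[X in _ --> X]mul1r; apply: cvgM; last by apply: cvgM.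
  by rewrite -[X in _ --> X]subr0; apply: cvgB => //; exact: cvg_cst.
have h2 : eps n * b n @[n --> \oo] --> (0 : R).
  by rewrite -(mul0r theta); apply: cvgM.
by have h := cvgB h1 h2; rewrite subr0 in h; exact: h.
Qed.

Definition saturation_poly (n : nat) : {poly R} := n.+1%:R *: (1 - 'X).

Lemma horner_saturation_poly n z :
  (saturation_poly n).[expR (- eps n * z)] = saturation (eps n) z.
Proof. by rewrite /saturation_poly !hornerE /saturation invrK mulrC. Qed.

Lemma euler_saturation_poly n : euler (saturation_poly n) = (- n.+1%:R) *: 'X.
Proof.
have d1 : (1 : {poly R})^`() = 0 by exact: derivC.
rewrite /saturation_poly /euler derivZ derivB derivX d1.
by rewrite sub0r scalerN mulrN -scalerAr mulr1 scaleNr.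
Qed.

Definition saturation_const : R :=
  `|alpha| + beta * (2 * theta) +
  (theta * expR theta + 1) * \int[pi]_(l in `]0, +oo[) G l.

(** The drift of [saturation] under the measure with density built on [tilt n].
The jumps are now weighted by [expR (theta * l)], so the bound rests on the
integrability of [l * expR (theta * l)]; it is uniform in [n]. *)
Lemma tilt_saturation_generator n e : 0 <= e <= 1 ->
  \sum_(i < size (tilt n * saturation_poly n))
     (tilt n * saturation_poly n)`_i * e ^+ i * Psi (i%:R * eps n) -
  (saturation_poly n).[e] * ((tilt n).[e] * tilt_rate n e) <=
  saturation_const * (e * (tilt n).[e]).
Proof.
move=> e01; have /andP[e0 e1] := e01.
have b01 : 0 <= tilt_slope n e <= theta by rewrite tilt_slope_ge0// tilt_slope_le_theta.
have A0 := denom0 n e1; have p0 := tilt_gt0 n e1.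
have m0 : n.+1%:R != 0 :> R by rewrite pnatr_eq0.
set p := tilt n in p0 *; set g := saturation_poly n.
have gE x : g.[x] = n.+1%:R * (1 - x) by rewrite /g /saturation_poly !hornerE.
have egE : eps n * (euler g).[e] = - e.
  by rewrite euler_saturation_poly hornerZ hornerX mulrA mulrN mulVf// mulN1r.
have eegE : eps n ^+ 2 * (euler (euler g)).[e] = - (eps n * e).
  rewrite euler_saturation_poly eulerZX hornerZ hornerX; move: (n.+1%:R) m0 => m m0.
  by field.
have epE : eps n * (euler p).[e] = - (tilt_slope n e * p.[e]).
  rewrite /p euler_tilt_pow// horner_tilt natrX /tilt_slope.
  set AN := _ ^+ (n.+1 ^ 2)%N; clearbody AN; set A := (1 + _ * (1 - e)) in A0 *; clearbody A.
  clear b01 gE egE eegE; move: (n.+1%:R) m0 => m m0; field.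
  by rewrite A0 m0.
rewrite -tilt_generator// !(polynomial_generatorE alpha beta hpi (ltW (eps0 n))) -/p.
have D1 : (euler (p * g)).[e] = (euler p).[e] * g.[e] + p.[e] * (euler g).[e].
  by rewrite eulerM hornerD (hornerM (euler p)) (hornerM p).
have D2 : (euler (euler (p * g))).[e] =
    (euler (euler p)).[e] * g.[e] + 2 * ((euler p).[e] * (euler g).[e]) +
    p.[e] * (euler (euler g)).[e].
  rewrite eulerM eulerD (eulerM (euler p)) (eulerM p) !hornerD (hornerM (euler (euler p))).
  rewrite (hornerM (euler p) (euler g)) (hornerM p).
  by ring.
have ijt q : pi.-integrable `]0, +oo[ (EFin \o jump_term (eps n) e q).
  by apply: jump_term_integrable => //; exact: ltW.
have ijtg : pi.-integrable `]0, +oo[ (EFin \o (fun l => g.[e] * jump_term (eps n) e p l)).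
  by apply: eq_integrable (integrableZl mpos g.[e] (ijt p)).
have I : \int[pi]_(l in `]0, +oo[) jump_term (eps n) e (p * g) l -
    g.[e] * \int[pi]_(l in `]0, +oo[) jump_term (eps n) e p l <=
    (theta * expR theta + 1) * \int[pi]_(l in `]0, +oo[) G l * (e * p.[e]).
  have -> : g.[e] * \int[pi]_(l in `]0, +oo[) jump_term (eps n) e p l =
      \int[pi]_(l in `]0, +oo[) (g.[e] * jump_term (eps n) e p l) by rewrite RintegralZl.
  rewrite -RintegralB// mulrAC -RintegralZl//.
  apply: le_Rintegral => //; first exact: (integrableB mpos (ijt _) ijtg).
  move=> l /=; rewrite in_itv/= andbT => l0; have l00 := ltW l0.
  have pr : p.[e * expR (- eps n * l)] <= p.[e] * expR (theta * l).
    rewrite /p !horner_tilt -/p (_ : 1 + theta * eps n * (1 - e * expR (- eps n * l)) =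
      (1 + theta * eps n * (1 - e)) *
      (1 + tilt_slope n e * eps n ^+ 2 * saturation (eps n) l)); last first.
      rewrite /tilt_slope /saturation; move: (eps n) A0 (lt0r_neq0 (eps0 n)) => d A0 d0.
      by field; rewrite A0 d0.
    rewrite exprMn ler_wpM2l//; first by apply: exprn_ge0; exact: le_trans ler01 (denom n e1).
    have /andP[b0 bt] := b01; have /andP[_ h] := jump_pow n b0 l00.
    apply: (le_trans h); rewrite ler_expR; apply: ler_pM => //.
      exact: saturation_ge0.
    exact: saturation_le.
  have s0 := saturation_ge0 (eps0 n) l00; have sl := saturation_le l (eps0 n).
  have gd : g.[e * expR (- eps n * l)] - g.[e] = e * saturation (eps n) l.
    by rewrite !gE /saturation invrK; ring.
  rewrite (_ : jump_term _ _ _ _ - _ = p.[e * expR (- eps n * l)] *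
      (e * saturation (eps n) l) - l * (l <= 1)%R%:R * e * p.[e]); last first.
    rewrite -gd /jump_term D1 !(hornerM p g).
    rewrite (_ : l * (l <= 1)%R%:R * e * p.[e] =
      - (l * (l <= 1)%R%:R * p.[e] * (eps n * (euler g).[e]))); last by rewrite egE; ring.
    ring.
  have es0 := mulr_ge0 e0 s0.
  apply: (le_trans (lerB (ler_wpM2r es0 pr) (lexx _))).
  rewrite (_ : _ - _ = (expR (theta * l) * saturation (eps n) l - l * (l <= 1)%R%:R) *
    (e * p.[e])); last by ring.
  rewrite mulrAC ler_wpM2r//; first by rewrite mulr_ge0// ltW.
  apply: (@le_trans _ _ (expR (theta * l) * l - l * (l <= 1)%R%:R)).
    by rewrite lerD2r ler_wpM2l ?expR_ge0.
  have K0 : 0 <= theta * expR theta := mulr_ge0 (ltW theta0) (expR_ge0 _).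
  have [l1|l1] := leP l 1.
    have GE : G l = l ^+ 2.
      by rewrite /levy_dominator min_r ?expr_le1// [1 < l]ltNge l1 mulr0 mul0r addr0.
    rewrite GE mulr1; have h := expR_sub1_le (theta * l).
    have h2 : expR (theta * l) <= expR theta.
      by rewrite ler_expR ler_piMr// ltW.
    have h3 := ler_wpM2l (mulr_ge0 (ltW theta0) l00) h2.
    have h4 := ler_wpM2r l00 (le_trans h h3).
    have h5 : 0 <= l ^+ 2 by exact: sqr_ge0.
    rewrite -[X in _ - X]mul1r -mulrBl; apply: (le_trans h4).
    rewrite -subr_ge0 (_ : _ - _ = l ^+ 2)//; ring.
  rewrite mulr0 subr0 mulrC; apply: (@le_trans _ _ (G l)).
    rewrite /levy_dominator l1 (gt_eqF theta0) mul1r mul1r lerDr.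
    by rewrite le_min ler01 sqr_ge0.
  by rewrite ler_peMl ?levy_dominator_ge0// lerDr.
rewrite D1 D2; move: I; set J1 := Rintegral _ _ _; set J2 := Rintegral _ _ _ => I.
rewrite (_ : _ - _ = alpha * p.[e] * (eps n * (euler g).[e]) +
  beta * (2 * (eps n * (euler p).[e]) * (eps n * (euler g).[e]) +
          p.[e] * (eps n ^+ 2 * (euler (euler g)).[e])) +
  (J1 - g.[e] * J2)); last by ring.
rewrite egE epE eegE /saturation_const.
have ep0 : 0 <= e * p.[e] by rewrite mulr_ge0// ltW.
have I1 : alpha * p.[e] * - e <= `|alpha| * (e * p.[e]).
  rewrite (_ : alpha * p.[e] * - e = - alpha * (e * p.[e])); last by ring.
  by rewrite ler_wpM2r// -normrN ler_norm.
have I2 : beta * (2 * - (tilt_slope n e * p.[e]) * - e + p.[e] * - (eps n * e)) <=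
    beta * (2 * theta) * (e * p.[e]).
  rewrite (_ : _ + p.[e] * _ = (2 * tilt_slope n e - eps n) * (e * p.[e])); last by ring.
  rewrite mulrA ler_wpM2r// ler_wpM2l//; have /andP[_ bt] := b01.
  by rewrite lerBlDr; apply: ler_wpDr (ltW (eps0 n)) _; rewrite ler_pM2l.
by rewrite [leRHS]mulrDl [X in _ <= X + _]mulrDl; apply: lerD I; exact: lerD.
Qed.

End tilt_estimates.

(** * Uniform integrability *)

(** As [U n] dominates the logarithm of [X n], the bound on the means of
[X n * U n] makes the [X n] uniformly integrable: the part of [X n] above
[expR L] is at most [X n * U n / L]. *)
Lemma entropy_cvg (R : realType) d (T : measurableType d) (P : probability T R)
    (X U : nat -> T -> R) (X' Y : T -> R) (K : R) :
  (forall n, measurable_fun setT (X n)) -> measurable_fun setT Y ->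
  (forall n w, 0 <= X n w) -> (forall n w, 0 <= U n w) ->
  (forall n w, X n w <= expR (U n w)) -> (forall w, `|Y w| <= 1) ->
  (forall n, P.-integrable setT (EFin \o X n)) ->
  (forall n, P.-integrable setT (EFin \o (fun w => X n w * U n w))) ->
  (forall n, \int[P]_w (X n w * U n w) <= K) ->
  (forall w, X n w @[n --> \oo] --> X' w) ->
  P.-integrable setT (EFin \o X') /\
  \int[P]_w (Y w * X n w) @[n --> \oo] --> \int[P]_w (Y w * X' w).
Proof.
move=> mX mY X0 U0 XU Y1 iX iXU hK Xc.
have mX' : measurable_fun setT X' by apply: (measurable_fun_cvg (h := X)) => // w _; exact: Xc.
have X'0 w : 0 <= X' w.
  have h := closed_cvg _ (@closed_ge R 0) _ (X' w) (Xc w); apply: h.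
  by apply: nearW => n; exact: X0.
have K0 : 0 <= K.
  by apply: le_trans (hK 0%N); apply: Rintegral_ge0 => w _; exact: mulr_ge0.
pose tail (V : T -> R) (L : R) w : R := V w - Num.min (V w) (expR L).
have tail0 (V : T -> R) L w : 0 <= tail V L w by rewrite subr_ge0 ge_min lexx.
have mmin (V : T -> R) (L : R) : measurable_fun setT V -> measurable_fun setT (fun w => Num.min (V w) (expR L)).
  by move=> mV; apply: measurable_minr => //; exact: measurable_cst.
have mtail (V : T -> R) L : measurable_fun setT V -> measurable_fun setT (tail V L).
  by move=> mV; apply: measurable_funB => //; exact: mmin.
have minc L w : Num.min (X n w) (expR L) @[n --> \oo] --> Num.min (X' w) (expR L).
  have cm : {for X' w, continuous (fun v : R => Num.min v (expR L))}.
    by apply: (@continuous_min _ _ id (fun=> expR L)); [exact: cvg_id|exact: cvg_cst].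
  exact: (cvg_comp _ _ (Xc w) cm).
have tailc L w : tail (X n) L w @[n --> \oo] --> tail X' L w by apply: cvgB.
have tail_le n L w : 0 < L -> tail (X n) L w <= L^-1 * (X n w * U n w).
  move=> L0; rewrite ler_pdivlMl// /tail; have [h|h] := leP (X n w) (expR L).
    by rewrite subrr mulr0 mulr_ge0.
  have LU : L <= U n w by rewrite -ler_expR (le_trans (ltW h)).
  apply: (@le_trans _ _ (L * X n w)).
    by rewrite ler_pM2l// gerBl expR_ge0.
  by rewrite mulrC ler_wpM2l.
have itail_n n L : 0 < L -> P.-integrable setT (EFin \o tail (X n) L).
  move=> L0; apply: dominated_integrable_real (iX n) _ => //; first exact: mtail.
  move=> w _; rewrite ger0_norm// gerBl le_min X0 expR_ge0//.
have Itail_n n L : 0 < L -> (\int[P]_w (tail (X n) L w)%:E <= (K / L)%:E)%E.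
  move=> L0; rewrite -(fineK (integrable_fin_num measurableT (itail_n n L L0))) lee_fin.
  apply: (@le_trans _ _ (\int[P]_w (L^-1 * (X n w * U n w)))).
    apply: le_Rintegral => //; first exact: itail_n.
      by apply: eq_integrable (integrableZl measurableT L^-1 (iXU n)).
    by move=> w _; exact: tail_le.
  by rewrite RintegralZl// mulrC ler_wpM2r// invr_ge0 ltW.
have Itail' L : 0 < L -> (\int[P]_w (tail X' L w)%:E <= (K / L)%:E)%E.
  move=> L0; apply: (integral_fatou_bound (F := fun n => tail (X n) L) (f := tail X' L)) => //.
  - by move=> n; exact: mtail.
  - by move=> n; exact: Itail_n.
have itail' L : 0 < L -> P.-integrable setT (EFin \o tail X' L).
  move=> L0; apply/integrableP; split; first by apply/measurable_EFinP; exact: mtail.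
  apply: le_lt_trans (ltry (K / L)); apply: le_trans (Itail' L L0).
  rewrite le_eqVlt; apply/orP; left; apply/eqP; apply: eq_integral => w _ /=.
  by rewrite ger0_norm.
have imin (V : T -> R) L : measurable_fun setT V -> (forall w, 0 <= V w) ->
    P.-integrable setT (EFin \o (fun w => Num.min (V w) (expR L))).
  move=> mV V0; apply: (probability_bounded_integrable P (K := expR L)); first exact: mmin.
  by move=> w; rewrite ger0_norm ?le_min ?V0 ?expR_ge0// ge_min lexx orbT.
have iX' : P.-integrable setT (EFin \o X').
  have := integrableD measurableT (itail' 1 ltr01) (imin X' 1 mX' X'0).
  by apply: eq_integrable => // w _ /=; rewrite -EFinD /tail subrK.
split=> //.
have iY (V : T -> R) : P.-integrable setT (EFin \o V) -> P.-integrable setT (EFin \o (fun w => Y w * V w)).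
  exact: weighted_integrable.
have split_ (V : T -> R) L : measurable_fun setT V -> (forall w, 0 <= V w) ->
    P.-integrable setT (EFin \o V) -> P.-integrable setT (EFin \o tail V L) ->
    (\int[P]_w (tail V L w)%:E <= (K / L)%:E)%E ->
    `|\int[P]_w (Y w * V w) - \int[P]_w (Y w * Num.min (V w) (expR L))| <= K / L.
  move=> mV V0 iV iT IT; rewrite -RintegralB//; [|exact: iY|by apply: iY; exact: imin].
  rewrite (_ : (fun w => _) = fun w => Y w * tail V L w); last first.
    by apply/funext => w; rewrite -mulrBr.
  apply: (le_trans (le_normr_Rintegral measurableT (iY _ iT))).
  rewrite -lee_fin; apply: le_trans IT.
  rewrite -[leRHS](fineK (integrable_fin_num measurableT iT)) lee_fin.
  apply: le_Rintegral => //; first exact: integrable_norm (iY _ iT).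
  by move=> w _; rewrite normrM (ger0_norm (tail0 _ _ _)) ler_piMl.
apply/cvgrPdist_le => e e0; pose L := 4 * (K + 1) / e.
have L0 : 0 < L by rewrite divr_gt0// mulr_gt0// ltr_wpDl.
have KL : K / L <= e / 4.
  rewrite /L invf_div mulrA ler_pdivrMr ?mulr_gt0 ?ltr_wpDl//.
  rewrite (_ : e / 4 * _ = e * (K + 1)); last by field.
  by rewrite mulrC ler_pM2l// lerDl.
have minI : \int[P]_w (Y w * Num.min (X n w) (expR L)) @[n --> \oo] -->
    \int[P]_w (Y w * Num.min (X' w) (expR L)).
  apply: (Rintegral_dominated_cvg (g := fun=> expR L)) => //.
  - by move=> n; apply: measurable_funM => //; exact: mmin.
  - by move=> w _; apply: cvgMl_tmp; exact: minc.
  - by apply: (probability_bounded_integrable P (K := expR L)) => // w; rewrite ger0_norm ?expR_ge0.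
  - move=> n w _; rewrite normrM -[leRHS]mul1r; apply: ler_pM => //.
    by rewrite ger0_norm ?le_min ?X0 ?expR_ge0// ge_min lexx orbT.
have /cvgrPdist_le/(_ (e / 4)) := minI; rewrite divr_gt0// => /(_ isT).
apply: filterS => n hn.
have h1 := split_ (X n) L (mX n) (X0 n) (iX n) (itail_n n L L0) (Itail_n n L L0).
have h2 := split_ X' L mX' X'0 iX' (itail' L L0) (Itail' L L0).
move: hn h1 h2; set a1 := Rintegral _ _ _; set a2 := Rintegral _ _ _.
set a3 := Rintegral _ _ _; set a4 := Rintegral _ _ _ => hn h1 h2.
rewrite (_ : a4 - a3 = (a4 - a1) + (a1 - a2) - (a3 - a2)); last by ring.
apply: (le_trans (ler_normB _ _)); apply: (le_trans (lerD (ler_normD _ _) (lexx _))).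
apply: (le_trans (lerD (lerD (le_trans h2 KL) hn) (le_trans h1 KL))).
by rewrite -!mulrDl ler_pdivrMr//; lra.
Qed.

(** * The martingale with an increasing exponential *)

Section growing.
Context (R : realType) d (T : measurableType d) (P : probability T R).
Context (Z : R -> T -> R) (alpha beta : R) (pi : {measure set R -> \bar R}).
Context (u : R -> R -> R) (theta x : R).
Local Notation Psi := (psi alpha beta pi).
Local Notation eps n := (n.+1%:R^-1 : R).
Hypothesis hbeta : 0 <= beta.
Hypothesis hpi : levy_measure pi.
Hypothesis theta0 : 0 < theta.
Hypothesis htheta : theta != 0 ->
  (\int[pi]_(l in `]1%R, +oo[) (l * expR (theta * l))%:E < +oo)%E.
Hypothesis hZ : exponential_markov P Z u.
Hypothesis hu : flow_generator Psi u.
Hypothesis x0 : 0 <= x.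
Hypothesis start : {ae P, forall w, Z 0 w = x}.

Let mZ : forall t : R, 0 <= t -> measurable_fun setT (Z t). Proof. by case: hZ. Qed.
Let Z0 : forall (t : R) w, 0 <= t -> 0 <= Z t w. Proof. by case: hZ. Qed.
Let cadZ : forall w, cadlag (Z ^~ w). Proof. by case: hZ. Qed.
Let eps0 n : 0 < eps n. Proof. by rewrite invr_gt0. Qed.
Let P0 : Psi 0 = 0. Proof. exact: psi0. Qed.

Local Notation p n := (tilt theta n).
Local Notation X n t w := (expR (- eps n * Z t w)).

Let E01 n (z : R) : 0 <= z -> 0 <= expR (- eps n * z) <= 1.
Proof. by move=> z0; rewrite expR_ge0 -expR0 ler_expR mulNr oppr_le0 mulr_ge0 ?(ltW (eps0 n)). Qed.

Let X01 n t w : 0 <= t -> 0 <= X n t w <= 1.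
Proof. by move=> t0; apply: E01; exact: Z0. Qed.

Definition tilt_image n : {poly R} := \poly_(i < size (p n)) ((p n)`_i * Psi (i%:R * eps n)).

Let horner_image n e : (tilt_image n).[e] =
  \sum_(i < size (p n)) (p n)`_i * e ^+ i * Psi (i%:R * eps n).
Proof. by rewrite horner_poly; apply: eq_bigr => i _; rewrite mulrAC. Qed.

(* The absolute value only serves to make the function continuous on the whole line. *)
Definition tilt_potential n (z : R) : R :=
  - z * ((tilt_image n).[expR (- eps n * `|z|)] / (p n).[expR (- eps n * `|z|)]).

Lemma tilt_potentialE n z : 0 <= z ->
  tilt_potential n z = - z * tilt_rate alpha beta pi theta n (expR (- eps n * z)).
Proof.
move=> z0; rewrite /tilt_potential ger0_norm// horner_image tilt_generator//; last exact: E01.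
have p0 : (p n).[expR (- eps n * z)] != 0.
  by rewrite gt_eqF// tilt_gt0//; case/andP: (E01 n z0).
by rewrite mulrAC divff// mul1r.
Qed.

Let mul_image n t w : 0 <= t ->
  Z t w * (tilt_image n).[X n t w] = - (p n).[X n t w] * tilt_potential n (Z t w).
Proof.
move=> t0; rewrite tilt_potentialE ?Z0// horner_image tilt_generator//; last exact: X01.
by ring.
Qed.

Lemma tilt_potential_continuous n : continuous (tilt_potential n).
Proof.
have cE : continuous (fun z : R => expR (- eps n * `|z|)).
  move=> z; apply: continuous_comp; last exact: continuous_expR.
  by apply: cvgMl_tmp; exact: norm_continuous.
move=> z; apply: cvgM; first exact: opp_continuous.
apply: cvgM; first exact: (continuous_comp (cE z) (@continuous_horner _ _ _)).
apply: cvgV; last exact: (continuous_comp (cE z) (@continuous_horner _ _ _)).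
by rewrite gt_eqF// tilt_gt0//; case/andP: (E01 n (normr_ge0 z)).
Qed.

Local Notation C1 := (tilt_rate_const alpha beta pi theta).
Local Notation C2 := (saturation_const alpha beta pi theta).

Let C1_ge0 : 0 <= C1. Proof. exact: tilt_rate_const_ge0. Qed.

Lemma tilt_potential_le n z : 0 <= z -> `|tilt_potential n z| <= C1 * saturation (eps n) z.
Proof.
move=> z0; rewrite tilt_potentialE// normrM normrN (ger0_norm z0).
apply: (le_trans (ler_wpM2l z0 (tilt_rate_bound alpha hbeta hpi theta0 htheta n (E01 n z0)))).
by rewrite mulrCA ler_wpM2l// saturation_ge.
Qed.

Let sat_bound n z : 0 <= z -> `|saturation (eps n) z| <= (eps n)^-1.
Proof.
move=> z0; by rewrite ger0_norm ?saturation_ge0// -[leRHS]mul1r ler_pM2r ?invr_gt0//.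
Qed.

Let pot_bound n z : 0 <= z -> `|tilt_potential n z| <= C1 * (eps n)^-1.
Proof.
move=> z0; apply: (le_trans (tilt_potential_le n z0)); rewrite ler_wpM2l//.
exact: le_trans (ler_norm _) (sat_bound n z0).
Qed.

Let sat_continuous n : continuous (saturation (eps n)).
Proof.
move=> z; apply: cvgMr_tmp; apply: cvgB; first exact: cvg_cst.
by apply: continuous_comp; [exact: continuous_lin|exact: continuous_expR].
Qed.

Let J n t w : R := \int[lebesgue_measure]_(s in `[0, t]) saturation (eps n) (Z s w).
Let D n t w : R := expR (\int[lebesgue_measure]_(s in `[0, t]) tilt_potential n (Z s w)).

(** A bounded martingale of the form [g(Z_t) exp (- int (A g / g)(Z_s) ds)], where
[A] is the generator and [g] the function built on [tilt n]. *)
Definition tilted n t w : R := (p n).[X n t w] * D n t w.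

Let potential_factor n (a b : R) : 0 <= a -> exists K, adapted_factor Z a b K (D n)
  (fun t w => D n t w * tilt_potential n (Z t w)).
Proof.
move=> a0; eexists; apply: exp_factor.
exact: (path_integral_factor b a0 Z0 cadZ (@tilt_potential_continuous n) (@pot_bound n)).
Qed.

Lemma tilted_martingale n s t (Y : T -> R) : 0 <= s -> s <= t ->
  measurable_wrt (natural_filtration Z s) Y -> (forall w, `|Y w| <= 1) ->
  \int[P]_w (Y w * tilted n t w) = \int[P]_w (Y w * tilted n s w).
Proof.
move=> s0 st mY Y1; have [K hK] := potential_factor n t s0.
have hD := mul_factor (constant_factor t mY Y1) hK.
have H : `|\int[P]_w (Y w * D n t w * (p n).[X n t w]) -
    \int[P]_w (Y w * D n s w * (p n).[X n s w])| <= 0 * (t - s).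
  apply: (rderive_lip (f := fun t => \int[P]_w (Y w * D n t w * (p n).[X n t w]))) => //.
    exact: (poly_functional_continuous hZ hu s0 hD (eps0 n)).
  move=> r /andP[sr rt]; have r0 := le_trans s0 sr.
  exists 0; last by rewrite normr0.
  have := poly_functional_rderive hZ hu P0 s0 hD (p := p n) (eps0 n) (t := r).
  rewrite sr rt => /(_ isT); rewrite (_ : \int[P]_w _ = 0)//.
  rewrite -[RHS](expectation_cst P); apply: eq_Rintegral => w _.
  rewrite -horner_image mul_image//; ring.
move: H; rewrite mul0r normr_le0 subr_eq0 => /eqP H.
transitivity (\int[P]_w (Y w * D n t w * (p n).[X n t w])).
  by apply: eq_Rintegral => w _; rewrite /tilted; ring.
by rewrite H; apply: eq_Rintegral => w _; rewrite /tilted; ring.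
Qed.

Let C2_ge0 : 0 <= C2.
Proof.
rewrite /saturation_const !addr_ge0 ?mulr_ge0 ?(ltW theta0)//.
  by rewrite addr_ge0// mulr_ge0 ?expR_ge0 ?(ltW theta0).
by apply: Rintegral_ge0 => l /=; rewrite in_itv/= andbT; exact: levy_dominator_ge0.
Qed.

Let D_measurable n t : 0 <= t -> measurable_fun setT (D n t).
Proof.
move=> t0; have [K [m _ _ _]] := potential_factor n t (lexx 0).
by apply: (natural_measurable_fun hZ (t := t)); apply: m; rewrite t0 lexx.
Qed.

Let D_bounded n t : 0 <= t -> exists K, forall w, `|D n t w| <= K.
Proof.
move=> t0; have [K [_ b _ _]] := potential_factor n t (lexx 0).
by exists K => w; apply: b; rewrite t0 lexx.
Qed.

Let J_factor n b : exists K, adapted_factor Z 0 b K (J n) (fun t w => saturation (eps n) (Z t w)).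
Proof.
eexists; exact: (path_integral_factor b (lexx 0) Z0 cadZ (@sat_continuous n) (@sat_bound n)).
Qed.

Let J_ge0 n t w : 0 <= J n t w.
Proof. by apply: primitive_ge0 => r /andP[r0 _]; rewrite saturation_ge0// Z0. Qed.

Lemma tilted_ge0 n t w : 0 <= t -> 0 <= tilted n t w.
Proof.
move=> t0; rewrite mulr_ge0 ?expR_ge0// ltW// tilt_gt0//.
by case/andP: (X01 n w t0).
Qed.

Let tilted_measurable n t : 0 <= t -> measurable_fun setT (tilted n t).
Proof.
move=> t0; apply: measurable_funM; last exact: D_measurable.
apply: (measurableT_comp (f := horner (p n))); last exact: (measurable_exp_marginal hZ).
by apply: continuous_measurable_fun; exact: continuous_horner.
Qed.

Let p_bounded n t w : 0 <= t -> (p n).[X n t w] <= expR (theta * (eps n)^-1).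
Proof.
move=> t0; apply: (le_trans (tilt_le theta0 n (Z0 w t0))).
rewrite ler_expR ler_wpM2l ?(ltW theta0)//.
exact: le_trans (ler_norm _) (sat_bound n (Z0 w t0)).
Qed.

Let tilted_times_integrable n t (V : T -> R) (L : R) : 0 <= t -> measurable_fun setT V ->
  (forall w, `|V w| <= L) -> P.-integrable setT (EFin \o (fun w => tilted n t w * V w)).
Proof.
move=> t0 mV VL; have [K DK] := D_bounded n t0.
apply: (probability_bounded_integrable P (K := expR (theta * (eps n)^-1) * K * L)).
  by apply: measurable_funM => //; exact: tilted_measurable.
move=> w; rewrite normrM; apply: ler_pM => //; rewrite normrM; apply: ler_pM => //.
rewrite ger0_norm ?p_bounded// ltW// tilt_gt0//.
by case/andP: (X01 n w t0).
Qed.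

Let sat_measurable n t : 0 <= t -> measurable_fun setT (fun w => saturation (eps n) (Z t w)).
Proof.
move=> t0; apply: (measurableT_comp (f := saturation (eps n))); last exact: mZ.
by apply: continuous_measurable_fun; exact: sat_continuous.
Qed.

Let sat_integrable n t : 0 <= t ->
  P.-integrable setT (EFin \o (fun w => tilted n t w * saturation (eps n) (Z t w))).
Proof.
move=> t0; apply: (@tilted_times_integrable n t _ (eps n)^-1) => //; first exact: sat_measurable.
by move=> w; apply: sat_bound; exact: Z0.
Qed.

Let moment n t := \int[P]_w (tilted n t w * saturation (eps n) (Z t w)).

(** Under the measure with density [tilted n], the mean of [saturation] has a drift
bounded by [C2 * Z * expR (- Z / n)], hence by a multiple of itself. *)
Lemma moment_growth n t : 0 <= t -> moment n t <= expR (C2 * t) * moment n 0.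
Proof.
move=> t0; have [K hD] := potential_factor n t (lexx 0).
pose g := saturation_poly R n.
pose phi r := \int[P]_w (D n r w * (p n * g).[X n r w]).
have phiE r : moment n r = phi r.
  apply: eq_Rintegral => w _; rewrite /tilted hornerM horner_saturation_poly; ring.
suff H : phi t <= expR (C2 * (t - 0)) * phi 0 by rewrite !phiE; rewrite subr0 in H.
apply: (rderive_gronwall (f := phi) (C := C2) t0).
  exact: (poly_functional_continuous hZ hu (lexx 0) hD (eps0 n)).
move=> r rt; have /andP[r0 _] := rt.
have := poly_functional_rderive hZ hu P0 (lexx 0) hD (p := p n * g) (eps0 n) rt.
have := poly_derivative_integrable hZ P0 (lexx 0) hD (p n * g) (eps0 n) rt.
set I := (fun w => _) => iI hr.
exists (\int[P]_w I w) => //.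
rewrite -phiE /moment -RintegralZl//; last exact: sat_integrable.
apply: le_Rintegral => //.
  by apply: eq_integrable (integrableZl measurableT C2 (sat_integrable n r0)).
move=> w _; rewrite /I /tilted.
have e01 := X01 n w r0; have /andP[e0 e1] := e01.
have H := tilt_saturation_generator alpha hbeta hpi theta0 htheta n e01.
have D0 : 0 <= D n r w by exact: expR_ge0.
set S := \sum_(i < _) _ in H *.
have Zg := saturation_ge (Z r w) (eps0 n).
have pz := tilt_gt0 theta0 n e1.
rewrite hornerM horner_saturation_poly in H *.
have mi := mul_image n w r0; rewrite horner_image tilt_generator// in mi.
set rho := tilt_rate _ _ _ _ _ _ in H mi; set g' := saturation _ _ in H Zg *.
have E : (p n).[X n r w] * g' * (D n r w * tilt_potential n (Z r w)) =
    - (g' * D n r w * (Z r w * ((p n).[X n r w] * rho))).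
  by rewrite mi; ring.
rewrite E [leLHS](_ : _ = Z r w * D n r w * (S - g' * ((p n).[X n r w] * rho))); last by ring.
apply: (le_trans (ler_wpM2l (mulr_ge0 (Z0 w r0) D0) H)).
rewrite [leLHS](_ : _ = C2 * ((p n).[X n r w] * D n r w * (Z r w * X n r w))); last by ring.
by rewrite ler_wpM2l// ler_wpM2l// mulr_ge0// ltW.
Qed.

Lemma moment_start n : moment n 0 <= expR (theta * x) * x.
Proof.
pose F z := (p n).[expR (- eps n * z)] * saturation (eps n) z.
rewrite (_ : moment n 0 = F x).
  have h1 := tilt_le theta0 n x0; have h2 := saturation_le x (eps0 n).
  apply: ler_pM => //; first by rewrite ltW// tilt_gt0//; case/andP: (E01 n x0).
    exact: saturation_ge0.
  by apply: (le_trans h1); rewrite ler_expR ler_wpM2l// ltW.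
rewrite -[RHS](expectation_cst P) /moment /Rintegral; congr fine; apply: ae_eq_integral => //.
- have := sat_integrable n (lexx 0); by case/integrableP.
- case: start => N [mN N0 sN]; exists N; split => // w /= h; apply: sN => /= e; apply: h => _.
  by rewrite /tilted /D primitive0 expR0 mulr1 e.
Qed.

Let mass : R := expR (theta * x) * x.

Lemma moment_bound n r t : 0 <= r -> r <= t -> moment n r <= expR (C2 * t) * mass.
Proof.
move=> r0 rt; apply: (le_trans (moment_growth n r0)).
have m0 : 0 <= moment n 0.
  by apply: Rintegral_ge0 => w _; rewrite mulr_ge0 ?tilted_ge0 ?saturation_ge0 ?Z0.
apply: ler_pM; rewrite ?expR_ge0//; first by rewrite ler_expR ler_wpM2l.
exact: moment_start.
Qed.

Let J_bounded n t : 0 <= t -> measurable_fun setT (J n t) /\ exists L, forall w, `|J n t w| <= L.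
Proof.
move=> t0; have [K [m b _ _]] := J_factor n t.
have tt : 0 <= t <= t by rewrite t0 lexx.
by split; [exact: (natural_measurable_fun hZ (m t tt))|exists K => w; exact: b].
Qed.

(** [tilted n * J n] grows in mean only through the change of [J n]. *)
Lemma occupation_bound n t : 0 <= t ->
  \int[P]_w (tilted n t w * J n t w) <= expR (C2 * t) * mass * t.
Proof.
move=> t0; have [K hD] := potential_factor n t (lexx 0).
have [L hJ] := J_factor n t; have hDJ := mul_factor hD hJ.
pose phi r := \int[P]_w (D n r w * J n r w * (p n).[X n r w]).
have phiE r : \int[P]_w (tilted n r w * J n r w) = phi r.
  by apply: eq_Rintegral => w _; rewrite /tilted; ring.
have phi0 : phi 0 = 0.
  rewrite -[RHS](expectation_cst P); apply: eq_Rintegral => w _.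
  by rewrite /J primitive0 mulr0 mul0r.
suff H : phi t - phi 0 <= expR (C2 * t) * mass * (t - 0).
  by move: H; rewrite phi0 !subr0 phiE.
apply: (rderive_upper (f := phi) t0).
  exact: (poly_functional_continuous hZ hu (lexx 0) hDJ (eps0 n)).
move=> r rt; have /andP[r0 rt'] := rt.
have := poly_functional_rderive hZ hu P0 (lexx 0) hDJ (p := p n) (eps0 n) rt.
move=> hr; eexists; first exact: hr.
rewrite (_ : \int[P]_w _ = moment n r); first exact: moment_bound (ltW rt').
apply: eq_Rintegral => w _; rewrite -horner_image /tilted.
rewrite mul_image//; ring.
Qed.

(** Dominates the logarithm of [tilted n t]. *)
Let U n t w : R := theta * saturation (eps n) (Z t w) + C1 * J n t w.

Let tilted_le n t w : 0 <= t -> tilted n t w <= expR (U n t w).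
Proof.
move=> t0; rewrite /U expRD; apply: ler_pM; rewrite ?expR_ge0//.
- by rewrite ltW// tilt_gt0//; case/andP: (X01 n w t0).
- exact: tilt_le (Z0 w t0).
rewrite ler_expR.
have rs : right_regular t (fun s => saturation (eps n) (Z s w)).
  exact: (right_regular_marginals Z0 cadZ t w (@sat_continuous n) (@sat_bound n)).
have rp : right_regular t (fun s => tilt_potential n (Z s w)).
  exact: (right_regular_marginals Z0 cadZ t w (@tilt_potential_continuous n) (@pot_bound n)).
rewrite /J -RintegralZl//; last exact: right_regular_integrable rs.
apply: le_Rintegral => //.
- exact: right_regular_integrable rp.
- exact: right_regular_integrable (right_regularZ C1 rs).
move=> s /=; rewrite in_itv/= => /andP[s0 _].
exact: le_trans (ler_norm _) (tilt_potential_le n (Z0 w s0)).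
Qed.

Let entropy_bound n t : 0 <= t ->
  P.-integrable setT (EFin \o (fun w => tilted n t w * U n t w)) /\
  \int[P]_w (tilted n t w * U n t w) <=
    theta * (expR (C2 * t) * mass) + C1 * (expR (C2 * t) * mass * t).
Proof.
move=> t0; have [mJ [L JL]] := J_bounded n t0.
have iJ := @tilted_times_integrable n t _ L t0 mJ JL.
have iS := sat_integrable n t0.
have iJ' : P.-integrable setT (EFin \o (fun w => C1 * (tilted n t w * J n t w))).
  by apply: eq_integrable (integrableZl measurableT C1 iJ).
have iS' : P.-integrable setT (EFin \o (fun w =>
    theta * (tilted n t w * saturation (eps n) (Z t w)))).
  by apply: eq_integrable (integrableZl measurableT theta iS).
have UE : (fun w => tilted n t w * U n t w) = (fun w =>
    theta * (tilted n t w * saturation (eps n) (Z t w)) + C1 * (tilted n t w * J n t w)).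
  by apply/funext => w; rewrite /U; ring.
rewrite UE; split; first by apply: eq_integrable (integrableD measurableT iS' iJ').
rewrite RintegralD// !RintegralZl//; apply: lerD.
  by rewrite ler_wpM2l ?(ltW theta0)//; exact: moment_bound.
by rewrite ler_wpM2l// occupation_bound.
Qed.

Local Notation W := (exp_functional Z Psi (- theta) (- theta)).

Let tilted_cvg t w : 0 <= t -> tilted n t w @[n --> \oo] --> W t w.
Proof.
move=> t0; have z0 := Z0 w t0.
have rr : right_regular t (Z ^~ w) by exact: cadlag_right_regular.
have [_ [B HB]] := rr.
have I : \int[lebesgue_measure]_(s in `[0, t]) tilt_potential n (Z s w) @[n --> \oo] -->
    \int[lebesgue_measure]_(s in `[0, t]) (- Psi (- theta) * Z s w).
  apply: (Rintegral_dominated_cvg (g := fun=> C1 * B)) => //.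
  - move=> n; apply: right_regular_measurable.
    exact: (right_regular_marginals Z0 cadZ t w (@tilt_potential_continuous n) (@pot_bound n)).
  - move=> s /=; rewrite in_itv/= => /andP[s0 st]; have zs := Z0 w s0.
    rewrite (_ : (fun n => _) = fun n =>
      - Z s w * tilt_rate alpha beta pi theta n (expR (- eps n * Z s w))); last first.
      by apply/funext => n; rewrite tilt_potentialE.
    rewrite mulNr mulrC -mulNr; apply: cvgMl_tmp; apply: tilt_rate_cvg => //.
      by move=> n; exact: E01.
    exact: expR_harmonic_cvg.
  - apply: (bounded_integrable (B := `|C1 * B|)) => //; exact: lebesgue_itv_lty.
  - move=> n s /=; rewrite in_itv/= => /andP[s0 st]; have zs := Z0 w s0.
    apply: (le_trans (tilt_potential_le n zs)); rewrite ler_wpM2l//.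
    apply: (le_trans (saturation_le _ (eps0 n))).
    by have := HB s; rewrite s0 st => /(_ isT); rewrite ger0_norm.
rewrite (_ : W t w = expR (theta * Z t w) *
    expR (\int[lebesgue_measure]_(s in `[0, t]) (- Psi (- theta) * Z s w))); last first.
  rewrite -expRD /exp_functional RintegralZl//; last exact: right_regular_integrable.
  by congr expR; ring.
apply: cvgM; first exact: tilt_cvg.
exact: (cvg_comp _ _ I (@continuous_expR R _)).
Qed.

Let growing_cvg t (Y : T -> R) : 0 <= t -> measurable_fun setT Y -> (forall w, `|Y w| <= 1) ->
  P.-integrable setT (EFin \o W t) /\
  \int[P]_w (Y w * tilted n t w) @[n --> \oo] --> \int[P]_w (Y w * W t w).
Proof.
move=> t0 mY Y1.
apply: (entropy_cvg (X := fun n => tilted n t) (U := fun n => U n t)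
  (K := theta * (expR (C2 * t) * mass) + C1 * (expR (C2 * t) * mass * t))) => //.
- by move=> n; exact: tilted_measurable.
- by move=> n w; exact: tilted_ge0.
- move=> n w; rewrite addr_ge0// mulr_ge0// ?(ltW theta0)// saturation_ge0// Z0//.
- by move=> n w; exact: tilted_le.
- move=> n; have h1 (w : T) : `|(1 : R)| <= 1 by rewrite normr1.
  have := @tilted_times_integrable n t _ 1 t0 (measurable_cst _) h1.
  by apply: eq_integrable => // w _ /=; rewrite mulr1.
- by move=> n; case: (entropy_bound n t0).
- by move=> n; case: (entropy_bound n t0).
- by move=> w; exact: tilted_cvg.
Qed.

Lemma exp_functional_integrable_growing t : 0 <= t -> P.-integrable setT (EFin \o W t).
Proof.
move=> t0; have h1 (w : T) : `|(1 : R)| <= 1 by rewrite normr1.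
by case: (growing_cvg t0 (measurable_cst _) h1).
Qed.

Lemma exp_functional_martingale_growing s t (Y : T -> R) : 0 <= s -> s <= t ->
  measurable_wrt (natural_filtration Z s) Y -> (forall w, `|Y w| <= 1) ->
  \int[P]_w (Y w * W t w) = \int[P]_w (Y w * W s w).
Proof.
move=> s0 st mY Y1; have t0 := le_trans s0 st.
have mY' := natural_measurable_fun hZ mY.
have [_ Lt] := growing_cvg t0 mY' Y1; have [_ Ls] := growing_cvg s0 mY' Y1.
have {}Ls : \int[P]_w (Y w * tilted n t w) @[n --> \oo] --> \int[P]_w (Y w * W s w).
  rewrite (_ : (fun n => _) = fun n => \int[P]_w (Y w * tilted n s w)); first exact: Ls.
  by apply/funext => n; exact: tilted_martingale.
exact: (cvg_unique (@norm_hausdorff R R) Lt Ls).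
Qed.

End growing.

(** * Completions *)

Lemma is_CB_markov (R : realType) d (T : measurableType d) (f : R -> R) (x : R)
    (P : probability T R) (Z : R -> T -> R) :
  is_CB f x P Z -> exists2 u, laplace_exponent f u & exponential_markov P Z u.
Proof.
move=> [mZ Z0 cadZ _ [u [p [hu _ hp hM]]]]; exists u => //; split=> //.
by move=> s h lam Y s0 h0 l0 mY Y0; exact: (markov_laplace mZ Z0 hp hM).
Qed.

Section completion.
Context (R : realType) d (T : measurableType d) (P : probability T R).
Implicit Types (A B C : set T) (F : T -> R).

Lemma integral_modulo_null A B C F : measurable A -> measurable B -> measurable C ->
  P C = 0%E -> A `+` B `<=` C -> measurable_fun setT F ->
  (\int[P]_(w in A) (F w)%:E = \int[P]_(w in B) (F w)%:E)%E.
Proof.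
move=> mA mB mN C0 AB mF.
have setE D : (\int[P]_(w in D) (F w)%:E = \int[P]_w (F w * \1_D w)%:E)%E.
  rewrite integral_mkcond; apply: eq_integral => w _.
  by rewrite /patch indicE; case: ifP; rewrite ?mulr1 ?mulr0.
have mC D : measurable D -> measurable_fun setT (fun w => (F w * \1_D w)%:E).
  move=> mD; apply/measurable_EFinP; apply: measurable_funM => //; exact: measurable_indic.
rewrite !setE; apply: ae_eq_integral => //; [exact: mC|exact: mC|].
exists C; split => // w /= h; apply: contrapT => nN; apply: h => _.
congr (_ * _)%:E; rewrite !indicE; congr ((nat_of_bool _)%:R).
apply/idP/idP => /set_mem hw; apply/mem_set; apply: contrapT => nw; apply: nN; apply: AB.
  by left.
by right.
Qed.

Lemma measure_modulo_null A B C : measurable A -> measurable B -> measurable C ->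
  P C = 0%E -> A `+` B `<=` C -> P A = P B.
Proof.
move=> mA mB mN C0 AB.
have := integral_modulo_null mA mB mN C0 AB (measurable_cst (1 : R)).
have one D : measurable D -> (\int[P]_(w in D) (cst (1 : R) w)%:E = P D)%E.
  by move=> mD; have := integral_cst P mD 1%E; rewrite mul1e.
by rewrite !one.
Qed.

Lemma sub_completion (N G : set (set T)) : N set0 -> G `<=` measurable ->
  G `<=` completion P N G.
Proof.
move=> N0 Gm A GA; split; first exact: Gm.
by exists A, set0; split; rewrite ?measure0// setYK.
Qed.

Lemma integral_indicator_set A F :
  P.-integrable setT (EFin \o F) -> measurable A ->
  (\int[P]_(w in A) (F w)%:E = (\int[P]_w (\1_A w * F w))%:E)%E.
Proof.
move=> iF mA.
have iAF : P.-integrable setT (EFin \o (fun w => \1_A w * F w)).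
  apply: weighted_integrable iF; first exact: measurable_indic.
  by move=> w; exact: norm_indic_le1.
rewrite /Rintegral fineK; last exact: integrable_fin_num iAF.
rewrite [LHS]integral_mkcond; apply: eq_integral => w _.
by rewrite /patch /= indicE; case: ifP; rewrite ?mul1r ?mul0r.
Qed.

End completion.

Section completed_filtrations.
Context (R : realType) d (T : measurableType d) (P : probability T R).
Variable Z : R -> T -> R.
Hypothesis mZ : forall t : R, 0 <= t -> measurable_fun setT (Z t).

Let nat_meas a : natural_filtration Z a `<=` measurable.
Proof. by move=> A; exact: natural_filtration_measurable. Qed.

Let nat0 a : natural_filtration Z a set0.
Proof. by case: (smallest_sigma_algebra setT (past_events Z a)). Qed.

Lemma completion_martingale (M : R -> T -> R) (N : R -> set (set T)) :
  (forall a, 0 <= a -> measurable_wrt (natural_filtration Z a) (M a)) ->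
  (forall a, 0 <= a -> P.-integrable setT (EFin \o M a)) ->
  (forall s t Y, 0 <= s -> s <= t -> measurable_wrt (natural_filtration Z s) Y ->
     (forall w, `|Y w| <= 1) -> \int[P]_w (Y w * M t w) = \int[P]_w (Y w * M s w)) ->
  (forall a, N a set0) -> (forall a, N a `<=` measurable) ->
  martingale P (fun a => completion P (N a) (natural_filtration Z a)) M.
Proof.
move=> mM iM hM N0 Nm; split=> //.
  by move=> a a0; apply: measurable_wrt_sub (mM a a0); exact: sub_completion.
move=> s t A s0 st [mA [B [C [FB NC PC AB]]]]; have t0 := le_trans s0 st.
have mB := nat_meas FB; have mC := Nm _ _ NC.
have mMr r : 0 <= r -> measurable_fun setT (M r).
  by move=> r0; apply/measurable_EFinP; case/integrableP: (iM r r0).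
rewrite (integral_modulo_null mA mB mC PC AB (mMr t t0)).
rewrite (integral_modulo_null mA mB mC PC AB (mMr s s0)).
rewrite (integral_indicator_set (iM t t0) mB) (integral_indicator_set (iM s s0) mB).
congr (_%:E); apply: hM => //.
  by apply/measurable_wrt_naturalP; apply: measurable_indic.
by move=> w; exact: norm_indic_le1.
Qed.

(** A null set of the past of [a] for [P] is one for [Q] as well, so the identity
does not notice the completion. *)
Lemma completion_density (Q : probability T R) (a : R) (M : T -> R) :
  measurable_wrt (natural_filtration Z a) M ->
  (forall A, natural_filtration Z a A -> Q A = \int[P]_(w in A) (M w)%:E)%E ->
  dominated_on (completed_filtration P Z a) Q P /\
  density_on (completed_filtration P Z a) Q P M.
Proof.
move=> mM QM.
have mM' : measurable_fun setT M.
  by move=> _ B mB; rewrite setTI; apply: nat_meas; exact: mM.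
have null_ext A : measurable A -> P A = 0%E -> (\int[P]_(w in A) (M w)%:E = 0)%E.
  move=> mA PA; rewrite (integral_modulo_null (B := set0) mA _ mA PA _ mM')//.
    exact: integral_set0.
  by rewrite setY0.
have D A : completed_filtration P Z a A -> Q A = (\int[P]_(w in A) (M w)%:E)%E.
  move=> [mA [B [C [FB FC PC AB]]]]; have mB := nat_meas FB; have mC := nat_meas FC.
  rewrite (integral_modulo_null mA mB mC PC AB mM') -QM//.
  have : Q C = 0%E by rewrite QM// null_ext.
  by move=> QC; exact: (measure_modulo_null mA mB mC QC AB).
split; last by split=> //; apply: measurable_wrt_sub mM; apply: sub_completion.
by move=> A FA PA; rewrite D//; apply: null_ext => //; case: FA.
Qed.

End completed_filtrations.

(** * The exponential process *)

Section exp_process.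
Context (R : realType) d (T : measurableType d).
Context (Z : R -> T -> R) (f : R -> R) (q x : R).

Lemma exp_processE a w :
  exp_process f q x Z a w = expR (q * x) * exp_functional Z f q q a w.
Proof. by rewrite /exp_process /exp_functional -expRD; congr expR; ring. Qed.

Lemma exp_process_adapted a : 0 <= a -> (forall w, cadlag (Z ^~ w)) ->
  measurable_wrt (natural_filtration Z a) (exp_process f q x Z a).
Proof.
move=> a0 cadZ; apply/measurable_wrt_naturalP; apply: measurableT_comp.
  exact: measurable_expR.
have aa : 0 <= a <= a by rewrite a0 lexx.
apply: measurable_funB.
  apply: measurable_funB; first exact: measurable_cst.
  apply: measurable_funM; first exact: measurable_cst.
  by apply/measurable_wrt_naturalP; exact: measurable_wrt_marginal.
apply: measurable_funM; first exact: measurable_cst.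
apply/measurable_wrt_naturalP; apply: (measurable_wrt_path_integral (g := id)) => //.
by move=> w; exact: cadlag_right_regular.
Qed.

End exp_process.

(** For negative [q] the two processes exchange their roles. *)
Lemma shift_mechanismK (R : realType) (f : R -> R) (q : R) : f 0 = 0 ->
  shift_mechanism (shift_mechanism f q) (- q) = f.
Proof.
move=> f0; apply/funext => lam.
by rewrite /shift_mechanism subrK addNr f0; ring.
Qed.

Section branching.
Context (R : realType) (alpha beta : R) (pi : {measure set R -> \bar R}) (q : R).
Local Notation Psi := (psi alpha beta pi).
Hypothesis hbeta : 0 <= beta.
Hypothesis hpi : levy_measure pi.
Hypothesis hq : 0 <= q \/
  (q < 0 /\ (\int[pi]_(l in `]1%R, +oo[) (l * expR (`|q| * l))%:E < +oo)%E).

Let hq' (q0 : q < 0) : - q != 0 ->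
  (\int[pi]_(l in `]1%R, +oo[) (l * expR (- q * l))%:E < +oo)%E.
Proof.
move=> _; case: hq => [/(lt_le_trans q0)|[_]]; first by rewrite ltxx.
by rewrite ltr0_norm.
Qed.

Lemma psi_convex_half_line : convex_on_half_line Psi.
Proof.
move=> y z t y0 z0; have h0 : (0 : R) != 0 -> (\int[pi]_(l in `]1%R, +oo[) (l * expR (0 * l))%:E < +oo)%E.
  by rewrite eqxx.
by apply: (psi_convex alpha hbeta hpi (lexx 0) h0); rewrite ?oppr0.
Qed.

Lemma psi_shift_convex : q < 0 -> convex_on_half_line (shift_mechanism Psi q).
Proof.
move=> q0 y z t y0 z0 t01; rewrite /shift_mechanism.
rewrite (_ : t * y + (1 - t) * z + q = t * (y + q) + (1 - t) * (z + q)); last by ring.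
have q0' : 0 <= - q by rewrite oppr_ge0 ltW.
have := @psi_convex _ alpha beta pi (- q) hbeta hpi q0' (hq' q0) (y + q) (z + q) t.
rewrite opprK !lerDr y0 z0 => /(_ isT isT t01).
rewrite (_ : t * (Psi (y + q) - Psi q) + (1 - t) * (Psi (z + q) - Psi q) =
  t * Psi (y + q) + (1 - t) * Psi (z + q) - Psi q); last by ring.
by rewrite lerD2r.
Qed.

Context d (T : measurableType d) (P : probability T R) (Z : R -> T -> R) (x : R).
Hypothesis x0 : 0 <= x.
Hypothesis hZ : is_CB Psi x P Z.

Let P0 : Psi 0 = 0. Proof. exact: psi0. Qed.
Let mZ : forall t : R, 0 <= t -> measurable_fun setT (Z t). Proof. by case: hZ. Qed.
Let cadZ : forall w, cadlag (Z ^~ w). Proof. by case: hZ. Qed.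
Let start : {ae P, forall w, Z 0 w = x}. Proof. by case: hZ. Qed.

Local Notation W := (exp_functional Z Psi q q).
Local Notation M := (exp_process Psi q x Z).

Lemma exp_functional_mean_constant :
  (forall t, 0 <= t -> P.-integrable setT (EFin \o W t)) /\
  (forall s t (Y : T -> R), 0 <= s -> s <= t -> measurable_wrt (natural_filtration Z s) Y ->
     (forall w, `|Y w| <= 1) -> \int[P]_w (Y w * W t w) = \int[P]_w (Y w * W s w)).
Proof.
have [u hu hm] := is_CB_markov hZ.
have hg := laplace_exponent_generator psi_convex_half_line P0 hu.
have [q0|q0] := leP 0 q.
  split; first exact: (exp_functional_integrable_ge0 hm psi_convex_half_line P0 hg q0).
  exact: (exp_functional_martingale_q hm psi_convex_half_line P0 hg q0).
have q0' : 0 < - q by rewrite oppr_gt0.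
have h1 := exp_functional_integrable_growing hbeta hpi q0' (hq' q0) hm hg x0 start.
have h2 := exp_functional_martingale_growing hbeta hpi q0' (hq' q0) hm hg x0 start.
by rewrite opprK in h1 h2.
Qed.

Lemma exp_process_integrable t : 0 <= t -> P.-integrable setT (EFin \o M t).
Proof.
move=> t0; have [iW _] := exp_functional_mean_constant.
apply: eq_integrable (integrableZl measurableT (expR (q * x)) (iW t t0)) => //.
by move=> w _ /=; rewrite exp_processE.
Qed.

Lemma exp_process_mean_constant s t (Y : T -> R) : 0 <= s -> s <= t ->
  measurable_wrt (natural_filtration Z s) Y -> (forall w, `|Y w| <= 1) ->
  \int[P]_w (Y w * M t w) = \int[P]_w (Y w * M s w).
Proof.
move=> s0 st mY Y1; have [iW hW] := exp_functional_mean_constant; have t0 := le_trans s0 st.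
have mY' : measurable_fun setT Y.
  by move=> _ B mB; rewrite setTI; apply: natural_filtration_measurable mZ _; exact: mY.
have E r : 0 <= r -> \int[P]_w (Y w * M r w) = expR (q * x) * \int[P]_w (Y w * W r w).
  move=> r0; rewrite -RintegralZl//.
    by apply: eq_Rintegral => w _; rewrite exp_processE; ring.
  exact: weighted_integrable mY' Y1 (iW r r0).
exact: etrans (E t t0) (etrans (congr1 _ (hW s t Y s0 st mY Y1)) (esym (E s s0))).
Qed.

Lemma exp_process_martingale (N : R -> set (set T)) :
  (forall a, N a set0) -> (forall a, N a `<=` measurable) ->
  martingale P (fun a => completion P (N a) (natural_filtration Z a)) M.
Proof.
apply: (completion_martingale mZ); first by move=> a a0; exact: exp_process_adapted.
  exact: exp_process_integrable.
exact: exp_process_mean_constant.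
Qed.

(** For [q < 0] the mechanism of [P] is the shift by [- q] of that of [Q], so the
nonnegative case gives the density [1 / M] of [P] with respect to [Q], and this
is inverted on the past of [a]. *)
Lemma exp_process_density (Q : probability T R) (a : R) : 0 <= a ->
  is_CB (shift_mechanism Psi q) x Q Z -> forall A, natural_filtration Z a A ->
  (Q A = \int[P]_(w in A) (M a w)%:E)%E.
Proof.
move=> a0 hQ A FA.
have mA : measurable A by exact: natural_filtration_measurable mZ FA.
have [u hu hm] := is_CB_markov hZ; have [u' hu' hm'] := is_CB_markov hQ.
have hg := laplace_exponent_generator psi_convex_half_line P0 hu.
have startQ : {ae Q, forall w, Z 0 w = x} by case: hQ.
have [q0|q0] := leP 0 q.
  rewrite (integral_indicator_set (exp_process_integrable a0) mA).
  rewrite -[LHS]fineK ?fin_num_measure//; congr (_%:E).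
  rewrite (girsanov_natural hm psi_convex_half_line P0 hg q0 hm' hu' start startQ a0 FA).
  have [iW _] := exp_functional_mean_constant.
  rewrite -RintegralZl//.
    by apply: eq_Rintegral => w _; rewrite exp_processE; ring.
  apply: weighted_integrable (iW a a0); first exact: measurable_indic.
  by move=> w; exact: norm_indic_le1.
have q0' : 0 <= - q by rewrite oppr_ge0 ltW.
have cf := psi_shift_convex q0.
have f0 : shift_mechanism Psi q 0 = 0 by rewrite /shift_mechanism add0r subrr.
have hg' := laplace_exponent_generator cf f0 hu'.
have hu2 : laplace_exponent (shift_mechanism (shift_mechanism Psi q) (- q)) u.
  by rewrite shift_mechanismK.
have G := girsanov_natural hm' cf f0 hg' q0' hm hu2 startQ start a0.
have inv w : expR (- q * x) * exp_functional Z (shift_mechanism Psi q) (- q) (- q) a w =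
    (M a w)^-1.
  rewrite /exp_process /exp_functional -expRN -expRD /shift_mechanism addNr P0.
  by congr expR; ring.
have mM : measurable_fun setT (M a).
  by apply/measurable_EFinP; case/integrableP: (exp_process_integrable a0).
have mMV : measurable_fun setT (fun w => (M a w)^-1).
  rewrite (_ : (fun w => _) = fun w => expR (- q * x) *
    exp_functional Z (shift_mechanism Psi q) (- q) (- q) a w); last first.
    by apply/funext => w; rewrite inv.
  apply: measurable_funM; first exact: measurable_cst.
  exact: (exp_functional_measurable _ _ hm').
have iW' := exp_functional_integrable_ge0 hm' cf f0 hg' q0' a0.
have iMV : Q.-integrable setT (EFin \o (fun w => (M a w)^-1)).
  apply: eq_integrable (integrableZl measurableT (expR (- q * x)) iW') => //.
  by move=> w _ /=; rewrite -inv.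
have dens B : natural_filtration Z a B ->
    (\int[P]_(w in B) (cst (1 : R) w)%:E = \int[Q]_(w in B) ((M a w)^-1)%:E)%E.
  move=> FB; have mB : measurable B by exact: natural_filtration_measurable mZ FB.
  have := integral_cst P mB 1%E; rewrite mul1e => ->.
  rewrite (integral_indicator_set iMV mB) -[LHS]fineK ?fin_num_measure//; congr (_%:E).
  rewrite (G B FB) -RintegralZl//.
    by apply: eq_Rintegral => w _; rewrite -inv; ring.
  apply: weighted_integrable iW'; first exact: measurable_indic.
  by move=> w; exact: norm_indic_le1.
have M0 w : 0 <= M a w by exact: expR_ge0.
have wY : measurable_wrt (natural_filtration Z a) (fun w => \1_A w * M a w).
  apply/measurable_wrt_naturalP; apply: measurable_funM.
    by apply: measurable_indic.
  by apply/measurable_wrt_naturalP; exact: exp_process_adapted.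
have H := @integral_sub_algebra_ext _ _ _ P Q (past_events Z a) (cst 1) (fun w => (M a w)^-1)
  (fun w => \1_A w * M a w) (fun B => natural_filtration_measurable mZ) (measurable_cst _) mMV
  _ _ dens wY _.
have E : (\int[P]_w (\1_A w * M a w * 1)%:E = \int[Q]_w (\1_A w * M a w * (M a w)^-1)%:E)%E.
  apply: H => w //=; first by rewrite invr_ge0.
  by rewrite mulr_ge0// indicE.
have : (\int[Q]_w (\1_A w * M a w * (M a w)^-1)%:E = Q A)%E.
  transitivity (\int[Q]_w (\1_A w)%:E)%E; last by rewrite integral_indic// setIT.
  apply: eq_integral => w _.
  by have M1 : M a w != 0 := lt0r_neq0 (expR_gt0 _); rewrite (mulfK M1).
rewrite -E => <-; rewrite [RHS]integral_mkcond; apply: eq_integral => w _.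
by rewrite /patch indicE; case: ifP; rewrite ?mulr1 ?mul1r ?mul0r.
Qed.

End branching.

Unset Implicit Arguments.

Theorem theorem2p2 (R : realType) (alpha beta : R)
    (pi : {measure set R -> \bar R}) (q : R)
    (hbeta : 0 <= beta) (hpi : levy_measure pi)
    (hcons : conservative (psi alpha beta pi))
    (hnontriv : beta <> 0 \/ pi `]0, +oo[%classic <> 0%E)
    (hq : 0 <= q \/
          (q < 0 /\ (\int[pi]_(l in `]1%R, +oo[) (l * expR (`|q| * l))%:E < +oo)%E))
    (d : measure_display) (T : measurableType d) (P : probability T R)
    (Z : R -> T -> R) (x : R) (hx : 0 <= x)
    (hZ : is_CB (psi alpha beta pi) x P Z) :
  (martingale P (completed_filtration P Z) (exp_process (psi alpha beta pi) q x Z) /\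
   martingale P (augmented_filtration P Z) (exp_process (psi alpha beta pi) q x Z)) /\
  (forall (Q : probability T R) (a : R), 0 <= a ->
     is_CB (shift_mechanism (psi alpha beta pi) q) x Q Z ->
     dominated_on (completed_filtration P Z a) Q P /\
     density_on (completed_filtration P Z a) Q P
       (exp_process (psi alpha beta pi) q x Z a)).
Proof.
have [mZ _ cadZ _ _] := hZ.
split; first split.
- apply: (exp_process_martingale hbeta hpi hq hx hZ (N := natural_filtration Z)).
    by move=> a; case: (smallest_sigma_algebra setT (past_events Z a)).
  by move=> a A; exact: natural_filtration_measurable.
- apply: (exp_process_martingale hbeta hpi hq hx hZ (N := fun _ => measurable)) => a.
    exact: measurable0.
  exact: subset_refl.
- move=> Q a a0 hQ; apply: (completion_density mZ).
    exact: exp_process_adapted.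
  exact: (exp_process_density hbeta hpi hq hx hZ).
Qed.
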